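(* Let $X_1,\dots,X_{q+1}$ be i.i.d. random variables taking the value $0$ with probability $1/(q+1)$ and each of the values $1$ and $-1$ with probability $1/(2(1+q^{-1}))$. If $q$ is fixed and $g\to\infty$, the distribution of the trace of Frobenius $\mathrm{Tr}(\mathrm{Frob}_C)$, as $C$ ranges over the moduli space $\mathcal H_g$ of hyperelliptic curves of genus $g$ defined over $\mathbb F_q$, is that of $\sum_{i=1}^{q+1}X_i$. More precisely, for any $s\in\mathbb Z$ with $|s|\le q+1$, $$\frac{\left|\{C\in\mathcal H_g:\ \mathrm{Tr}(\mathrm{Frob}_C)=-s\}\right|'}{|\mathcal H_g|'}=\mathrm{Prob}\left(\sum_{i=1}^{q+1}X_i=s\right)\left(1+O\left(q^{(3q-2-2g)/2}\right)\right).$$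
   Context: $\mathbb F_q$ is the finite field with $q$ elements, $q$ odd. $\mathcal H_g$ denotes the set of $\mathbb F_q$-isomorphism classes of hyperelliptic curves of genus $g$ over $\mathbb F_q$ (smooth projective curves with an affine model $Y^2=F(X)$, $F\in\mathbb F_q[X]$ square-free of degree $2g+1$ or $2g+2$, not necessarily monic). The prime on a cardinality means that each curve $C$ is counted with weight $1/|\mathrm{Aut}(C)|$, where $\mathrm{Aut}(C)$ is the automorphism group over $\mathbb F_q$; thus $|\mathcal S|'=\sum_{C\in\mathcal S}1/|\mathrm{Aut}(C)|$. For a smooth projective curve $C$ of genus $g$ over $\mathbb F_q$ with zeta function $Z_C(T)=\prod_{j=1}^{2g}(1-\alpha_j(C)T)/((1-T)(1-qT))$, $\mathrm{Tr}(\mathrm{Frob}_C)=\sum_{j=1}^{2g}\alpha_j(C)=q+1-|C(\mathbb F_q)|$. The implied constant in the error term is independent of $q$ (and of $g$ and $s$). *)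

(* Defs.v *)
From HB Require Import structures.
From mathcomp Require Import all_boot all_order all_algebra.
From mathcomp Require Import finmap.
From mathcomp Require Import all_classical all_reals all_analysis.

Set Implicit Arguments.
Unset Strict Implicit.
Unset Printing Implicit Defensive.

Import Order.TTheory GRing.Theory Num.Theory.
Import numFieldNormedType.Exports.
Local Open Scope classical_set_scope.
Local Open Scope ring_scope.

Section HyperellipticCurves.
Variables (F : finFieldType) (g : nat).

(* A curve is given by an equation Y^2 = f(X); the bound 2g+3 on the size of f
   makes the type of equations finite. *)
Definition equation : finType := {poly_(2 * g + 3) F}.

Definition squarefree (f : {poly F}) : Prop :=
  forall d : {poly F}, d ^+ 2 %| f -> (size d <= 1)%N.

(* size is degree + 1. *)
Definition hyperelliptic (f : equation) : Prop :=
  (size (f : {poly F}) = (2 * g + 2)%N \/ size (f : {poly F}) = (2 * g + 3)%N)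
  /\ squarefree f.

(* The smooth projective model of Y^2 = f(X) is the curve
   y^2 = sum_i f_i x^i z^(2g+2-i) in the weighted projective plane P(1,g+1,1).
   Its rational points are the affine ones (z = 1) and those at infinity
   (x = 1, z = 0), for which y^2 is the coefficient of X^(2g+2) in f. *)
Definition affine_points (f : equation) : {set F * F} :=
  [set p : F * F | p.2 ^+ 2 == (f : {poly F}).[p.1]]%SET.

Definition infinite_points (f : equation) : {set F} :=
  [set y : F | y ^+ 2 == (f : {poly F})`_(2 * g + 2)]%SET.

Definition npoints (f : equation) : nat :=
  (#|affine_points f| + #|infinite_points f|)%N.

(* The sum of the alpha_j in Z_C(T) = prod_j (1 - alpha_j T)/((1-T)(1-qT)), read
   off from the coefficient of T in Z_C(T). *)
Definition trace_Frobenius (f : equation) : int :=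
  (#|F|.+1)%:Z - (npoints f)%:Z.

Definition function_field_modulus (f : equation) :
    {poly {fraction {poly F}}} :=
  'X^2 - (tofrac (f : {poly F}))%:P.

(* {poly %/ h} is by definition the quotient by mk_monic h. *)
Lemma mk_monic_function_field_modulus (f : equation) :
  mk_monic (function_field_modulus f) = function_field_modulus f.
Proof.
rewrite /mk_monic /function_field_modulus.
have sz : size ('X^2 - (tofrac (f : {poly F}))%:P) = 3%N.
  rewrite size_polyDl ?size_polyXn // size_polyN.
  exact: leq_ltn_trans (size_polyC_leq1 _) _.
rewrite sz monicE lead_coefDl ?size_polyXn ?size_polyN ?lead_coefXn ?eqxx //.
exact: leq_ltn_trans (size_polyC_leq1 _) _.
Qed.

(* A field when f is squarefree and nonconstant, as Y^2 - f is then irreducible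
   over F(X); only its ring structure is needed below. *)
Definition function_field (f : equation) : comNzRingType :=
  {poly %/ function_field_modulus f}.

Definition const_ff (f : equation) (c : F) : function_field f :=
  qpolyC (function_field_modulus f) (tofrac c%:P).

(* Isomorphisms over F of smooth projective curves are the isomorphisms of
   their function fields that fix the constants F. *)
Definition is_iso (f1 f2 : equation)
    (phi : function_field f1 -> function_field f2) : Prop :=
  [/\ bijective phi, GRing.zmod_morphism phi, GRing.monoid_morphism phi
    & forall c : F, phi (const_ff f1 c) = const_ff f2 c].

Definition isomorphic (f1 f2 : equation) : bool :=
  `[< exists phi : function_field f1 -> function_field f2, is_iso phi >].

Definition Aut (f : equation) : set (function_field f -> function_field f) :=
  [set phi | is_iso phi].

Arguments Aut : clear implicits.

Definition card_Aut (f : equation) : nat := #|` fset_set (Aut f)|%fset.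

Definition hyperelliptic_set : {set equation} :=
  [set f : equation | `[< hyperelliptic f >]]%SET.

(* Summing over a transversal is summing over isomorphism classes, since the
   summands used below do not depend on the representative. *)
Definition moduli : {set equation} :=
  transversal (equivalence_partition isomorphic hyperelliptic_set)
              hyperelliptic_set.

Definition weighted_card (R : realType) (S : pred equation) : R :=
  \sum_(f in moduli | S f) ((card_Aut f)%:R)^-1.

End HyperellipticCurves.

Definition trace_ratio (R : realType) (F : finFieldType) (g : nat) (s : int)
    : R :=
  weighted_card R (fun f : equation F g => trace_Frobenius f == - s)
  / weighted_card R (fun _ : equation F g => true).

Section RandomModel.
Context (R : realType) (d : measure_display) (T : measurableType d)
  (P : probability T R) (n : nat).
Variable X : 'I_n -> {RV P >-> R}.

Definition mutually_independent : Prop :=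
  forall (J : {set 'I_n}) (B : 'I_n -> set R),
    (forall i, measurable (B i)) ->
    P (\bigcap_(i in [set i | i \in J]) X i @^-1` B i)
    = (\prod_(i in J) P (X i @^-1` B i))%E.

Definition prob_sum (s : int) : R :=
  fine (P [set t | \sum_(i < n) X i t = s%:~R]).

End RandomModel.

Definition iid_trace_variables (R : realType) (q : nat) (d : measure_display)
    (T : measurableType d) (P : probability T R)
    (X : 'I_q.+1 -> {RV P >-> R}) : Prop :=
  mutually_independent X /\
  forall i : 'I_q.+1,
    [/\ P [set t | X i t = 0] = ((q%:R + 1)^-1)%:E,
        P [set t | X i t = 1] = ((2 * (1 + q%:R^-1))^-1)%:E
      & P [set t | X i t = - 1] = ((2 * (1 + q%:R^-1))^-1)%:E].

(* Main.v *)
(* If Y^2 = F(X) and F is seen as a form of degree n = 2g + 2, then -Tr(Frob) is the sum over the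
   q + 1 rational points of the projective line of the quadratic characters of the values of F.

   For g >= 2 the subfield F_q(X) of the function field is intrinsic. Indeed, if u has degree 2
   and lies outside F_q(X), then its primitive equation over F_q[X] has discriminant F times a
   square, hence X-degree at least 3, while X is quadratic over F_q(u); Gauss' lemma forbids this.
   So all isomorphisms are X -> (aX+b)/(cX+d), Y -> eY/(cX+d)^(g+1), their number starting from
   a given curve does not depend on the curve, and the weighted count of isomorphism classes is
   proportional to the plain count of squarefree forms.

   Squarefree forms with a given sign pattern eps at the rational points are counted by a sieve.
   A form without double rational zeros is uniquely D^2 h with D monic without rational roots and
   h squarefree with the same pattern, so the generating functions differ by the factor
   (1 - T^2)^q / (1 - q T^2), whose inverse has explicit coefficients of size at most q^k. The
   forms without double rational zeros are counted by interpolation, exactly in large degree and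
   up to W(eps) in all degrees. This yields the probability of eps in the random model times a
   constant independent of eps, with an error of at most 2 q^(g+1) W(eps), where the W(eps) add up
   to (2(q-1))^(q+1).

   Dividing by the total, which is at least q^(2g+3) / 3, bounds the difference between the two
   probabilities by 12 * 2^(q+1) q^(q-1-g). As the probability of each s with |s| <= q + 1 is at
   least 4^-(q+1) / (q+1), the relative error is O((q+1) 8^q q^(q-1-g)), and (q+1) 8^q is
   O(q^(q/2)). For g = 1 the claimed bound is weaker than the trivial one. *)
Require Import Defs.
From HB Require Import structures.
From mathcomp Require Import all_boot all_order all_algebra.
From mathcomp Require Import ring lra zify.
From mathcomp Require Import finmap.
From mathcomp Require Import all_classical all_reals all_analysis.

Set Implicit Arguments.
Unset Strict Implicit.
Unset Printing Implicit Defensive.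

Import Order.TTheory GRing.Theory Num.Theory.
Import numFieldNormedType.Exports.
Local Open Scope ring_scope.

(** * Divisibility of polynomials and Gauss' lemma *)

Section PolynomialDivisibility.
Variable F : finFieldType.
Implicit Types b c d f p q : {poly F}.

Lemma squarefree_neq0 f : squarefree f -> f != 0.
Proof. by move=> sf; apply/eqP=> f0; have := sf 'X; rewrite f0 dvdp0 size_polyX => /(_ isT). Qed.

(** Divided by their gcd, [c] and [b] become coprime; the square of the cofactor of [c] then divides
    [f], so this cofactor is constant. *)
Lemma dvdp_sqr_squarefree c b f :
  squarefree f -> c ^+ 2 %| b ^+ 2 * f -> c %| b.
Proof.
move=> sf; have [->|b0] := eqVneq b 0; first by rewrite dvdp0.
have [->|c0] := eqVneq c 0.
  by rewrite expr0n /= dvd0p mulf_eq0 expf_eq0 /= (negPf b0) (negPf (squarefree_neq0 sf)).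
have cop : coprimep (c %/ gcdp c b) (b %/ gcdp c b).
  by apply: coprimep_div_gcd; rewrite b0 orbT.
have g0 : gcdp c b != 0 by rewrite gcdp_eq0 (negPf b0) andbF.
have Ec := divpK (dvdp_gcdl c b); have Eb := divpK (dvdp_gcdr c b).
rewrite -[X in X ^+ 2 %| _]Ec -[X in _ %| X ^+ 2 * _]Eb !exprMn.
rewrite [in X in _ %| X]mulrAC dvdp_mul2r ?expf_neq0 //.
rewrite Gauss_dvdpr; last by rewrite coprimep_expl // coprimep_expr.
move=> /sf sz.
have : c %/ gcdp c b %= 1.
  rewrite -size_poly_eq1 eqn_leq sz lt0n size_poly_eq0.
  by apply: contraNneq c0 => e; rewrite -Ec e mul0r.
rewrite -[X in X %| _]Ec.
by move=> /(eqp_mulr (gcdp c b)) /eqp_dvdl ->; rewrite mul1r dvdp_gcdr.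
Qed.

Lemma irreducible_factor d : (1 < size d)%N -> exists2 p, irreducible_poly p & p %| d.
Proof.
have [n] := ubnP (size d); elim: n d => // n IH d ltn d1.
have [/irreducibleP irr|] := boolP (irreducibleb d); first by exists d; rewrite ?dvdpp.
rewrite /irreducibleb d1 /= => /forallPn[q]; rewrite negb_imply => /andP[qd].
rewrite -ltnNge => q1; have d0 : d != 0 by rewrite -size_poly_gt0 (ltn_trans _ d1).
have szq : (size q < size d)%N.
  by apply: leq_ltn_trans (size_npoly q) _; rewrite -ltnS prednK // (ltn_trans _ d1).
have [p irr pq] := IH q (leq_trans szq ltn) q1.
by exists p => //; apply: dvdp_trans pq _; rewrite dvdpE.
Qed.

Lemma irreducible_dvdp_mul p b c : irreducible_poly p -> p %| b * c -> (p %| b) || (p %| c).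
Proof.
move=> irr; case: (boolP (p %| b)) => //= pb.
by rewrite Gauss_dvdpr // irreducible_poly_coprime.
Qed.

(** Gauss' argument: take the least indices at which [p] fails to divide a coefficient of [S] and of
    [P]. In the coefficient of the product at their sum, [p] divides all terms but one. *)
Lemma irreducible_dvd_coefM (p : {poly F}) (S P : {poly {poly F}}) :
  irreducible_poly p -> (forall i, p %| (S * P)`_i) -> 
  (forall i, p %| S`_i) \/ (forall i, p %| P`_i).
Proof.
move=> irr pSP.
have [/allP aS|/allPn[s /(nthP 0)[i0 _ <-] ni0]] := boolP (all (dvdp p) S).
  left=> i; have [lt|ge] := ltnP i (size S); first by apply: aS; rewrite mem_nth.
  by rewrite nth_default // dvdp0.
have [/allP aP|/allPn[s' /(nthP 0)[j0 _ <-] nj0]] := boolP (all (dvdp p) P).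
  right=> i; have [lt|ge] := ltnP i (size P); first by apply: aP; rewrite mem_nth.
  by rewrite nth_default // dvdp0.
have [i pi mi] := ex_minnP (ex_intro (fun i => ~~ (p %| S`_i)) i0 ni0).
have [j pj mj] := ex_minnP (ex_intro (fun i => ~~ (p %| P`_i)) j0 nj0).
have := pSP (i + j)%N; rewrite coefM.
have lti : (i < (i + j).+1)%N by rewrite ltnS leq_addr.
rewrite (bigD1 (Ordinal lti)) //= addKn dvdp_addl.
  by move=> /(irreducible_dvdp_mul irr); rewrite (negPf pi) (negPf pj).
apply: (big_ind (fun x => p %| x)); rewrite ?dvdp0 //; first exact: dvdp_add.
move=> k; rewrite -val_eqE /= neq_ltn => /orP[ki|ik].
  by rewrite dvdp_mulr //; apply: contraLR ki; rewrite -leqNgt; apply: mi.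
rewrite dvdp_mull //; apply: contraTT ik => /mj; rewrite -leqNgt.
have := ltn_ord k; lia.
Qed.

(* Gauss' lemma over F[X]: divisibility by a primitive P descends from F(X)[Y] to F[X][Y]. *)
Lemma gauss_primitive (d : {poly F}) (P Q S : {poly {poly F}}) :
  d != 0 -> d *: Q = S * P ->
  (forall c, (forall i, c %| P`_i) -> (size c <= 1)%N) ->
  exists S', Q = S' * P.
Proof.
move=> + + prim; have [n] := ubnP (size d).
elim: n d S => // n IH d S ltn d0 e.
have [d1|d1] := leqP (size d) 1.
  move: d0 e; rewrite (size1_polyC d1) polyC_eq0 => k0 e.
  exists ((d`_0)^-1%:P *: S); rewrite -scalerAl -e scalerA -polyCM mulVf //.
  by rewrite polyC1 scale1r.
(* As [P] is primitive, [p] divides all coefficients of [S] and can be cancelled on both sides,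
   which lowers the degree of [d]. *)
have [p irr pd] := irreducible_factor d1.
have p0 := irredp_neq0 irr.
case: (@irreducible_dvd_coefM p S P irr) => [i|pS|pP].
- by rewrite -e coefZ dvdp_mulr.
- have d'0 : d %/ p != 0 by apply: contraNneq d0 => e'; rewrite -(divpK pd) e' mul0r.
  have SE : S = p *: \poly_(i < size S) (S`_i %/ p).
    apply/polyP => i; rewrite coefZ coef_poly; case: ltnP => h; last by rewrite nth_default ?mulr0.
    by rewrite mulrC divpK.
  apply: (IH (d %/ p) (\poly_(i < size S) (S`_i %/ p))) => //.
    rewrite size_divp //; case: irr => p1 _; move: (size d) (size p) ltn d1 p1 => *; lia.
  apply: (@mulfI _ p%:P); rewrite ?polyC_eq0 // mulrA -!mul_polyC mulrA -polyCM [p * _]mulrC.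
  by rewrite divpK // !mul_polyC -SE.
- by have := prim _ pP; case: irr => p1 _; move: p1; case: ltnP.
Qed.

(** The bound on the coefficients is a bound on the degree in X, which is additive in products;
    [swapXY] turns it into a statement about [size]. *)
Lemma size_coef_dvd (P Q S : {poly {poly F}}) m :
  Q != 0 -> Q = S * P -> (forall i, (size (Q`_i)%R <= m)%N) -> forall i, (size (P`_i)%R <= m)%N.
Proof.
move=> Q0 e szQ i; apply: leq_trans (max_size_coefXY _ _) _.
have szY : (sizeY Q <= m)%N by apply/bigmax_leqP=> j _; apply: szQ.
apply: leq_trans szY; rewrite !sizeYE e rmorphM /=.
move: Q0; rewrite e mulf_eq0 negb_or => /andP[S0 P0].
rewrite size_mul ?swapXY_eq0 //.
have : size (swapXY S) != 0%N by rewrite size_poly_eq0 swapXY_eq0.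
by case: (size (swapXY S)) => // k _; rewrite addSn leq_addl.
Qed.

End PolynomialDivisibility.

(** * Fractional linear substitutions *)

Section HomogeneousEvaluation.
Variable F : fieldType.
Implicit Types f p r : {poly F}.

(* The value at (x : z) of the form of degree n whose dehomogenization is f, where n may exceed
   the degree of f. *)
Definition homog (A : comNzRingType) (h : F -> A) n f (x z : A) : A :=
  \sum_(i < n.+1) h f`_i * x ^+ i * z ^+ (n - i).

Lemma homog_morph (A B : comNzRingType) (t : {rmorphism A -> B}) (h : F -> A) n f x z :
  t (homog h n f x z) = homog (t \o h) n f (t x) (t z).
Proof. by rewrite rmorph_sum; apply: eq_bigr => i _; rewrite !rmorphM !rmorphXn. Qed.

Lemma homogMl (A : comNzRingType) (h : F -> A) n f t x z :
  homog h n f (t * x) (t * z) = t ^+ n * homog h n f x z.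
Proof.
rewrite mulr_sumr; apply: eq_bigr => i _; have /subnKC ni : (i <= n)%N by rewrite -ltnS.
rewrite -[X in t ^+ X]ni exprD !exprMn; ring.
Qed.

Lemma homog_infty (A : comNzRingType) (h : F -> A) n f x :
  homog h n f x 0 = h f`_n * x ^+ n.
Proof.
rewrite /homog big_ord_recr /= subnn expr0 mulr1 big1 ?add0r // => i _.
by rewrite expr0n subn_eq0 leqNgt ltn_ord mulr0.
Qed.

Lemma homogE (A : fieldType) (h : {rmorphism F -> A}) n f x z : z != 0 -> (size f <= n.+1)%N ->
  homog h n f x z = z ^+ n * (map_poly h f).[x / z].
Proof.
move=> z0 sz; rewrite (@horner_coef_wide _ n.+1) ?size_map_poly // mulr_sumr.
apply: eq_bigr => i _; rewrite coef_map /=.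
have /subnKC ni : (i <= n)%N by rewrite -ltnS.
rewrite -[X in _ = z ^+ X * _]ni exprD expr_div_n; field.
by rewrite expf_neq0.
Qed.

Lemma homogM (A : fieldType) (h : {rmorphism F -> A}) k l p r x z : z != 0 ->
  (size p <= k.+1)%N -> (size r <= l.+1)%N ->
  homog h (k + l) (p * r) x z = homog h k p x z * homog h l r x z.
Proof.
move=> z0 szp szr; rewrite !homogE //; first by rewrite rmorphM hornerM exprD; ring.
by apply: leq_trans (size_polyMleq _ _) _; move: (size p) (size r) szp szr; lia.
Qed.

Lemma homogZ (A : comNzRingType) (h : {rmorphism F -> A}) n c f x z :
  homog h n (c *: f) x z = h c * homog h n f x z.
Proof. by rewrite mulr_sumr; apply: eq_bigr => i _; rewrite coefZ rmorphM !mulrA. Qed.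

End HomogeneousEvaluation.

Lemma coef_top_mul (R : nzRingType) (p r : {poly R}) k l :
  (size p <= k.+1)%N -> (size r <= l.+1)%N -> (p * r)`_(k + l) = p`_k * r`_l.
Proof.
move=> szp szr; rewrite coefM.
have ltk : (k < (k + l).+1)%N by rewrite ltnS leq_addr.
rewrite (bigD1 (Ordinal ltk)) //= addKn big1 ?addr0 // => i.
rewrite -val_eqE /= neq_ltn => /orP[ik|ki].
  by rewrite [r`_ _]nth_default ?mulr0 //; apply: leq_trans szr _; lia.
by rewrite [p`_ _]nth_default ?mul0r //; apply: leq_trans szp _.
Qed.

Section Moebius.
Variable F : fieldType.
Local Notation FX := {fraction {poly F}}.
Local Notation CF := (@tofrac {poly F} \o polyC).
Implicit Types (f p r : {poly F}) (u v z : FX) (a b c d : F).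

Definition ev u p : FX := (map_poly CF p).[u].

Lemma ev_is_zmod_morphism u : zmod_morphism (ev u).
Proof. by move=> p r; rewrite /ev rmorphB hornerD hornerN. Qed.

Lemma ev_is_monoid_morphism u : monoid_morphism (ev u).
Proof. by split=> [|p r]; rewrite /ev ?rmorph1 ?hornerC // rmorphM hornerM. Qed.

HB.instance Definition _ u := GRing.isZmodMorphism.Build _ _ (ev u) (ev_is_zmod_morphism u).
HB.instance Definition _ u := GRing.isMonoidMorphism.Build _ _ (ev u) (ev_is_monoid_morphism u).

Lemma evC u c : ev u c%:P = CF c.
Proof. by rewrite /ev map_polyC hornerC. Qed.

Lemma evX u : ev u 'X = u.
Proof. by rewrite /ev map_polyX hornerX. Qed.

Lemma ev_homog u n p (x z : {poly F}) : ev u (homog polyC n p x z) = homog CF n p (ev u x) (ev u z).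
Proof. by rewrite homog_morph; apply: eq_bigr => i _; rewrite /= evC. Qed.

Lemma ev_frac p : ev (tofrac 'X) p = tofrac p.
Proof.
rewrite /ev map_poly_comp horner_map /=; congr tofrac.
by rewrite -/(p \Po 'X) comp_polyXr.
Qed.

Lemma tofrac_homog n p (x z : {poly F}) :
  tofrac (homog polyC n p x z) = homog CF n p (tofrac x) (tofrac z).
Proof. by rewrite -ev_frac ev_homog !ev_frac. Qed.

Definition lin a b : {poly F} := a *: 'X + b%:P.

Lemma size_lin a b : (size (lin a b) <= 2)%N.
Proof.
rewrite /lin; apply: leq_trans (size_polyD _ _) _; rewrite geq_max.
rewrite (leq_trans (size_scale_leq _ _)) ?size_polyX //=.
by rewrite (leq_trans (size_polyC_leq1 _)).
Qed.

Lemma coef_lin a b i : (lin a b)`_i = if i == 1%N then a else if i == 0%N then b else 0.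
Proof.
rewrite /lin coefD coefZ coefX coefC.
by case: i => [|[|i]] /=; rewrite ?mulr0 ?mulr1 ?add0r ?addr0.
Qed.

Lemma linE p : (size p <= 2)%N -> p = lin p`_1 p`_0.
Proof.
move=> sz; apply/polyP=> -[|[|i]]; rewrite coef_lin //=.
by rewrite nth_default // (leq_trans sz).
Qed.

Lemma lin_neq0 a b : (a != 0) || (b != 0) -> lin a b != 0.
Proof.
case/orP => h; apply: contraNneq h => e.
  by have := coef_lin a b 1; rewrite e coef0 /= => <-.
by have := coef_lin a b 0; rewrite e coef0 /= => <-.
Qed.

Lemma det_lin_neq0 a b c d : a * d - b * c != 0 -> lin c d != 0.
Proof.
move=> h; apply: lin_neq0; rewrite -negb_and; apply: contraNN h => /andP[/eqP-> /eqP->].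
by rewrite !mulr0 subrr.
Qed.

(* The action of a matrix on forms of degree n, in terms of the dehomogenization z = 1. *)
Definition msub a b c d n f : {poly F} := homog polyC n f (lin a b) (lin c d).

Definition moeb a b c d : FX := tofrac (lin a b) / tofrac (lin c d).

Lemma tofrac_msub a b c d n f : lin c d != 0 -> (size f <= n.+1)%N ->
  tofrac (msub a b c d n f) = tofrac (lin c d) ^+ n * ev (moeb a b c d) f.
Proof. by move=> l0 sz; rewrite tofrac_homog homogE // tofrac_eq0. Qed.

Lemma size_exp_lin a b i : (size (lin a b ^+ i) <= i.+1)%N.
Proof.
elim: i => [|i IH]; first by rewrite expr0 size_polyC oner_neq0.
rewrite exprS; apply: leq_trans (size_polyMleq _ _) _.
have := size_lin a b; move: (size _) (size _) IH; lia.
Qed.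

Lemma coef_exp_lin a b i : (lin a b ^+ i)`_i = a ^+ i.
Proof.
elim: i => [|i IH]; first by rewrite !expr0 coefC.
rewrite exprS -[in X in _`_X](add1n i) coef_top_mul ?size_lin ?size_exp_lin //.
by rewrite IH coef_lin exprS.
Qed.

Lemma size_msub a b c d n f : (size (msub a b c d n f) <= n.+1)%N.
Proof.
apply: (big_ind (fun x : {poly F} => size x <= n.+1)%N); first by rewrite size_poly0.
  by move=> x y hx hy; rewrite (leq_trans (size_polyD _ _)) // geq_max hx hy.
move=> i _; rewrite -mulrA mul_polyC; apply: leq_trans (size_scale_leq _ _) _.
apply: leq_trans (size_polyMleq _ _) _.
have := size_exp_lin a b i; have := size_exp_lin c d (n - i); have := ltn_ord i.
move: (size _) (size _); lia.
Qed.

(** The top coefficient is the value of the form at infinity, and the substitution sends (1 : 0) to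
    (a : c). *)
Lemma coef_msub a b c d n f : (msub a b c d n f)`_n = homog idfun n f a c.
Proof.
rewrite /msub /homog coef_sum; apply: eq_bigr => i _.
have /subnKC ni : (i <= n)%N by rewrite -ltnS.
rewrite -mulrA mul_polyC coefZ.
have := coef_top_mul (size_exp_lin a b i) (size_exp_lin c d (n - i)).
by rewrite ni => ->; rewrite !coef_exp_lin mulrA.
Qed.

Lemma horner_lin a b x : (lin a b).[x] = a * x + b.
Proof. by rewrite /lin hornerD hornerZ hornerX hornerC. Qed.

Lemma homog_msub a b c d n f (x z : F) : (size f <= n.+1)%N ->
  homog idfun n (msub a b c d n f) x z = homog idfun n f (a * x + b * z) (c * x + d * z).
Proof.
move=> sz; have [->|z0] := eqVneq z 0.
  rewrite homog_infty coef_msub !mulr0 !addr0 mulrC -homogMl.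
  by rewrite [x * a]mulrC [x * c]mulrC.
rewrite (@homogE _ _ idfun) ?size_msub // map_poly_id //.
have -> : (msub a b c d n f).[x / z] = homog idfun n f (a * (x / z) + b) (c * (x / z) + d).
  rewrite -!horner_lin /msub /homog horner_sum; apply: eq_bigr => i _.
  by rewrite !hornerM !horner_exp hornerC.
by rewrite -homogMl; congr homog; field.
Qed.

(** A matrix times its adjugate is det times the identity, so both linear forms acquire the same
    factor det / (a - c X). *)
Lemma moeb_inv a b c d : a * d - b * c != 0 ->
  ev (moeb d (- b) (- c) a) (lin a b) = CF (a * d - b * c) / tofrac (lin (- c) a) * tofrac 'X
  /\ ev (moeb d (- b) (- c) a) (lin c d) = CF (a * d - b * c) / tofrac (lin (- c) a).
Proof.
move=> det; have l0 : tofrac (lin (- c) a) != 0.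
  by rewrite tofrac_eq0 (@det_lin_neq0 d (-b)) // mulrNN mulrC.
have evl x y u : ev u (lin x y) = CF x * u + CF y.
  by rewrite /lin rmorphD /= -mul_polyC rmorphM /= !evC evX.
rewrite !evl /moeb !mulrA; split; apply: (mulIf l0); rewrite mulrDl.
  rewrite divfK // [RHS]mulrAC divfK // /= -!tofracM -tofracD; congr tofrac.
  by rewrite /lin -!mul_polyC !(polyCN, polyCB, polyCM); ring.
rewrite !divfK // /= -!tofracM -tofracD; congr tofrac.
by rewrite /lin -!mul_polyC !(polyCN, polyCB, polyCM); ring.
Qed.

Lemma homogX1 n f : (size f <= n.+1)%N -> homog polyC n f 'X 1 = f.
Proof.
move=> sz; rewrite -[RHS](@coefK _ f) poly_def.
rewrite (big_ord_widen _ (fun i => f`_i *: 'X^i) sz) big_mkcond.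
apply: eq_bigr => i _; rewrite expr1n mulr1 mul_polyC; case: ltnP => // h.
by rewrite nth_default // scale0r.
Qed.

(** The adjugate replaces the inverse matrix; this accounts for the scalar det^n. *)
Lemma msubK a b c d n f : a * d - b * c != 0 -> (size f <= n.+1)%N ->
  msub d (- b) (- c) a n (msub a b c d n f) = (a * d - b * c) ^+ n *: f.
Proof.
move=> det sz; have l0 : lin (- c) a != 0.
  by rewrite (@det_lin_neq0 d (-b)) // mulrNN mulrC.
apply/eqP; rewrite -tofrac_eq; apply/eqP.
rewrite tofrac_msub ?size_msub // ev_homog.
have [-> ->] := moeb_inv det.
rewrite -[X in homog _ _ _ _ X]mulr1 homogMl -[1]tofrac1 -tofrac_homog homogX1 //.
by rewrite expr_div_n mulrA mulrCA mulfV ?expf_neq0 ?tofrac_eq0 // mulr1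
  /= -tofracXn -tofracM -mul_polyC polyC_exp.
Qed.

End Moebius.

(** * Substitution in rational functions *)

Section Fractions.
Variable F : fieldType.
Local Notation FX := {fraction {poly F}}.
Local Notation CF := (@tofrac {poly F} \o polyC).
Implicit Types (f p r : {poly F}) (u v x y z : FX) (a b c d : F).

Definition fnum z : {poly F} := (frac (repr z)).1.
Definition fden z : {poly F} := (frac (repr z)).2.

Lemma fden_neq0 z : fden z != 0. Proof. exact: denom_ratioP. Qed.

Lemma fnum_fden z : z = tofrac (fnum z) / tofrac (fden z).
Proof.
have d0 : tofrac (fden z) != 0 by rewrite tofrac_eq0 fden_neq0.
apply: (mulIf d0); rewrite divfK // /fnum /fden.
rewrite -[X in X * _]reprK.
case: (repr z) => -[n d] /= d1.
(* Unfolding the quotient that defines the fraction field reduces the claim to equal cross products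
   of representatives. *)
rewrite -[tofrac d]/(FracField.tofrac d) -[tofrac n]/(FracField.tofrac n).
rewrite -[_ * _]/(FracField.mul _ _).
rewrite !piE; apply/eqmodP; rewrite /= FracField.equivfE /FracField.mulf /=.
by rewrite !numden_Ratio ?oner_eq0 ?mulr1 // mulrC.
Qed.

Lemma coprime_fraction z : exists p r, [/\ r != 0, coprimep p r & z = tofrac p / tofrac r].
Proof.
have r0 := fden_neq0 z; set g := gcdp (fnum z) (fden z).
have g0 : g != 0 by rewrite gcdp_eq0 (negPf r0) andbF.
have Ep := divpK (dvdp_gcdl (fnum z) (fden z)); have Er := divpK (dvdp_gcdr (fnum z) (fden z)).
exists (fnum z %/ g), (fden z %/ g); split.
- by apply: contraNneq r0; rewrite -{2}Er => ->; rewrite mul0r.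
- by apply: coprimep_div_gcd; rewrite r0 orbT.
- have tp : tofrac (fnum z) = tofrac (fnum z %/ g) * tofrac g by rewrite -tofracM Ep.
  have tr : tofrac (fden z) = tofrac (fden z %/ g) * tofrac g by rewrite -tofracM Er.
  by rewrite [LHS]fnum_fden tp tr -mulf_div divff ?mulr1 // tofrac_eq0.
Qed.

Lemma common_denominator x y : exists t x1 y1 : {poly F},
  [/\ t != 0, tofrac t * x = tofrac x1 & tofrac t * y = tofrac y1].
Proof.
have [nx [dx [dx0 _ xE]]] := coprime_fraction x.
have [ny [dy [dy0 _ yE]]] := coprime_fraction y.
exists (dx * dy), (nx * dy), (ny * dx); rewrite mulf_neq0 //; split=> //.
  by rewrite xE !tofracM [LHS]mulrC mulrA divfK ?tofrac_eq0.
by rewrite yE !tofracM [X in X * _]mulrC [LHS]mulrC mulrA divfK ?tofrac_eq0.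
Qed.

Lemma tofrac_div_eq p r p' r' : r != 0 -> r' != 0 ->
  tofrac p / tofrac r = tofrac p' / tofrac r' -> p * r' = p' * r.
Proof.
move=> r0 r'0 /eqP; rewrite eqr_div ?tofrac_eq0 // -!tofracM tofrac_eq => /eqP.
done.
Qed.

(** Substitution of [u] for X in F(X). It is a ring morphism once [u] is transcendental over F, as
    denominators then stay nonzero. *)
Definition fsubst u z : FX := ev u (fnum z) / ev u (fden z).

Section Substitution.
Variable u : FX.
Hypothesis u_transcendental : forall p, ev u p = 0 -> p = 0.

Let ev_neq0 p : p != 0 -> ev u p != 0.
Proof. by apply: contraNneq => /u_transcendental ->. Qed.

Lemma fsubst_div p r : r != 0 -> fsubst u (tofrac p / tofrac r) = ev u p / ev u r.
Proof.
move=> r0; apply/eqP; rewrite eqr_div ?ev_neq0 ?fden_neq0 // -!rmorphM /=.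
apply/eqP; congr (ev u _); apply: tofrac_div_eq; rewrite ?fden_neq0 //.
by rewrite -fnum_fden.
Qed.

Lemma fsubst_tofrac p : fsubst u (tofrac p) = ev u p.
Proof. by rewrite -[tofrac p]divr1 -tofrac1 fsubst_div ?oner_eq0 // rmorph1 divr1. Qed.

Lemma fsubst_is_zmod_morphism : zmod_morphism (fsubst u).
Proof.
move=> z v; rewrite {1}(fnum_fden z) {1}(fnum_fden v).
rewrite -mulNr addf_div ?tofrac_eq0 ?fden_neq0 // -tofracN -!tofracM -tofracD.
rewrite fsubst_div ?mulf_neq0 ?fden_neq0 // /fsubst -mulNr addf_div ?ev_neq0 ?fden_neq0 //.
by rewrite rmorphD !rmorphM rmorphN.
Qed.

Lemma fsubst_is_monoid_morphism : monoid_morphism (fsubst u).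
Proof.
split=> [|z v]; first by rewrite -tofrac1 fsubst_tofrac rmorph1.
rewrite {1}(fnum_fden z) {1}(fnum_fden v) mulf_div -!tofracM.
by rewrite fsubst_div ?mulf_neq0 ?fden_neq0 // /fsubst mulf_div !rmorphM.
Qed.

Definition fsubst_rmorphism : {rmorphism FX -> FX} :=
  HB.pack (fsubst u) (GRing.isZmodMorphism.Build _ _ (fsubst u) fsubst_is_zmod_morphism)
    (GRing.isMonoidMorphism.Build _ _ (fsubst u) fsubst_is_monoid_morphism).

Lemma fsubst_ev v p : fsubst u (ev v p) = ev (fsubst u v) p.
Proof.
rewrite -[fsubst u]/(fsubst_rmorphism : _ -> _) /ev -horner_map -map_poly_comp /=.
congr horner; apply: eq_map_poly => c /=.
by rewrite fsubst_tofrac evC.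
Qed.

Lemma fsubst_comp v z : fsubst u (fsubst v z) = fsubst (fsubst u v) z.
Proof.
have := fmorph_div fsubst_rmorphism (ev v (fnum z)) (ev v (fden z)).
by rewrite /= !fsubst_ev.
Qed.

End Substitution.

Lemma fsubst_X z : fsubst (tofrac 'X) z = z.
Proof. by rewrite /fsubst !ev_frac -fnum_fden. Qed.

Section MoebiusSubstitution.
Variables a b c d : F.
Hypothesis det : a * d - b * c != 0.

(** Up to a power of c X + d, evaluation at a Moebius transform is [msub], which is injective by
    [msubK]. *)
Lemma moeb_transcendental p : ev (moeb a b c d) p = 0 -> p = 0.
Proof.
move=> e; have l0 := det_lin_neq0 det.
have sz : (size p <= (size p).+1)%N by [].
have e2 := msubK det sz; have := tofrac_msub a b l0 sz; rewrite e mulr0 => /eqP.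
rewrite tofrac_eq0 => /eqP e3; move: e2; rewrite e3 /msub /homog big1 => [/esym/eqP|i _].
  by rewrite scaler_eq0 expf_eq0 (negPf det) andbF => /eqP.
by rewrite coef0 !mul0r.
Qed.

End MoebiusSubstitution.

Lemma fsubst_moeb_inv a b c d : a * d - b * c != 0 ->
  fsubst (moeb d (- b) (- c) a) (moeb a b c d) = tofrac 'X.
Proof.
move=> det; have [e1 e2] := moeb_inv det.
have det' : d * a - (- b) * (- c) != 0 by rewrite mulrNN mulrC.
have l0 := det_lin_neq0 det; have l'0 := det_lin_neq0 det'.
rewrite fsubst_div ?e1 ?e2 //; last exact: moeb_transcendental.
rewrite mulrC mulKf // mulf_neq0 ?invr_eq0 ?tofrac_eq0 //=.
by rewrite polyC_eq0.
Qed.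

End Fractions.

(** * Squarefree forms under linear substitutions *)

Section SquarefreeForms.
Variables (F : finFieldType) (a b c d : F).
Hypothesis det : a * d - b * c != 0.
Implicit Types D f h : {poly F}.

(** Substituting back turns a square factor of the transform into one of [f], which must be
    constant; then [f] has lost 2k degrees. [D] counts as a form of degree [k], so that [D = 1],
    [k = 1] covers a double zero at infinity. *)
Lemma msub_sqr_factor n k f D h : squarefree f -> (n <= size f <= n.+1)%N ->
  (0 < k)%N -> (k + k <= n)%N -> (size D <= k.+1)%N -> (size h <= (n - (k + k)).+1)%N ->
  msub a b c d n f != D * D * h.
Proof.
move=> sf /andP[szf szf'] k0 kn szD szh; apply/eqP => e.
have det' : d * a - (- b) * (- c) != 0 by rewrite mulrNN mulrC.
have l0 := det_lin_neq0 det'.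
have := msubK det szf'; rewrite {}e -[X in msub d _ _ _ X _](subnKC kn).
set D' := msub d (- b) (- c) a k D; set h' := msub d (- b) (- c) a (n - (k + k)) h.
have -> : msub d (- b) (- c) a (k + k + (n - (k + k))) (D * D * h) = D' * D' * h'.
  have szDD : (size (D * D)%R <= (k + k).+1)%N.
    by apply: leq_trans (size_polyMleq _ _) _; move: (size D) szD; lia.
  have tl : tofrac (lin (- c) a) != 0 by rewrite tofrac_eq0.
  apply/eqP; rewrite -tofrac_eq !tofracM !tofrac_homog.
  by rewrite (homogM [the {rmorphism F -> _} of @tofrac {poly F} \o polyC]) ?homogM.
move=> e; have d0 : (a * d - b * c) ^+ n != 0 by rewrite expf_neq0.
have : (size D' <= 1)%N.
  by apply: sf; rewrite -(dvdpZr _ _ d0) -e -expr2 dvdp_mulr.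
move=> szD'; have : (size f <= (n - (k + k)).+1)%N.
  rewrite -(size_scale _ d0) -e; apply: leq_trans (size_polyMleq _ _) _.
  have := size_polyMleq D' D'; have := size_msub d (- b) (- c) a (n - (k + k)) h.
  rewrite -/h'; move: (size D') (size h') (size (D' * D')) szD'; lia.
by move: (size f) szf; lia.
Qed.

Lemma msub_hyperelliptic n f : (1 < n)%N -> squarefree f -> (n <= size f <= n.+1)%N ->
  squarefree (msub a b c d n f) /\ (n <= size (msub a b c d n f) <= n.+1)%N.
Proof.
move=> n1 sf szf; have /andP[_ szf'] := szf.
have szg := size_msub a b c d n f.
have g0 : msub a b c d n f != 0.
  apply: contraNneq (squarefree_neq0 sf) => e; have := msubK det szf'.
  rewrite e /msub /homog big1 => [/esym/eqP|i _]; last by rewrite coef0 !mul0r.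
  by rewrite scaler_eq0 expf_eq0 (negPf det) andbF.
split; last first.
  rewrite szg andbT leqNgt; apply/negP => lt.
  (* A degree drop of at least two is a double zero at infinity; its linear factor is the form z,
     which dehomogenizes to 1. *)
  suff: msub a b c d n f != 1 * 1 * msub a b c d n f by rewrite !mul1r eqxx.
  apply: (@msub_sqr_factor n 1) => //; first by rewrite size_polyC; case: eqP.
  by move: (size _) lt; lia.
move=> D /dvdpP[h e]; rewrite leqNgt; apply/negP => D1.
have h0 : h != 0 by apply: contraNneq g0 => h0; rewrite e h0 mul0r.
have D0 : D != 0 by rewrite -size_poly_gt0 (ltn_trans _ D1).
have szE : (size (msub a b c d n f) = (size h + (size D).-1 + (size D).-1))%N.
  rewrite e expr2 !size_mul ?mulf_neq0 //; move: (size D) (size h) D1; lia.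
have h1 : (0 < size h)%N by rewrite size_poly_gt0.
have kn : ((size D).-1 + (size D).-1 <= n)%N.
  by move: (size D) (size h) (size (msub _ _ _ _ _ _)) h1 szE szg; lia.
suff: msub a b c d n f != D * D * h by rewrite e mulrC expr2 eqxx.
apply: (@msub_sqr_factor n (size D).-1) => //.
- by move: (size D) D1; lia.
- by move: (size D) D1; lia.
- by move: (size D) (size h) (size (msub _ _ _ _ _ _)) h1 szE szg kn; lia.
Qed.

End SquarefreeForms.

(** * Function fields of hyperelliptic curves *)

(** Translation by 1 permutes F, so comparing the sums of all elements gives q = 0 in F; if 2 = 0,
    an odd q would be 1. *)
Lemma two_neq0 (F : finFieldType) : odd #|F| -> (2 : F) != 0.
Proof.
move=> oddF; apply/eqP => two0.
have : (#|F|%:R : F) = 0.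
  apply: (addrI (\sum_(x : F) x)); rewrite addr0 [RHS](reindex_inj (addIr 1)).
  by rewrite big_split /= sumr_const.
rewrite -(odd_double_half #|F|) oddF -muln2 natrD natrM two0 mulr0 addr0 => /eqP.
by rewrite oner_eq0.
Qed.

(* K is F(X)(sqrt f), with basis 1, G over F(X), where E is the embedding of F(X). *)
Definition quadratic_extension (F : fieldType) (f : {poly F}) (K : comNzRingType)
    (E : {fraction {poly F}} -> K) (G : K) : Prop :=
  [/\ forall z, exists x y, z = E x + E y * G,
      forall x y x' y', E x + E y * G = E x' + E y' * G -> x = x' /\ y = y'
    & G ^+ 2 = E (tofrac f)].

Section FunctionField.
Variables (F : finFieldType) (g : nat).
Local Notation FX := {fraction {poly F}}.
Local Notation CF := (@tofrac {poly F} \o polyC).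
Implicit Types (f : equation F g).

Definition emb f (z : FX) : function_field f := in_qpoly (function_field_modulus f) z%:P.
Definition gen f : function_field f := in_qpoly (function_field_modulus f) 'X.

Lemma emb_is_zmod_morphism f : zmod_morphism (emb f).
Proof. by move=> x y; rewrite /emb polyCB raddfB. Qed.

Lemma emb_is_monoid_morphism f : monoid_morphism (emb f).
Proof.
split=> [|x y]; first by rewrite /emb polyC1; apply: in_qpoly1.
by rewrite /emb polyCM; apply: in_qpolyM.
Qed.

HB.instance Definition _ f :=
  GRing.isZmodMorphism.Build _ _ (emb f) (@emb_is_zmod_morphism f).
HB.instance Definition _ f :=
  GRing.isMonoidMorphism.Build _ _ (emb f) (@emb_is_monoid_morphism f).

Lemma size_function_field_modulus f : size (function_field_modulus f) = 3%N.
Proof.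
rewrite /function_field_modulus size_polyDl ?size_polyXn // size_polyN.
exact: leq_ltn_trans (size_polyC_leq1 _) _.
Qed.

Definition ffcoord0 f (z : function_field f) : FX := (z : {poly FX})`_0.
Definition ffcoord1 f (z : function_field f) : FX := (z : {poly FX})`_1.

Lemma emb_gen_val f (x y : FX) :
  (emb f x + emb f y * gen f : function_field f) = x%:P + y%:P * 'X :> {poly FX}.
Proof.
have -> : emb f x + emb f y * gen f =
    in_qpoly (function_field_modulus f) (x%:P + y%:P * 'X) :> function_field f.
  by apply/esym/(etrans (in_qpolyD _ _ _)); congr (_ + _); apply: in_qpolyM.
apply: in_qpoly_small.
rewrite mk_monic_function_field_modulus size_function_field_modulus.
rewrite mul_polyC ltnS (leq_trans (size_polyD _ _)) // geq_max.
rewrite (leq_trans (size_polyC_leq1 _)) //= (leq_trans (size_scale_leq _ _)) //.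
by rewrite size_polyX.
Qed.

Lemma ffcoord0E f x y : ffcoord0 (emb f x + emb f y * gen f) = x.
Proof. by rewrite /ffcoord0 emb_gen_val coefD coefC coefMX addr0. Qed.

Lemma ffcoord1E f x y : ffcoord1 (emb f x + emb f y * gen f) = y.
Proof. by rewrite /ffcoord1 emb_gen_val coefD coefC coefMX coefC add0r. Qed.

Lemma ffcoordE f (z : function_field f) :
  z = emb f (ffcoord0 z) + emb f (ffcoord1 z) * gen f.
Proof.
have /polyP h := emb_gen_val f (ffcoord0 z) (ffcoord1 z).
apply/val_inj/polyP => i; apply: etrans _ (esym (h i)).
rewrite coefD coefC coefMX coefC.
case: i => [|[|i]] /=; rewrite ?addr0 ?add0r //.
rewrite nth_default //; apply: leq_trans (size_npoly z) _.
by rewrite mk_monic_function_field_modulus size_function_field_modulus.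
Qed.

Lemma gen_sqr f : gen f ^+ 2 = emb f (tofrac (f : {poly F})).
Proof.
have modulus0 : in_qpoly (function_field_modulus f) (function_field_modulus f) = 0.
  apply: val_inj => /=; have := Pdiv.RingMonic.rmodpp (monic_mk_monic (function_field_modulus f)).
  by rewrite mk_monic_function_field_modulus.
apply/eqP; rewrite -subr_eq0; apply/eqP; rewrite -[RHS]modulus0; apply/esym.
apply: etrans (raddfB _ _ _) _; congr (_ - _).
by rewrite !expr2; apply: in_qpolyM.
Qed.

Lemma const_ffE f c : const_ff f c = emb f (CF c).
Proof.
apply: val_inj; apply: etrans (qpolyCE _ _) _; apply/esym/in_qpoly_small.
rewrite mk_monic_function_field_modulus size_function_field_modulus.
exact: leq_ltn_trans (size_polyC_leq1 _) _.
Qed.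

Lemma emb_gen_inj f x y x' y' :
  emb f x + emb f y * gen f = emb f x' + emb f y' * gen f -> x = x' /\ y = y'.
Proof.
move=> e; split.
  exact: etrans (esym (ffcoord0E f x y)) (etrans (congr1 (@ffcoord0 f) e) (ffcoord0E f x' y')).
exact: etrans (esym (ffcoord1E f x y)) (etrans (congr1 (@ffcoord1 f) e) (ffcoord1E f x' y')).
Qed.

Lemma function_field_quadratic f :
  quadratic_extension (f : {poly F}) (emb f) (gen f).
Proof.
split; last exact: gen_sqr.
  by move=> z; exists (ffcoord0 z), (ffcoord1 z); apply: ffcoordE.
exact: emb_gen_inj.
Qed.

End FunctionField.

(** * Elements of a quadratic extension satisfying a relation of low degree *)

Section QuadraticExtension.
Variables (F : finFieldType) (f : {poly F}) (K : comNzRingType).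
Local Notation FX := {fraction {poly F}}.
Local Notation CF := (@tofrac {poly F} \o polyC).
Variables (E : {rmorphism FX -> K}) (G : K).
Hypothesis quadK : quadratic_extension f E G.
Implicit Types (x y : FX).

Lemma emb_genM x y x' y' :
  (E x + E y * G) * (E x' + E y' * G) =
  E (x * x' + y * y' * tofrac f) + E (x * y' + y * x') * G.
Proof.
case: quadK => _ _ sq; rewrite !(rmorphD, rmorphM) /= -sq; ring.
Qed.

Lemma emb_inj x y : E x = E y -> x = y.
Proof.
case: quadK => _ inj _ e; apply: proj1 (_ : _ /\ (0 = 0 :> FX)).
by apply: inj; rewrite e.
Qed.

Lemma emb_gen_eq0 x y : E x + E y * G = 0 -> x = 0 /\ y = 0.
Proof. by case: quadK => _ inj _ e; apply: inj; rewrite e rmorph0 mul0r addr0. Qed.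

(** [K] is only assumed to be a ring, but nonzero elements of F(X) are units in it. *)
Lemma emb_lreg x (z : K) : x != 0 -> E x * z = 0 -> z = 0.
Proof.
by move=> x0 e; rewrite -[z]mul1r -(rmorph1 E) -(mulVf x0) rmorphM -mulrA e mulr0.
Qed.

(* Q is a polynomial in Y over F[X]; X is sent to itself and Y to U. *)
Definition ev2 (U : K) (Q : {poly {poly F}}) : K := (map_poly (E \o @tofrac {poly F}) Q).[U].

Lemma ev2_is_zmod_morphism U : zmod_morphism (ev2 U).
Proof. by move=> p r; rewrite /ev2 rmorphB hornerD hornerN. Qed.

Lemma ev2_is_monoid_morphism U : monoid_morphism (ev2 U).
Proof. by split=> [|p r]; rewrite /ev2 ?rmorph1 ?hornerC // rmorphM hornerM. Qed.

HB.instance Definition _ U :=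
  GRing.isZmodMorphism.Build _ _ (ev2 U) (ev2_is_zmod_morphism U).
HB.instance Definition _ U :=
  GRing.isMonoidMorphism.Build _ _ (ev2 U) (ev2_is_monoid_morphism U).

Lemma ev2_poly3 U (Q : {poly {poly F}}) : (size Q <= 3)%N ->
  ev2 U Q = E (tofrac Q`_0) + E (tofrac Q`_1) * U + E (tofrac Q`_2) * (U * U).
Proof.
move=> sz; rewrite /ev2 (@horner_coef_wide _ 3); last by rewrite (leq_trans (size_poly _ _)).
by rewrite !big_ord_recr big_ord0 /= !coef_map /= expr0 mulr1 add0r expr1 expr2.
Qed.

(* If U lies outside F(X), its primitive equation P over F[X] has discriminant f times a
   square, so it has degree at least 3 in X when deg f >= 5; by Gauss' lemma P divides any
   other equation of U. *)
Lemma low_degree_relation_rational (x y : FX) (Q : {poly {poly F}}) :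
  (2 : F) != 0 -> squarefree f -> (6 <= size f)%N ->
  Q != 0 -> (forall i, (size (Q`_i)%R <= 3)%N) -> ev2 (E x + E y * G) Q = 0 -> y = 0.
Proof.
move=> two0 sf szf Q0 szQ evQ; apply/eqP/negPn/negP => y0.
have [U UE] : {U | U = E x + E y * G} by exists (E x + E y * G).
rewrite -UE in evQ.
have f0 := squarefree_neq0 sf.
have [t [x1 [y1 [t0 tx ty]]]] := common_denominator x y.
have ft0 : tofrac t != 0 by rewrite tofrac_eq0.
have y10 : y1 != 0.
  apply: contraNneq y0 => y10; move: ty; rewrite y10 tofrac0 => /eqP.
  by rewrite mulf_eq0 (negPf ft0).
(* The expansion of (t Y - x1)^2 - y1^2 f, which vanishes at Y = U; dividing by the gcd [e] makes it
   primitive. *)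
pose A0 := t ^+ 2; pose B0 := (- 2%:R)%:P * t * x1; pose C0 := x1 ^+ 2 - y1 ^+ 2 * f.
have A00 : A0 != 0 by rewrite expf_neq0.
pose e := gcdp (gcdp A0 B0) C0.
have e0 : e != 0 by rewrite !gcdp_eq0 (negPf A00).
have eA : e %| A0 by rewrite (dvdp_trans (dvdp_gcdl _ _)) ?dvdp_gcdl.
have eB : e %| B0 by rewrite (dvdp_trans (dvdp_gcdl _ _)) ?dvdp_gcdr.
have eC : e %| C0 by rewrite dvdp_gcdr.
pose P : {poly {poly F}} := Poly [:: C0 %/ e; B0 %/ e; A0 %/ e].
have Ae0 : A0 %/ e != 0 by apply: contraNneq A00 => h; rewrite -(divpK eA) h mul0r.
have PE : P = [:: C0 %/ e; B0 %/ e; A0 %/ e] :> seq _ by apply: (@PolyK _ 0).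
have evP : ev2 U P = 0.
  rewrite ev2_poly3 ?PE //=; apply: (@emb_lreg (tofrac e)); first by rewrite tofrac_eq0.
  have eE q : e %| q -> E (tofrac e) * E (tofrac (q %/ e)) = E (tofrac q).
    by move=> eq; rewrite -rmorphM -tofracM mulrC divpK.
  rewrite !mulrDr !mulrA !eE // -[_ * U * U]mulrA UE emb_genM.
  pose a := tofrac C0 + tofrac B0 * x + tofrac A0 * (x * x + y * y * tofrac f).
  pose b := tofrac B0 * y + tofrac A0 * (x * y + y * x).
  have tB : tofrac B0 = - 2%:R * tofrac t * tofrac x1.
    by rewrite /B0 !tofracM polyCN tofracN !rmorph_nat.
  have tC : tofrac C0 = tofrac x1 ^+ 2 - tofrac y1 ^+ 2 * tofrac f.
    by rewrite /C0 !expr2 tofracB !tofracM.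
  have a0 : a = 0 by rewrite /a tB tC -tx -ty /A0 tofracXn; ring.
  have b0 : b = 0 by rewrite /b tB -tx /A0 tofracXn; ring.
  transitivity (E a + E b * G); last by rewrite a0 b0 rmorph0 mul0r addr0.
  by rewrite /a /b !(rmorphD, rmorphM) /=; ring.
(* The pseudo-remainder of [Q] by [P] is at most linear in Y and vanishes at U; as U lies outside
   F(X), it is zero. *)
have [R eQ] : exists R, Q = R * P.
  apply: (@gauss_primitive _ (lead_coef P ^+ scalp Q P) P Q (Q %/ P)).
  - by rewrite expf_neq0 // lead_coef_eq0 -size_poly_gt0 PE.
  - rewrite Pdiv.WeakIdomain.divp_eq.
    suff -> : Q %% P = 0 by rewrite addr0.
    have szR : (size (Q %% P)%R <= 2)%N.
      have : (size (Q %% P)%R < size P)%N by rewrite ltn_modp -size_poly_gt0 PE.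
      by rewrite PE.
    have := congr1 (ev2 U) (Pdiv.WeakIdomain.divp_eq Q P).
    rewrite -mul_polyC rmorphD !rmorphM /= evP evQ !mulr0 add0r.
    rewrite ev2_poly3 ?(leq_trans szR) // [_`_2]nth_default // tofrac0 rmorph0 mul0r addr0.
    set r0 := tofrac _; set r1 := tofrac _ => /esym er.
    have : E (r0 + r1 * x) + E (r1 * y) * G = 0.
      by rewrite -er UE rmorphD !rmorphM; ring.
    move=> /emb_gen_eq0[h0 /eqP]; rewrite mulf_eq0 (negPf y0) orbF => /eqP r10.
    move: h0; rewrite r10 mul0r addr0 => r00.
    apply/polyP => i; rewrite coef0; case: i => [|[|i]].
    + by apply/eqP; rewrite -tofrac_eq0 -/r0 r00.
    + by apply/eqP; rewrite -tofrac_eq0 -/r1 r10.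
    + by rewrite nth_default // (leq_trans szR).
  - move=> c cP; have : e * c %| e.
      rewrite !dvdp_gcd -!andbA; apply/and3P; split.
      + by rewrite -(divpK eA) mulrC dvdp_mul2r //; have := cP 2; rewrite PE.
      + by rewrite -(divpK eB) mulrC dvdp_mul2r //; have := cP 1; rewrite PE.
      + by rewrite -(divpK eC) mulrC dvdp_mul2r //; have := cP 0; rewrite PE.
    rewrite -{2}[e]mulr1 dvdp_mul2l // => c1.
    by have := dvdp_leq (oner_neq0 _) c1; rewrite size_poly1.
have szP := size_coef_dvd Q0 eQ szQ.
pose A := A0 %/ e; pose B := B0 %/ e; pose C := C0 %/ e.
have szA : (size A <= 3)%N by have := szP 2; rewrite PE.
have szB : (size B <= 3)%N by have := szP 1; rewrite PE.
have szC : (size C <= 3)%N by have := szP 0; rewrite PE.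
(* The discriminant B0^2 - 4 A0 C0 equals z^2 f. As [f] is squarefree, [e] divides [z], and the
   discriminant of [P] is again a square times [f]. *)
pose z := 2%:R%:P * t * y1.
have disc : e ^+ 2 * (B ^+ 2 - 4%:R%:P * A * C) = z ^+ 2 * f.
  transitivity ((B * e) ^+ 2 - 4%:R%:P * (A * e) * (C * e)); first by ring.
  rewrite /A /B /C !divpK // /A0 /B0 /C0 /z polyCN !polyC_natr; ring.
have /dvdpP[w zE] : e %| z.
  by apply: (dvdp_sqr_squarefree sf); rewrite -disc dvdp_mulr.
have z0 : z != 0 by rewrite !mulf_neq0 ?polyC_eq0.
have w0 : w != 0 by apply: contraNneq z0 => w0; rewrite zE w0 mul0r.
clearbody A B C.
have disc2 : B ^+ 2 - 4%:R%:P * A * C = w ^+ 2 * f.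
  apply: (mulfI (expf_neq0 2 e0)); rewrite disc zE; ring.
have szM (p r : {poly F}) : (size p <= 3 -> size r <= 3 -> size (p * r)%R <= 5)%N.
  move=> szp szr; apply: leq_trans (size_polyMleq _ _) _.
  by move: (size p) (size r) szp szr; clear; lia.
(* Coefficients of degree at most 2 give a discriminant of degree at most 4, whereas w^2 f has
   degree at least 5. *)
have : (size (w ^+ 2 * f)%R <= 5)%N.
  rewrite -disc2 (leq_trans (size_polyD _ _)) // geq_max size_polyN expr2 szM //= szM //.
  by rewrite mul_polyC (leq_trans (size_scale_leq _ _)).
rewrite size_mul ?expf_neq0 //.
have : (0 < size (w ^+ 2)%R)%N by rewrite size_poly_gt0 expf_neq0.
by move: (size (w ^+ 2)) (size f) szf; clear; lia.
Qed.

End QuadraticExtension.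

(** * Moebius transformations and square ratios in F(X) *)

Section RationalFunctions.
Variable F : finFieldType.
Local Notation FX := {fraction {poly F}}.
Local Notation CF := (@tofrac {poly F} \o polyC).
Implicit Types (f h p q r : {poly F}) (u z : FX).

Lemma dvdp_homog_top m f p q : q %| homog polyC m f p q - (f`_m)%:P * p ^+ m.
Proof.
rewrite /homog big_ord_recr /= subnn expr0 mulr1 addrK.
apply: (big_ind (fun x => q %| x)); rewrite ?dvdp0 //; first exact: dvdp_add.
by move=> i _; rewrite dvdp_mull // dvdp_exp // subn_gt0.
Qed.

Lemma dvdp_homog_bot m f p q : p %| homog polyC m f p q - (f`_0)%:P * q ^+ m.
Proof.
rewrite /homog big_ord_recl /= subn0 expr0 mulr1 addrAC subrr add0r.
apply: (big_ind (fun x => p %| x)); rewrite ?dvdp0 //; first exact: dvdp_add.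
by move=> i _; rewrite dvdp_mulr // dvdp_mull // dvdp_exp.
Qed.

(* If u = p / q and X = r(u) / s(u) then, comparing extreme coefficients, q and p divide
   nonzero linear polynomials. *)
Lemma moebius_of_left_inverse u u' :
  (forall p, ev u p = 0 -> p = 0) -> fsubst u u' = tofrac 'X ->
  exists a b c d, a * d - b * c != 0 /\ u = moeb a b c d.
Proof.
move=> trans; have [p [q [q0 copq ->]]] := coprime_fraction u' => {u'}.
rename p into r, q into s, q0 into s0, copq into cors.
rewrite fsubst_div // => e1.
have ev0 : ev u s != 0 by apply: contraNneq s0 => /trans ->.
have e2 : ev u r = tofrac 'X * ev u s by rewrite -e1 divfK.
have [p [q [q0 copq uE]]] := coprime_fraction u.
pose m := (maxn (size r) (size s)).-1.
have s1 : (0 < size s)%N by rewrite size_poly_gt0.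
have szr : (size r <= m.+1)%N by rewrite /m prednK ?leq_maxl // leq_max s1 orbT.
have szs : (size s <= m.+1)%N by rewrite /m prednK ?leq_maxr // leq_max s1 orbT.
(* The equation r(u) = X s(u), multiplied by q^m with [m] the larger of the degrees of [r] and
   [s]. *)
have key : homog polyC m r p q = 'X * homog polyC m s p q.
  apply/eqP; rewrite -tofrac_eq tofracM !tofrac_homog !homogE ?tofrac_eq0 //.
  rewrite -uE -[_.[u]]/(ev u r) -[(_ s).[u]]/(ev u s) e2.
  by rewrite mulrCA.
have dq : q %| lin (- s`_m) r`_m.
  rewrite -(@Gauss_dvdpl _ _ (p ^+ m)); last by rewrite coprimep_expr // coprimep_sym.
  have -> : lin (- s`_m) r`_m * p ^+ m = 'X * (homog polyC m s p q - (s`_m)%:P * p ^+ m)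
      - (homog polyC m r p q - (r`_m)%:P * p ^+ m).
    by rewrite key /lin -mul_polyC polyCN; ring.
  by rewrite dvdp_sub ?dvdp_mull ?dvdp_homog_top.
have dp : p %| lin (- s`_0) r`_0.
  rewrite -(@Gauss_dvdpl _ _ (q ^+ m)); last by rewrite coprimep_expr.
  have -> : lin (- s`_0) r`_0 * q ^+ m = 'X * (homog polyC m s p q - (s`_0)%:P * q ^+ m)
      - (homog polyC m r p q - (r`_0)%:P * q ^+ m).
    by rewrite key /lin -mul_polyC polyCN; ring.
  by rewrite dvdp_sub ?dvdp_mull ?dvdp_homog_bot.
have szq : (size q <= 2)%N.
  apply: leq_trans (dvdp_leq _ dq) (size_lin _ _); apply: lin_neq0.
  rewrite oppr_eq0 orbC; have [h|h] := leqP (size s) (size r).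
    have r0 : r != 0 by rewrite -size_poly_gt0 (leq_trans s1).
    by rewrite /m (maxn_idPl h) -lead_coefE lead_coef_eq0 r0.
  by rewrite orbC /m (maxn_idPr (ltnW h)) -lead_coefE lead_coef_eq0 s0.
have szp : (size p <= 2)%N.
  apply: leq_trans (dvdp_leq _ dp) (size_lin _ _); apply: lin_neq0.
  rewrite oppr_eq0 -negb_and; apply/andP => -[/eqP s00 /eqP r00].
  have r0 : root r 0 by rewrite /root horner_coef0 r00.
  by have := coprimep_root cors r0; rewrite horner_coef0 s00 eqxx.
have pE := linE szp; have qE := linE szq.
set a := p`_1 in pE; set b := p`_0 in pE; set c := q`_1 in qE; set d := q`_0 in qE.
exists a, b, c, d; rewrite /moeb -pE -qE; split=> //.
(* If det = 0 then c p - a q = 0 and d p - b q = 0. As u = p / q is transcendental, c = d = 0, so q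
   = 0. *)
apply/eqP => det.
have q0' : tofrac q != 0 by rewrite tofrac_eq0.
have ev_lin x y : x *: p + y *: q = 0 -> x = 0 /\ y = 0.
  move=> e; have : ev u (lin x y) = 0.
    apply: (mulIf q0'); rewrite /lin rmorphD -mul_polyC rmorphM /= !evC evX mul0r.
    by rewrite mulrDl -mulrA uE divfK //= -!tofracM -tofracD !mul_polyC e tofrac0.
  move=> /trans e'; have := coef_lin x y 0; have := coef_lin x y 1.
  by rewrite e' !coef0 /=.
have [c0 a0] : c = 0 /\ - a = 0.
  apply: ev_lin; rewrite pE qE; apply/polyP => i; rewrite coefD !coefZ !coef_lin coef0.
  case: eqP => _; first by ring.
  case: eqP => _; last by rewrite !mulr0 addr0.
  by transitivity (- (a * d - b * c)); [ring | rewrite det oppr0].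
have [d0 b0] : d = 0 /\ - b = 0.
  apply: ev_lin; rewrite pE qE; apply/polyP => i; rewrite coefD !coefZ !coef_lin coef0.
  case: eqP => _; first by transitivity (a * d - b * c); [ring | rewrite det].
  by case: eqP => _; [ring | rewrite !mulr0 addr0].
by move: q0; rewrite qE c0 d0 /lin scale0r add0r eqxx.
Qed.

(** With z = p / q in lowest terms, p^2 f = q^2 h; squarefreeness makes [p] and [q] divide each
    other, so both are constant. *)
Lemma sqr_ratio_const f h z : squarefree f -> squarefree h ->
  z ^+ 2 * tofrac f = tofrac h -> exists2 e, e != 0 & z = CF e.
Proof.
move=> sf sh; have [p [q [q0 copq zE]]] := coprime_fraction z.
have q0' : tofrac q != 0 by rewrite tofrac_eq0.
have aux (K : fieldType) (a b c : K) : b != 0 -> a * a * c = b * b * ((a / b) ^+ 2 * c).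
  by move=> b0; field.
rewrite zE => e; have key : p ^+ 2 * f = q ^+ 2 * h.
  apply/eqP; rewrite -tofrac_eq !expr2 !tofracM -e; apply/eqP; exact: aux.
have qp : q %| p by apply: (dvdp_sqr_squarefree sf); rewrite key dvdp_mulr.
have pq : p %| q by apply: (dvdp_sqr_squarefree sh); rewrite -key dvdp_mulr.
have : q %| 1 by rewrite -(@Gauss_dvdpr _ 1 p) ?mulr1 // coprimep_sym.
have : p %| 1 by rewrite -(@Gauss_dvdpr _ 1 q) ?mulr1.
rewrite !dvdp1 => /size_poly1P[a a0 pE] /size_poly1P[b b0 qE].
exists (a / b); first by rewrite mulf_neq0 ?invr_eq0.
by rewrite pE qE -[tofrac _]/(CF a) -[tofrac b%:P]/(CF b) -fmorph_div.
Qed.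

End RationalFunctions.

(** * Isomorphisms between quadratic extensions of F(X) *)

Section Isomorphisms.
Variables (F : finFieldType) (f1 f2 : {poly F}) (K1 K2 : comNzRingType).
Local Notation FX := {fraction {poly F}}.
Local Notation CF := (@tofrac {poly F} \o polyC).
Variables (E1 : {rmorphism FX -> K1}) (G1 : K1) (E2 : {rmorphism FX -> K2}) (G2 : K2).
Hypotheses (quad1 : quadratic_extension f1 E1 G1) (quad2 : quadratic_extension f2 E2 G2).

Section Restriction.
Variable phi : {rmorphism K1 -> K2}.
Hypothesis phi_const : forall c, phi (E1 (CF c)) = E2 (CF c).

(** The image of X is not yet known to lie in F(X), hence [ev2], applied to a polynomial with
    constant coefficients. *)
Lemma iso_ev2 p : phi (E1 (tofrac p)) = ev2 E2 (phi (E1 (tofrac 'X))) (map_poly polyC p).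
Proof.
rewrite /ev2 -map_poly_comp -{1}[p]coefK poly_def !rmorph_sum /=.
rewrite (@horner_coef_wide _ (size p)); last by rewrite (leq_trans (size_poly _ _)).
apply: eq_bigr => i _; rewrite coef_map_id0 /= ?tofrac0 ?rmorph0 //.
by rewrite -mul_polyC tofracM tofracXn !rmorphM !rmorphXn /= -phi_const.
Qed.

Lemma iso_ev u p : phi (E1 (tofrac 'X)) = E2 u -> phi (E1 (tofrac p)) = E2 (ev u p).
Proof.
move=> e; rewrite iso_ev2 e /ev2 -map_poly_comp /ev -horner_map -map_poly_comp.
by [].
Qed.

Hypothesis phi_inj : injective phi.

Lemma iso_transcendental u p : phi (E1 (tofrac 'X)) = E2 u -> ev u p = 0 -> p = 0.
Proof.
move=> e e0; apply/eqP; rewrite -tofrac_eq0; apply/eqP/(emb_inj quad1)/phi_inj.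
by rewrite (iso_ev _ e) e0 !rmorph0.
Qed.

Lemma iso_fsubst u z : phi (E1 (tofrac 'X)) = E2 u -> phi (E1 z) = E2 (fsubst u z).
Proof.
move=> e; have [p [q [q0 _ ->]]] := coprime_fraction z.
have tr := iso_transcendental e.
have q0' : ev u q != 0 by apply: contraNneq q0 => /tr ->.
have h1 : phi (E1 (tofrac p / tofrac q)) * E2 (ev u q) = E2 (ev u p).
  by rewrite -(iso_ev q e) -(iso_ev p e) -rmorphM -rmorphM divfK ?tofrac_eq0.
have h2 : E2 (fsubst u (tofrac p / tofrac q)) * E2 (ev u q) = E2 (ev u p).
  by rewrite -rmorphM fsubst_div // divfK.
apply: subr0_eq; apply: (emb_lreg (E := E2) q0').
by rewrite mulrC mulrBl h1 h2 subrr.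
Qed.

Variable psi : K2 -> K1.
Hypothesis phiK : cancel psi phi.

(** The preimage of X is quadratic over F(X) in [K1]. Carried over by [phi], its equation relates X
    to the image U of X and has degree at most 2 in X, so [low_degree_relation_rational] puts U in
    F(X). *)
Lemma iso_rational : (2 : F) != 0 -> squarefree f2 -> (6 <= size f2)%N ->
  exists u, phi (E1 (tofrac 'X)) = E2 u.
Proof.
move=> two0 sf2 szf2; have [decomp2 _ _] := quad2; have [decomp1 _ sq1] := quad1.
have [x [y UE]] := decomp2 (phi (E1 (tofrac 'X))).
have [r [s XE]] := decomp1 (psi (E2 (tofrac 'X))).
have [t [r1 [s1 [t0 tr ts]]]] := common_denominator r s.
have key : phi (E1 (tofrac t)) * E2 (tofrac 'X) =
    phi (E1 (tofrac r1)) + phi (E1 (tofrac s1)) * phi G1.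
  rewrite -[E2 (tofrac 'X)]phiK XE -tr -ts -!rmorphM -rmorphD; congr (phi _).
  by rewrite !rmorphM; ring.
(* [L] rewrites a polynomial over F in the outer variable, which stands for U; the coefficients of
   [Q] are then at most quadratic in X. *)
pose L := map_poly (polyC : F -> {poly F}).
pose a := t ^+ 2; pose b := - 2%:R%:P * t * r1; pose c := r1 ^+ 2 - s1 ^+ 2 * f1.
pose Q : {poly {poly F}} := L a * ('X^2)%:P + L b * 'X%:P + L c.
have Qi i : Q`_i = (a`_i)%:P * 'X^2 + (b`_i)%:P * 'X + (c`_i)%:P.
  by rewrite /Q; clearbody a b c; rewrite !coefD !coefMC /L !coef_map.
exists x; rewrite UE; suff -> : y = 0 by rewrite rmorph0 mul0r addr0.
apply: (low_degree_relation_rational quad2 (Q := Q) (x := x)) => //.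
- have a0 : a != 0 by rewrite expf_neq0.
  apply: contraNneq a0 => Q0; rewrite -lead_coef_eq0 lead_coefE.
  have := congr1 (fun q : {poly F} => q`_2) (Qi (size a).-1); rewrite Q0 !coef0.
  by rewrite !coefD coefCM coefXn coefMX !coefC /= mulr1 !addr0 => <-.
- move=> i; rewrite Qi (leq_trans (size_polyD _ _)) // geq_max.
  rewrite (leq_trans (size_polyC_leq1 _)) // andbT.
  rewrite (leq_trans (size_polyD _ _)) // geq_max !mul_polyC.
  by rewrite !(leq_trans (size_scale_leq _ _)) ?size_polyX ?size_polyXn.
- rewrite -UE /Q !rmorphD !rmorphM /= -!iso_ev2.
  have ev2C (q : {poly F}) U : ev2 E2 U q%:P = E2 (tofrac q).
    by rewrite /ev2 map_polyC hornerC.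
  rewrite !ev2C.
  have -> : phi (E1 (tofrac a)) = phi (E1 (tofrac t)) ^+ 2.
    by rewrite -!rmorphXn.
  have -> : phi (E1 (tofrac b)) = - 2%:R * phi (E1 (tofrac t)) * phi (E1 (tofrac r1)).
    by rewrite !(rmorphM, rmorphN) /= polyC_natr !rmorph_nat.
  have -> : phi (E1 (tofrac c)) = phi (E1 (tofrac r1)) ^+ 2 -
      (phi (E1 (tofrac s1)) * phi G1) ^+ 2.
    by rewrite exprMn -[phi G1 ^+ 2]rmorphXn sq1 -!rmorphXn -!rmorphM -!rmorphB /= .
  transitivity ((phi (E1 (tofrac t)) * E2 (tofrac 'X) - phi (E1 (tofrac r1))) ^+ 2 -
    (phi (E1 (tofrac s1)) * phi G1) ^+ 2); first by ring.
  by rewrite key; ring.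
Qed.

(** The image v + w G2 of G1 has its square in F(X), so v w = 0; with w = 0 the image of [phi] would
    lie in F(X), against surjectivity. *)
Lemma iso_gen u : (2 : F) != 0 -> phi (E1 (tofrac 'X)) = E2 u ->
  exists w, phi G1 = E2 w * G2 /\ ev u f1 = w ^+ 2 * tofrac f2.
Proof.
move=> two0 e; have [decomp2 inj2 _] := quad2; have [decomp1 _ sq1] := quad1.
have [v [w VE]] := decomp2 (phi G1).
have := iso_ev f1 e; rewrite -sq1 rmorphXn VE expr2 (emb_genM quad2) => h.
have [h0 h1] : v * v + w * w * tofrac f2 = ev u f1 /\ v * w + w * v = 0.
  by apply: inj2; rewrite h rmorph0 mul0r addr0.
have w0 : w != 0.
  apply/eqP => w0; have [r [s XE]] := decomp1 (psi G2).
  have := phiK G2; rewrite XE rmorphD rmorphM VE w0 !(iso_fsubst _ e) rmorph0 mul0r addr0.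
  rewrite -rmorphM -rmorphD => h2.
  have : E2 (fsubst u r + fsubst u s * v) + E2 0 * G2 = E2 0 + E2 1 * G2.
    by rewrite h2 rmorph0 rmorph1 !mul0r mul1r addr0 add0r.
  by move=> /inj2[_ /esym/eqP]; rewrite oner_eq0.
have v0 : v = 0.
  have : 2%:R * (v * w) = 0 by rewrite -h1; ring.
  have two0' : (2%:R : FX) != 0 by rewrite -(rmorph_nat CF) fmorph_eq0.
  by move=> /eqP; rewrite mulf_eq0 (negPf two0') mulf_eq0 (negPf w0) orbF => /eqP.
exists w; split; first by rewrite v0 rmorph0 add0r.
by rewrite -h0 v0 mul0r add0r expr2.
Qed.

End Restriction.

Lemma iso_ext (phi phi' : {rmorphism K1 -> K2}) :
  (forall c, phi (E1 (CF c)) = E2 (CF c)) -> (forall c, phi' (E1 (CF c)) = E2 (CF c)) ->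
  injective phi -> injective phi' ->
  forall u, phi (E1 (tofrac 'X)) = E2 u -> phi' (E1 (tofrac 'X)) = E2 u ->
  phi G1 = phi' G1 -> phi =1 phi'.
Proof.
move=> c c' i i' u e e' eG z; have [decomp1 _ _] := quad1.
have [x [y ->]] := decomp1 z.
rewrite !rmorphD !rmorphM eG (iso_fsubst c i _ e) (iso_fsubst c' i' _ e').
by rewrite (iso_fsubst c i _ e) (iso_fsubst c' i' _ e').
Qed.

(** The map is x + y G1 -> x(u) + y(u) w G2, multiplicative because f1(u) = w^2 f2; its inverse
    divides by [w] and substitutes [u']. *)
Lemma iso_exists u u' w :
  (forall p, ev u p = 0 -> p = 0) -> (forall p, ev u' p = 0 -> p = 0) ->
  fsubst u u' = tofrac 'X -> fsubst u' u = tofrac 'X ->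
  w != 0 -> ev u f1 = w ^+ 2 * tofrac f2 ->
  exists phi : K1 -> K2,
    [/\ bijective phi, GRing.zmod_morphism phi, GRing.monoid_morphism phi,
      forall c, phi (E1 (CF c)) = E2 (CF c)
      & phi (E1 (tofrac 'X)) = E2 u /\ phi G1 = E2 w * G2].
Proof.
move=> tr tr' uu' u'u w0 ew.
have [decomp1 inj1 sq1] := quad1; have [decomp2 inj2 sq2] := quad2.
have /boolp.choice[c1 c1E] : forall z, exists xy : FX * FX, z = E1 xy.1 + E1 xy.2 * G1.
  by move=> z; have [x [y e]] := decomp1 z; exists (x, y).
have /boolp.choice[c2 c2E] : forall z, exists xy : FX * FX, z = E2 xy.1 + E2 xy.2 * G2.
  by move=> z; have [x [y e]] := decomp2 z; exists (x, y).
have c1K x y : c1 (E1 x + E1 y * G1) = (x, y).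
  by have := c1E (E1 x + E1 y * G1); move=> /inj1[]; case: (c1 _) => ? ? /= -> ->.
have c2K x y : c2 (E2 x + E2 y * G2) = (x, y).
  by have := c2E (E2 x + E2 y * G2); move=> /inj2[]; case: (c2 _) => ? ? /= -> ->.
pose s : {rmorphism FX -> FX} := fsubst_rmorphism tr.
pose s' : {rmorphism FX -> FX} := fsubst_rmorphism tr'.
have ss' z : s (s' z) = z by rewrite /s /s' /= (fsubst_comp tr) uu' fsubst_X.
have s's z : s' (s z) = z by rewrite /s /s' /= (fsubst_comp tr') u'u fsubst_X.
have sC c : s (CF c) = CF c by rewrite /s /= fsubst_tofrac ?evC.
have sX : s (tofrac 'X) = u by rewrite /s /= fsubst_tofrac ?evX.
have sf1 : s (tofrac f1) = w ^+ 2 * tofrac f2 by rewrite -ew /s /= fsubst_tofrac.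
clearbody s s'.
pose phi z := E2 (s (c1 z).1) + E2 (s (c1 z).2 * w) * G2.
pose psi z := E1 (s' (c2 z).1) + E1 (s' ((c2 z).2 / w)) * G1.
have phiE x y : phi (E1 x + E1 y * G1) = E2 (s x) + E2 (s y * w) * G2.
  by rewrite /phi c1K.
have psiE x y : psi (E2 x + E2 y * G2) = E1 (s' x) + E1 (s' (y / w)) * G1.
  by rewrite /psi c2K.
exists phi; split.
- exists psi => z.
    by rewrite [z]c1E phiE psiE mulfK // !s's.
  by rewrite [z]c2E psiE phiE !ss' divfK.
- move=> z v; rewrite [z]c1E [v]c1E.
  have -> : E1 (c1 z).1 + E1 (c1 z).2 * G1 - (E1 (c1 v).1 + E1 (c1 v).2 * G1) =
    E1 ((c1 z).1 - (c1 v).1) + E1 ((c1 z).2 - (c1 v).2) * G1 by rewrite !rmorphB; ring.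
  rewrite !phiE !(rmorphB, rmorphM, rmorphD).
  move: (E2 (s _)) (E2 (s _)) (E2 (s _)) (E2 (s _)) (E2 w) => *; ring.
- split.
    have -> : 1 = E1 1 + E1 0 * G1 by rewrite rmorph1 rmorph0 mul0r addr0.
    by rewrite phiE rmorph1 rmorph0 !(rmorph1, mul0r, rmorph0) addr0.
  move=> z v; rewrite [z]c1E [v]c1E (emb_genM quad1) !phiE (emb_genM quad2).
  congr (_ + _ * _); congr (E2 _); rewrite !(rmorphD, rmorphM) ?sf1; ring.
- move=> c; have := phiE (CF c) 0; rewrite !(rmorph0, mul0r, addr0) => ->.
  by rewrite sC.
split.
  have := phiE (tofrac 'X) 0; rewrite !(rmorph0, mul0r, addr0) => ->.
  by rewrite sX.
by have := phiE 0 1; rewrite !(rmorph0, rmorph1, mul1r, add0r).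
Qed.

End Isomorphisms.

Definition moebius_pair (F : finFieldType) g (u w : {fraction {poly F}}) (a b c d e : F) : Prop :=
  [/\ a * d - b * c != 0, e != 0, u = moeb a b c d
    & w = tofrac e%:P / tofrac (lin c d) ^+ g.+1].

(** The image of X has a left inverse under substitution, hence is Moebius. The square of (c X +
    d)^(g+1) w is then a ratio of squarefree polynomials, so [sqr_ratio_const] makes it a
    constant. *)
Lemma iso_moebius_pair (F : finFieldType) (g : nat) (f1 f2 : {poly F}) (K1 K2 : comNzRingType)
    (E1 : {rmorphism {fraction {poly F}} -> K1}) (G1 : K1)
    (E2 : {rmorphism {fraction {poly F}} -> K2}) (G2 : K2)
    (phi : {rmorphism K1 -> K2}) (psi : {rmorphism K2 -> K1}) :
  quadratic_extension f1 E1 G1 -> quadratic_extension f2 E2 G2 ->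
  (2 : F) != 0 -> (1 < g)%N -> squarefree f1 -> squarefree f2 ->
  (2 * g + 2 <= size f1 <= (2 * g + 2).+1)%N -> (2 * g + 2 <= size f2)%N ->
  (forall c, phi (E1 (tofrac c%:P)) = E2 (tofrac c%:P)) ->
  (forall c, psi (E2 (tofrac c%:P)) = E1 (tofrac c%:P)) ->
  cancel phi psi -> cancel psi phi ->
  exists u w a b c d e, [/\ moebius_pair g u w a b c d e,
    phi (E1 (tofrac 'X)) = E2 u, phi G1 = E2 w * G2
    & ev u f1 = w ^+ 2 * tofrac f2].
Proof.
move=> q1 q2 two0 g1 sf1 sf2 szf1 szf2 phic psic phiK psiK.
have sz1 : (6 <= size f1)%N by move: (size f1) szf1 g1; clear; lia.
have sz2 : (6 <= size f2)%N by move: (size f2) szf2 g1; clear; lia.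
have phiinj := can_inj phiK.
have [u ue] := iso_rational q1 q2 phic psiK two0 sf2 sz2.
have [u' u'e] := iso_rational q2 q1 psic phiK two0 sf1 sz1.
have [w [we fe]] := iso_gen q1 q2 phic phiinj psiK two0 ue.
have uu' : fsubst u u' = tofrac 'X.
  by apply: (emb_inj q2); rewrite -(iso_fsubst q1 phic phiinj _ ue) -u'e psiK.
have tr p : ev u p = 0 -> p = 0 by apply: (iso_transcendental q1 phic phiinj ue).
have [a [b [c [d [det uE]]]]] := moebius_of_left_inverse tr uu'.
have l0 := det_lin_neq0 det.
have l0' : tofrac (lin c d) != 0 by rewrite tofrac_eq0.
have n1 : (1 < 2 * g + 2)%N by rewrite addn2.
have [sfm szm] := msub_hyperelliptic det n1 sf1 szf1.
have : (tofrac (lin c d) ^+ g.+1 * w) ^+ 2 * tofrac f2 = tofrac (msub a b c d (2 * g + 2) f1).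
  rewrite tofrac_msub //; last by case/andP: szf1.
  by rewrite -uE fe exprMn -exprM -mulrA; congr (_ ^+ _ * _); lia.
move=> /(sqr_ratio_const sf2 sfm)[e e0 we'].
exists u, w, a, b, c, d, e; split=> //.
split=> //; apply: (canRL (mulfK (expf_neq0 _ l0'))).
exact: etrans (mulrC _ _) we'.
Qed.

Lemma comp_is_monoid_morphism (K1 K2 K3 : comNzRingType) (f : K1 -> K2) (h : K2 -> K3) :
  GRing.monoid_morphism f -> GRing.monoid_morphism h -> GRing.monoid_morphism (h \o f).
Proof. by move=> [f1 fM] [h1 hM]; split=> [|x y] /=; rewrite ?f1 ?fM. Qed.

Lemma comp_is_zmod_morphism (K1 K2 K3 : zmodType) (f : K1 -> K2) (h : K2 -> K3) :
  GRing.zmod_morphism f -> GRing.zmod_morphism h -> GRing.zmod_morphism (h \o f).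
Proof. by move=> fB hB x y /=; rewrite fB. Qed.

Lemma inv_is_monoid_morphism (K1 K2 : comNzRingType) (f : K1 -> K2) (h : K2 -> K1) :
  cancel f h -> cancel h f -> GRing.monoid_morphism f -> GRing.monoid_morphism h.
Proof.
move=> fK hK [f1 fM]; split=> [|x y]; apply: (can_inj fK); rewrite hK ?f1 //.
by rewrite fM !hK.
Qed.

Lemma inv_is_zmod_morphism (K1 K2 : zmodType) (f : K1 -> K2) (h : K2 -> K1) :
  cancel f h -> cancel h f -> GRing.zmod_morphism f -> GRing.zmod_morphism h.
Proof. by move=> fK hK fB x y; apply: (can_inj fK); rewrite hK fB !hK. Qed.

(** * Isomorphisms of hyperelliptic curves *)

Section IsomorphismsOfCurves.
Variables (F : finFieldType) (g : nat).
Local Notation FX := {fraction {poly F}}.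
Local Notation CF := (@tofrac {poly F} \o polyC).
Local Notation n := (2 * g + 2)%N.
Local Notation fX := (tofrac ('X : {poly F})).
Implicit Types f : equation F g.
Hypotheses (oddF : odd #|F|) (g1 : (1 < g)%N).

Lemma hyperelliptic_size f : hyperelliptic f -> (n <= size (f : {poly F}) <= n.+1)%N.
Proof. by move=> [[->|->] _]; clear; lia. Qed.

Lemma is_iso_comp f1 f2 f3 (phi : function_field f1 -> function_field f2)
    (psi : function_field f2 -> function_field f3) :
  is_iso phi -> is_iso psi -> is_iso (psi \o phi).
Proof.
move=> [b a m c] [b' a' m' c']; split.
- exact: bij_comp.
- exact: comp_is_zmod_morphism.
- exact: comp_is_monoid_morphism.
- by move=> k; apply: etrans (congr1 psi (c k)) (c' k).
Qed.

Lemma is_iso_id f : is_iso (id : function_field f -> function_field f).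
Proof. by split=> //; exists id. Qed.

Lemma is_iso_inv f1 f2 (phi : function_field f1 -> function_field f2) :
  is_iso phi -> exists psi, [/\ is_iso psi, cancel phi psi & cancel psi phi].
Proof.
move=> [[psi K K'] a m c]; exists psi; split; [split|exact: K|exact: K'].
- by exists phi.
- exact (@inv_is_zmod_morphism (function_field f1) (function_field f2) phi psi K K' a).
- exact (@inv_is_monoid_morphism (function_field f1) (function_field f2) phi psi K K' m).
- by move=> k; apply: (can_inj K); apply: etrans (K' _) (esym (c k)).
Qed.

Definition iso_rmorphism f1 f2 (phi : function_field f1 -> function_field f2)
    (isophi : is_iso phi) : {rmorphism function_field f1 -> function_field f2} :=
  let: And4 _ a m _ := isophi in
  HB.pack phi (GRing.isZmodMorphism.Build _ _ phi a) (GRing.isMonoidMorphism.Build _ _ phi m).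

Lemma iso_rmorphismE f1 f2 (phi : function_field f1 -> function_field f2)
  (isophi : is_iso phi) : iso_rmorphism isophi = phi :> (_ -> _).
Proof. by case: isophi. Qed.

Lemma iso_moebius f1 f2 (phi : function_field f1 -> function_field f2) :
  hyperelliptic f1 -> hyperelliptic f2 -> is_iso phi ->
  exists u w a b c d e, [/\ moebius_pair g u w a b c d e,
    phi (emb f1 fX) = emb f2 u, phi (gen f1) = emb f2 w * gen f2
    & ev u (f1 : {poly F}) = w ^+ 2 * tofrac (f2 : {poly F})].
Proof.
move=> h1 h2 isophi; have [psi [isopsi K K']] := is_iso_inv isophi.
have [phir E] : exists phir : {rmorphism function_field f1 -> function_field f2},
  (phir : _ -> _) = phi by exists (iso_rmorphism isophi); apply: iso_rmorphismE.
have [psir E'] : exists psir : {rmorphism function_field f2 -> function_field f1},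
  (psir : _ -> _) = psi by exists (iso_rmorphism isopsi); apply: iso_rmorphismE.
subst phi psi.
have phic k : phir (emb f1 (tofrac k%:P)) = emb f2 (tofrac k%:P).
  apply: etrans (congr1 phir (esym (const_ffE f1 k))) (etrans _ (const_ffE f2 k)).
  by case: isophi.
have psic k : psir (emb f2 (tofrac k%:P)) = emb f1 (tofrac k%:P).
  apply: etrans (congr1 psir (esym (const_ffE f2 k))) (etrans _ (const_ffE f1 k)).
  by case: isopsi.
exact: (@iso_moebius_pair F g f1 f2
  (function_field f1) (function_field f2) (emb f1) (gen f1) (emb f2) (gen f2) phir psir
  (function_field_quadratic f1) (function_field_quadratic f2)
  (two_neq0 oddF) g1 h1.2 h2.2 (hyperelliptic_size h1) (proj1 (andP (hyperelliptic_size h2)))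
  phic psic K K').
Qed.

Lemma moebius_iso f1 f2 u w a b c d e :
  moebius_pair g u w a b c d e ->
  ev u (f1 : {poly F}) = w ^+ 2 * tofrac (f2 : {poly F}) ->
  exists phi : function_field f1 -> function_field f2,
    [/\ is_iso phi, phi (emb f1 fX) = emb f2 u & phi (gen f1) = emb f2 w * gen f2].
Proof.
move=> [det e0 -> wE] fe.
have det' : d * a - (- b) * (- c) != 0 by rewrite mulrNN mulrC.
have := fsubst_moeb_inv det'; rewrite !opprK => inv'.
have l0' : tofrac (lin c d) != 0 by rewrite tofrac_eq0 (det_lin_neq0 det).
have w0 : w != 0.
  rewrite wE; apply: mulf_neq0; last by apply/invr_neq0/expf_neq0.
  by rewrite tofrac_eq0 polyC_eq0.
have [phi [b1 a1 m1 c1 [p1 p2]]] := iso_exists (function_field_quadratic f1)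
  (function_field_quadratic f2) (moeb_transcendental det) (moeb_transcendental det')
  inv' (fsubst_moeb_inv det) w0 fe.
exists phi; split; [split=> // k | exact: p1 | exact: p2].
by apply: etrans (congr1 phi (const_ffE f1 k)) (etrans (c1 k) (esym (const_ffE f2 k))).
Qed.

Lemma iso_eq f1 f2 (phi phi' : function_field f1 -> function_field f2) u :
  is_iso phi -> is_iso phi' -> phi (emb f1 fX) = emb f2 u -> phi' (emb f1 fX) = emb f2 u ->
  phi (gen f1) = phi' (gen f1) -> phi = phi'.
Proof.
move=> i i'.
have [phir E] : exists phir : {rmorphism function_field f1 -> function_field f2},
  (phir : _ -> _) = phi by exists (iso_rmorphism i); apply: iso_rmorphismE.
have [phir' E'] : exists phir' : {rmorphism function_field f1 -> function_field f2},
  (phir' : _ -> _) = phi' by exists (iso_rmorphism i'); apply: iso_rmorphismE.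
subst phi phi' => e e' eG; apply/funext.
apply: (@iso_ext F f1 (function_field f1) (function_field f2) (emb f1) (gen f1) (emb f2)
  (function_field_quadratic f1) phir phir' _ _ _ _ u e e' eG).
- move=> k; apply: etrans (congr1 phir (esym (const_ffE f1 k))) (etrans _ (const_ffE f2 k)).
  by case: i.
- move=> k; apply: etrans (congr1 phir' (esym (const_ffE f1 k))) (etrans _ (const_ffE f2 k)).
  by case: i'.
- by case: i => /bij_inj.
- by case: i' => /bij_inj.
Qed.

End IsomorphismsOfCurves.

(** * The mass formula *)

Section MassFormula.
Local Open Scope classical_set_scope.
Variables (F : finFieldType) (g : nat).
Local Notation FX := {fraction {poly F}}.
Local Notation n := (2 * g + 2)%N.
Local Notation fX := (tofrac ('X : {poly F})).
Implicit Types f : equation F g.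
Hypotheses (oddF : odd #|F|) (g1 : (1 < g)%N).

(** The candidates X -> u, Y -> w Y, taken without reference to a curve. Proportional matrices can
    give the same pair, hence [undup]. *)
Definition moebius_pairs : seq (FX * FX) :=
  undup [seq (moeb t.1.1.1.1 t.1.1.1.2 t.1.1.2 t.1.2,
              tofrac (t.2)%:P / tofrac (lin t.1.1.2 t.1.2) ^+ g.+1)
        | t <- enum [pred t : F * F * F * F * F |
            (t.1.1.1.1 * t.1.2 - t.1.1.1.2 * t.1.1.2 != 0) && (t.2 != 0)]].

Lemma moebius_pairsP (p : FX * FX) :
  p \in moebius_pairs <-> exists a b c d e, moebius_pair g p.1 p.2 a b c d e.
Proof.
rewrite mem_undup; split=> [/mapP[[[[[a b] c] d] e]]|[a [b [c [d [e [det e0 uE wE]]]]]]].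
  by rewrite mem_enum inE /= => /andP[det e0] ->; exists a, b, c, d, e.
apply/mapP; exists (a, b, c, d, e); first by rewrite mem_enum inE /= det e0.
by case: p uE wE => u w /= -> ->.
Qed.

Definition isos_pairs f1 f2 : seq (FX * FX) :=
  [seq p <- moebius_pairs | ev p.1 (f1 : {poly F}) == p.2 ^+ 2 * tofrac (f2 : {poly F})].

Definition isos f1 f2 : set (function_field f1 -> function_field f2) :=
  [set phi | is_iso phi].

Arguments isos : clear implicits.

Let restr f1 f2 (phi : function_field f1 -> function_field f2) : FX * FX :=
  (ffcoord0 (phi (emb f1 fX)), ffcoord1 (phi (gen f1))).

Let restrE f1 f2 (phi : function_field f1 -> function_field f2) u w :
  phi (emb f1 fX) = emb f2 u -> phi (gen f1) = emb f2 w * gen f2 -> restr phi = (u, w).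
Proof.
move=> e e'; have z0 : emb f2 0 = 0 by exact: (rmorph0 (emb f2)).
rewrite /restr; congr pair.
  apply: etrans (ffcoord0E f2 u 0); congr (ffcoord0 _); apply: etrans e _.
  by rewrite z0 mul0r addr0.
apply: etrans (ffcoord1E f2 0 w); congr (ffcoord1 _); apply: etrans e' _.
by rewrite z0 add0r.
Qed.

(** An isomorphism is determined by its pair (u, w); [iso_moebius] and [moebius_iso] identify the
    pairs that occur. *)
Lemma card_isos f1 f2 : hyperelliptic f1 -> hyperelliptic f2 ->
  (isos f1 f2 #= `I_(size (isos_pairs f1 f2)))%card.
Proof.
move=> h1 h2.
have inj : {in isos f1 f2 &, injective (@restr f1 f2)}.
  move=> phi phi' /set_mem i /set_mem i'.
  have [u [w [a [b [c [d [e [_ eu ew _]]]]]]]] := iso_moebius oddF g1 h1 h2 i.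
  have [u' [w' [a' [b' [c' [d' [e' [_ eu' ew' _]]]]]]]] := iso_moebius oddF g1 h1 h2 i'.
  rewrite (restrE eu ew) (restrE eu' ew') => -[uu ww].
  rewrite -uu in eu'; rewrite -ww in ew'.
  exact: (iso_eq i i' eu eu' (etrans ew (esym ew'))).
have img : [set restr phi | phi in isos f1 f2] = [set` [fset x in isos_pairs f1 f2]%fset].
  apply/seteqP; split=> [_ [phi i <-] /=|p /=].
    have [u [w [a [b [c [d [e [mp eu ew fe]]]]]]]] := iso_moebius oddF g1 h1 h2 i.
    rewrite (restrE eu ew) inE mem_filter /= fe eqxx /=.
    by apply/moebius_pairsP; exists a, b, c, d, e.
  rewrite inE mem_filter => /andP[/eqP fe /moebius_pairsP[a [b [c [d [e mp]]]]]].
  have [phi [i eu ew]] := moebius_iso mp fe.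
  by exists phi => //; rewrite (restrE eu ew); case: p {fe mp eu ew}.
have := inj_card_eq inj; rewrite img => /card_esym/card_eq_trans; apply.
apply/card_eq_fsetP; rewrite card_fseq undup_id // filter_uniq //.
exact: undup_uniq.
Qed.

Lemma card_Aut_isos f : hyperelliptic f -> card_Aut f = size (isos_pairs f f).
Proof. by move=> h; apply: card_fset_set; apply: card_isos. Qed.

Lemma isomorphicP f1 f2 : reflect (exists phi : function_field f1 -> function_field f2, is_iso phi)
  (isomorphic f1 f2).
Proof. exact: asboolP. Qed.

Lemma isomorphic_refl f : isomorphic f f.
Proof. by apply/isomorphicP; exists id; apply: is_iso_id. Qed.

Lemma isomorphic_sym f1 f2 : isomorphic f1 f2 -> isomorphic f2 f1.
Proof.
move=> /isomorphicP[phi i]; apply/isomorphicP.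
by have [psi [i' _ _]] := is_iso_inv i; exists psi.
Qed.

Lemma isomorphic_trans f1 f2 f3 : isomorphic f1 f2 -> isomorphic f2 f3 -> isomorphic f1 f3.
Proof.
move=> /isomorphicP[phi i] /isomorphicP[psi i']; apply/isomorphicP.
by exists (psi \o phi); apply: is_iso_comp i i'.
Qed.

Lemma isomorphic_equivalence (D : {set equation F g}) :
  {in D & &, equivalence_rel (@isomorphic F g)}.
Proof.
move=> f1 f2 f3 _ _ _; split; first exact: isomorphic_refl.
move=> i; apply/idP/idP; first exact/isomorphic_trans/isomorphic_sym.
exact: isomorphic_trans.
Qed.

(** Composition with a fixed isomorphism from [f1] to [f2] is a bijection from the automorphisms of
    [f1] onto all isomorphisms from [f1] to [f2]. *)
Lemma size_isos_pairs f1 f2 : hyperelliptic f1 -> hyperelliptic f2 ->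
  size (isos_pairs f1 f2) = if isomorphic f1 f2 then card_Aut f1 else 0%N.
Proof.
move=> h1 h2; case: isomorphicP => [[phi i]|no]; last first.
  apply/eqP; rewrite size_filter -leqn0 leqNgt -has_count; apply/hasP.
  case=> p /moebius_pairsP[a [b [c [d [e mp]]]]] /eqP fe; apply: no.
  by have [phi [i _ _]] := moebius_iso mp fe; exists phi.
rewrite (card_Aut_isos h1); apply/card_eq_II.
apply: card_eq_trans (card_esym (card_isos h1 h2)) _.
apply: card_eq_trans _ (card_isos h1 h1).
have [psi [i' K K']] := is_iso_inv i.
have inj : {in isos f1 f1 &, injective (fun ph => phi \o ph)}.
  move=> p p' _ _ e; apply/funext => x; apply: (can_inj K).
  exact: (congr1 (@^~ x) e).
have img : [set phi \o ph | ph in isos f1 f1] = isos f1 f2.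
  apply/seteqP; split=> [_ [ph iph <-] /=|chi ichi]; first exact: is_iso_comp iph i.
  exists (psi \o chi); first exact: is_iso_comp ichi i'.
  by apply/funext => x; apply: K'.
by have := inj_card_eq inj; rewrite img.
Qed.

Lemma ev_moebius_pair (f1 f2 : {poly F}) u w a b c d e :
  moebius_pair g u w a b c d e -> (size f1 <= n.+1)%N ->
  (ev u f1 == w ^+ 2 * tofrac f2) = (f2 == (e ^+ 2)^-1 *: msub a b c d n f1).
Proof.
move=> [det e0 -> ->] szf.
have l0 := det_lin_neq0 det.
have l0' : tofrac (lin c d) != 0 by rewrite tofrac_eq0.
have e20 : e ^+ 2 != 0 by rewrite expf_neq0.
have -> : (f2 == (e ^+ 2)^-1 *: msub a b c d n f1) = (msub a b c d n f1 == e ^+ 2 *: f2).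
  apply/eqP/eqP=> [->|->]; rewrite scalerA ?mulfV ?mulVf ?scale1r //.
rewrite -[RHS]tofrac_eq tofrac_msub // -mul_polyC polyC_exp tofracM tofracXn.
have tn0 : tofrac (lin c d) ^+ n != 0 by apply: expf_neq0.
rewrite -(inj_eq (mulfI tn0)); congr (_ == _).
rewrite mulrA expr_div_n -exprM; congr (_ * _).
have -> : (g.+1 * 2 = n)%N by rewrite mulnC mulnS addnC.
by rewrite mulrC divfK.
Qed.

(** The target is e^-2 times the transform of [f1]. Every pair thus applies to every curve, which
    makes the number of isomorphisms leaving a curve constant. *)
Lemma moebius_image_unique f1 u w a b c d e : hyperelliptic f1 ->
  moebius_pair g u w a b c d e ->
  exists2 f2, hyperelliptic f2 & forall f3 : equation F g,
    (ev u (f1 : {poly F}) == w ^+ 2 * tofrac (f3 : {poly F})) = (f3 == f2).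
Proof.
move=> h1 mp; have [det e0 _ _] := mp.
have e20 : (e ^+ 2)^-1 != 0 by rewrite invr_eq0 expf_neq0.
have n1 : (1 < n)%N by rewrite addn2.
have szf := hyperelliptic_size h1; have /andP[_ szf'] := szf.
have [sfm szm] := msub_hyperelliptic det n1 h1.2 szf.
set q := (e ^+ 2)^-1 *: msub a b c d n f1.
have szq : size q = size (msub a b c d n f1) by rewrite size_scale.
have szq' : (size q <= 2 * g + 3)%N by rewrite szq; move: (size _) szm; clear; lia.
exists (npolyp (2 * g + 3) q) => [|f3].
  split; rewrite npolypK //.
    by rewrite szq; move: (size _) szm; clear; lia.
  by move=> D; rewrite dvdpZr // => /sfm.
rewrite (ev_moebius_pair _ mp) // -/q -[X in _ == X](npolypK szq').
exact: (inj_eq val_inj).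
Qed.

Definition iso_class f1 : {set equation F g} :=
  [set f2 in hyperelliptic_set F g | isomorphic f1 f2]%SET.

Lemma mem_hyperelliptic_set f : reflect (hyperelliptic f) (f \in hyperelliptic_set F g).
Proof. by rewrite inE; apply: asboolP. Qed.

(** Isomorphisms leaving [f1] are counted by target and by pair: each curve in the class is reached
    by [card_Aut f1] pairs, and each pair reaches one curve. *)
Lemma mass_iso_class f1 : hyperelliptic f1 ->
  (#|iso_class f1| * card_Aut f1 = size moebius_pairs)%N.
Proof.
move=> h1; transitivity (\sum_(f2 in hyperelliptic_set F g) size (isos_pairs f1 f2))%N.
  rewrite -sum_nat_const (eq_bigl (fun f2 => (f2 \in hyperelliptic_set F g) && isomorphic f1 f2)).
    rewrite big_mkcondr; apply: eq_bigr => f2 /mem_hyperelliptic_set h2.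
    by rewrite size_isos_pairs.
  by move=> f2; rewrite inE.
transitivity (\sum_(p <- moebius_pairs) 1)%N; last by rewrite sum1_size.
transitivity (\sum_(f2 in hyperelliptic_set F g) \sum_(p <- moebius_pairs)
    nat_of_bool (ev p.1 (f1 : {poly F}) == p.2 ^+ 2 * tofrac (f2 : {poly F}))%R)%N.
  by apply: eq_bigr => f2 _; rewrite size_filter -sum1_count big_mkcond.
rewrite exchange_big /=; apply: eq_big_seq => p /moebius_pairsP[a [b [c [d [e mp]]]]].
have [f2 h2 fE] := moebius_image_unique h1 mp.
rewrite (bigD1 f2) /=; last exact/mem_hyperelliptic_set.
rewrite fE eqxx big1 // => f3 /andP[_ ne]; rewrite fE (negPf ne) //.
Qed.

(** By [mass_iso_class] the weight 1 / |Aut| is the size of the class over a constant, so the sum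
    over the transversal becomes a plain count of equations. *)
Lemma weighted_card_moduli (R : realType) (S : pred (equation F g)) :
  (forall f1 f2, hyperelliptic f1 -> hyperelliptic f2 -> isomorphic f1 f2 -> S f1 = S f2) ->
  weighted_card R S = #|[set f in hyperelliptic_set F g | S f]%SET|%:R / (size moebius_pairs)%:R.
Proof.
move=> Sinv; rewrite /weighted_card.
have eqv := @isomorphic_equivalence (hyperelliptic_set F g).
have part := equivalence_partitionP eqv; have trX := transversalP part.
have subX := fintype.subsetP (transversal_sub trX).
rewrite /moduli; set X := transversal _ _ in trX subX *.
transitivity (\sum_(f in X | S f) #|iso_class f|%:R / (size moebius_pairs)%:R : R).
  apply: eq_bigr => f /andP[/subX/mem_hyperelliptic_set hf _].
  have := mass_iso_class hf.
  have c0 : (0 < #|iso_class f|)%N.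
    by apply/card_gt0P; exists f; rewrite inE isomorphic_refl andbT; apply/mem_hyperelliptic_set.
  move=> <-; rewrite natrM invfM mulrA mulfV ?mul1r // pnatr_eq0 -lt0n //.
rewrite -mulr_suml; congr (_ / _); rewrite -natr_sum; congr (_%:R).
transitivity (\sum_(f in hyperelliptic_set F g | S f) 1)%N; last first.
  by rewrite -sum1_card; apply: eq_bigl => f; rewrite !inE.
rewrite (set_partition_big_cond _ part) -(pblock_transversal trX) big_imset /=; last first.
  exact: finset.pblock_inj trX.
rewrite big_mkcondr; apply: eq_bigr => f Xf.
have hf := subX _ Xf; have /mem_hyperelliptic_set hf' := hf.
pose B := equivalence_partition (@isomorphic F g) (hyperelliptic_set F g).
have EB f2 : (f2 \in finset.pblock B f) = (f2 \in iso_class f).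
  rewrite inE; have [h2|h2] := boolP (f2 \in hyperelliptic_set F g).
    by rewrite (pblock_equivalence_partition eqv).
  apply/negP => f2B; case/negP: h2.
  have /and3P[/eqP <- _ _] := part; apply/finset.bigcupP.
  exists (finset.pblock B f) => //.
  by rewrite finset.pblock_mem //; have /and3P[/eqP -> _ _] := part.
have SE f2 : f2 \in iso_class f -> S f2 = S f.
  by rewrite inE => /andP[/mem_hyperelliptic_set h2 i]; rewrite (Sinv f f2).
rewrite (eq_bigl (fun f2 => (f2 \in iso_class f) && S f)).
  by rewrite big_mkcondr /=; case: (S f); [rewrite sum1_card | rewrite big1].
by move=> f2; rewrite EB; case: (boolP (f2 \in _)) => //= /SE.
Qed.

End MassFormula.

(** * Invariance of the trace *)

Section QuadraticCharacter.
Variable F : finFieldType.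
Implicit Types x y z c : F.

(** The quadratic character with values in a finite type, so that sign patterns form a finite type;
    [None] stands for zero. *)
Definition fsign y : option bool :=
  if y == 0 then None else Some [exists z, z ^+ 2 == y].

Definition sign_val (s : option bool) : int :=
  if s is Some b then if b then 1 else -1 else 0.

Definition qchar y : int := sign_val (fsign y).

Lemma fsign_sqrM c y : c != 0 -> fsign (c ^+ 2 * y) = fsign y.
Proof.
move=> c0; rewrite /fsign mulf_eq0 expf_eq0 /= (negPf c0) /=.
case: eqP => // _; congr (Some _).
apply/existsP/existsP => -[z /eqP e].
  by exists (z / c); rewrite expr_div_n e mulrC mulKf ?expf_neq0.
by exists (c * z); rewrite exprMn e.
Qed.

Lemma qchar_sqrM c y : c != 0 -> qchar (c ^+ 2 * y) = qchar y.
Proof. by move=> c0; rewrite /qchar fsign_sqrM. Qed.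

Lemma card_sqrt y : odd #|F| -> (#|[set z | z ^+ 2 == y]%SET|)%:Z = 1 + qchar y.
Proof.
move=> /two_neq0 two0; rewrite /qchar /fsign; case: eqP => [->|/eqP y0] /=.
  rewrite (_ : [set z | _]%SET = [set 0]%SET) ?cards1 //.
  by apply/setP => z; rewrite !inE expf_eq0.
case: existsP => [[z /eqP zE]|no].
  rewrite (_ : [set z | _]%SET = [set z; - z]%SET).
    rewrite cards2; case: eqP => // /eqP; rewrite -addr_eq0 -mulr2n -mulr_natl mulf_eq0.
    rewrite (negPf two0) /= => /eqP z0; case/eqP: y0; by rewrite -zE z0 expr0n.
  by apply/setP => t; rewrite !inE -zE eqf_sqr.
rewrite (_ : [set z | _]%SET = finset.set0) ?cards0 //.
by apply/setP => t; rewrite !inE; apply/negP => e; apply: no; exists t.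
Qed.

(* The values of f, as a form of degree k, at the points of the projective line; None is the
   point at infinity. *)
Definition point_value k (f : {poly F}) (P : option F) : F :=
  if P is Some x then f.[x] else f`_k.

Lemma sum_option (A : nmodType) (h : option F -> A) :
  \sum_P h P = h None + \sum_x h (Some x).
Proof.
rewrite (bigD1 None) //=; congr (_ + _).
rewrite (reindex_onto (@Some F) (odflt 0)) /=; first by apply: eq_bigl => x; rewrite eqxx.
by case.
Qed.

(** Each point of the projective line carries 1 plus the character of the value of the form, and the
    q + 1 ones cancel. *)
Lemma trace_FrobeniusE g (f : equation F g) : odd #|F| ->
  trace_Frobenius f = - \sum_P qchar (point_value (2 * g + 2) f P).
Proof.
move=> oddF; rewrite /trace_Frobenius /npoints PoszD sum_option /=.
have -> : (#|affine_points f|)%:Z = (#|F|)%:Z + \sum_x qchar (f : {poly F}).[x].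
  transitivity (\sum_(x : F) (#|[set z | z ^+ 2 == (f : {poly F}).[x]]%SET|)%:Z).
    rewrite -(big_morph Posz PoszD (erefl _)); congr Posz; rewrite -sum1_card.
    transitivity (\sum_(x : F) \sum_(z | z ^+ 2 == (f : {poly F}).[x]) 1)%N.
      by rewrite pair_big_dep /=; apply: eq_bigl => p; rewrite inE.
    by apply: eq_bigr => x _; rewrite -sum1_card; apply: eq_bigl => z; rewrite inE.
  under eq_bigr do rewrite card_sqrt //.
  by rewrite big_split /= sumr_const natz.
rewrite /infinite_points card_sqrt // -addn1 PoszD; ring.
Qed.

(* Summing over all vectors instead of over the projective line makes the invariance under
   linear substitutions a change of variables. *)
Lemma sum_qchar_homog g (f : {poly F}) : (size f <= (2 * g + 2).+1)%N ->
  \sum_(p : F * F) qchar (homog idfun (2 * g + 2) f p.1 p.2) =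
  (\sum_P qchar (point_value (2 * g + 2) f P)) *+ #|F|.-1.
Proof.
(* A rational point has q - 1 representatives; since the degree 2g + 2 is even, they all have the
   same character. *)
move=> szf; have nE : (2 * g + 2 = g.+1 * 2)%N by rewrite mulnC addn2.
rewrite -(pair_big xpredT xpredT (fun x z => qchar (homog idfun (2 * g + 2) f x z))) /=.
rewrite exchange_big /= (bigD1 0) //= sum_option /= mulrnDl; congr (_ + _).
  rewrite (bigD1 0) //= homog_infty nE exprM expr0n /= expr0n mulr0 {1}/qchar {1}/fsign eqxx add0r.
  rewrite (eq_bigr (fun=> qchar f`_(g.+1 * 2))); last first.
    by move=> x x0; rewrite homog_infty exprM mulrC qchar_sqrM ?expf_neq0.
  by rewrite sumr_const cardC1.
rewrite (eq_bigr (fun=> \sum_x qchar f.[x])); first by rewrite sumr_const cardC1.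
move=> z z0; rewrite [RHS](reindex_inj (mulIf (invr_neq0 z0))) /=.
apply: eq_bigr => x _; rewrite (@homogE _ _ idfun) // map_poly_id // nE exprM.
by rewrite qchar_sqrM // expf_neq0.
Qed.

End QuadraticCharacter.

(** The second form is e^-2 times a transform of the first: the square does not change characters,
    and the matrix permutes the vectors of F^2. *)
Lemma isomorphic_trace (F : finFieldType) g (f1 f2 : equation F g) : odd #|F| -> (1 < g)%N ->
  hyperelliptic f1 -> hyperelliptic f2 -> isomorphic f1 f2 ->
  trace_Frobenius f1 = trace_Frobenius f2.
Proof.
move=> oddF g1 h1 h2 /isomorphicP[phi i].
have [u [w [a [b [c [d [e [mp _ _ fe]]]]]]]] := iso_moebius oddF g1 h1 h2 i.
have [_ szf1] := andP (hyperelliptic_size h1).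
have [_ szf2] := andP (hyperelliptic_size h2).
have [det e0 _ _] := mp.
have f2E : (f2 : {poly F}) = (e ^+ 2)^-1 *: msub a b c d (2 * g + 2) f1.
  by apply/eqP; rewrite -(ev_moebius_pair _ mp) // fe.
rewrite !trace_FrobeniusE //; congr (- _).
have q0 : (0 < #|F|.-1)%N.
  have := card_finNzRing_gt1 F; case: #|F| oddF => [|[|k]] //.
apply: (@pmulrnI _ _ q0); rewrite -!sum_qchar_homog //.
have inj : injective (fun p : F * F => (a * p.1 + b * p.2, c * p.1 + d * p.2)).
  apply: (can_inj (g := fun p => ((d * p.1 - b * p.2) / (a * d - b * c),
    (a * p.2 - c * p.1) / (a * d - b * c)))) => -[x y] /=.
  by congr pair; field.
rewrite (reindex_inj inj) /=; apply: eq_bigr => p _.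
rewrite -homog_msub // f2E -[(e ^+ 2)^-1]exprVn.
by rewrite (homogZ [the {rmorphism F -> F} of idfun]) /= qchar_sqrM // invr_neq0.
Qed.

(** * Sieving squarefree forms *)

Section TruncatedSeries.
Variables (R : comNzRingType) (N : nat).
Implicit Types p r : {poly R}.

(** Congruence modulo T^N, so that polynomials can serve as truncated generating functions. *)
Definition eqtrunc p r := forall k, (k < N)%N -> p`_k = r`_k.

Lemma eqtrunc_mul p p' r r' : eqtrunc p p' -> eqtrunc r r' -> eqtrunc (p * r) (p' * r').
Proof.
move=> ep er k kN; rewrite !coefM; apply: eq_bigr => i _.
by rewrite ep ?er // (leq_ltn_trans _ kN) ?leq_subr // -ltnS.
Qed.

Lemma eqtrunc_trans p r s : eqtrunc p r -> eqtrunc r s -> eqtrunc p s.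
Proof. by move=> e e' k kN; rewrite e ?e'. Qed.

Lemma eqtrunc_sym p r : eqtrunc p r -> eqtrunc r p.
Proof. by move=> e k kN; rewrite e. Qed.

Definition gseries (u : nat -> R) : {poly R} := \poly_(i < N) u i.

Lemma coef_gseries u k : (k < N)%N -> (gseries u)`_k = u k.
Proof. by move=> kN; rewrite coef_poly kN. Qed.

Lemma coef_gseries_mul u v k : (k < N)%N ->
  (gseries u * gseries v)`_k = \sum_(i < k.+1) u i * v (k - i)%N.
Proof.
move=> kN; rewrite coefM; apply: eq_bigr => i _.
by rewrite !coef_gseries // (leq_ltn_trans _ kN) ?leq_subr // -ltnS.
Qed.

Lemma gseries_diff u v a : (forall k, (k.+1 < N)%N -> v k.+1 = u k.+1 - a * u k) -> v 0%N = u 0%N ->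
  eqtrunc (gseries v) ((1 - a *: 'X) * gseries u).
Proof.
move=> vS v0 k kN; rewrite coef_gseries // mulrBl mul1r coefB -scalerAl coefZ coefXM.
rewrite coef_gseries //; case: k kN => [|k] kN /=; first by rewrite mulr0 subr0.
by rewrite vS // coef_gseries // ltnW.
Qed.

End TruncatedSeries.

(* The coefficients of (1 - T)^-r. *)
Fixpoint neg_binomial r k : nat :=
  if r is r'.+1 then \sum_(j < k.+1) neg_binomial r' j else (k == 0).

Lemma neg_binomialS r k :
  neg_binomial r.+1 k.+1 = (neg_binomial r.+1 k + neg_binomial r k.+1)%N.
Proof. by rewrite /= [LHS]big_ord_recr. Qed.

Lemma neg_binomial0 r : neg_binomial r 0 = 1%N.
Proof. by elim: r => //= r IH; rewrite big_ord_recr big_ord0 /= IH. Qed.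

Lemma neg_binomial_mono r k : (neg_binomial r k <= neg_binomial r.+1 k)%N.
Proof. by rewrite /= big_ord_recr leq_addl. Qed.

(** It makes the coefficients of (1 - r T) / (1 - T)^r nonpositive in positive degree, from which
    [sieve_coef_bound] follows. *)
Lemma neg_binomial_growth r k : (neg_binomial r k.+1 <= r * neg_binomial r k)%N.
Proof.
elim: r => [//|r IH]; rewrite neg_binomialS mulSn leq_add2l.
by apply: leq_trans IH _; rewrite leq_mul2l neg_binomial_mono orbT.
Qed.

Lemma neg_binomial_bound r k : (neg_binomial r k <= r ^ k)%N.
Proof.
elim: k => [|k IH]; first by rewrite neg_binomial0.
by apply: leq_trans (neg_binomial_growth r k) _; rewrite expnS leq_mul2l IH orbT.
Qed.

(** * Monic polynomials without rational roots *)

Section RootlessPolynomials.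
Variables (F : finFieldType) (N : nat).
Implicit Types (A : seq F) (D : {poly F}).

Definition rootless A k : {set {poly_N F}} :=
  [set D : {poly_N F} | (size (D : {poly F}) == k.+1) && ((D : {poly F}) \is monic)
    && all (fun x => ~~ root D x) A]%SET.

Lemma card_rootless_nil k : (k < N)%N -> #|rootless [::] k| = (#|F| ^ k)%N.
Proof.
move=> kN; rewrite -card_npoly.
have szX (r : {poly_k F}) : size ('X^k + (r : {poly F})) = k.+1.
  by rewrite size_polyDl size_polyXn // ltnS size_npoly.
pose h (r : {poly_k F}) : {poly_N F} := npolyp N ('X^k + (r : {poly F})).
have hE r : h r = 'X^k + (r : {poly F}) :> {poly F} by rewrite npolypK // szX.
have hinj : injective h.
  move=> r r' e; apply: val_inj; apply: (addrI 'X^k).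
  by have := hE r; rewrite e hE.
rewrite -(card_imset _ hinj); apply: eq_card => D; rewrite inE andbT.
apply/andP/imsetP => [[/eqP szD monD]|[r _ ->]].
  have szr : (size ((D : {poly F}) - 'X^k)%R <= k)%N.
    apply/leq_sizeP => j; rewrite leq_eqVlt => /orP[/eqP<-|kj].
      have := monicP monD; rewrite lead_coefE szD /= => e.
      by rewrite coefB coefXn eqxx e subrr.
    by rewrite coefB coefXn gtn_eqF // nth_default ?szD // subr0.
  exists (npolyp k ((D : {poly F}) - 'X^k)) => //; apply: val_inj.
  by rewrite /= hE npolypK // addrC subrK.
rewrite !hE szX monicE lead_coefDl ?lead_coefXn // size_polyXn ltnS size_npoly.
by split.
Qed.

(** The polynomials vanishing at [x] are divided by X - x; the quotient may vanish at [x] again,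
    hence [A] in the second term. *)
Lemma card_rootless_cons x A k : x \notin A -> (k.+1 < N)%N ->
  (#|rootless (x :: A) k.+1| + #|rootless A k| = #|rootless A k.+1|)%N.
Proof.
move=> xA kN; rewrite -(cardsID [set D : {poly_N F} | root D x]%SET (rootless A k.+1)) addnC.
congr (_ + _)%N; last first.
  by apply: eq_card => D; rewrite !inE /=; case: (root D x); rewrite ?andbF //= andbT.
pose h (D : {poly_N F}) : {poly_N F} := npolyp N ((D : {poly F}) * ('X - x%:P)).
have szh (D : {poly_N F}) : D \in rootless A k -> size ((D : {poly F}) * ('X - x%:P)) = k.+2.
  rewrite inE => /andP[/andP[/eqP szD monD] _].
  by rewrite size_Mmonic ?monicXsubC ?monic_neq0 // size_XsubC szD addn2.
have hE (D : {poly_N F}) : D \in rootless A k -> h D = (D : {poly F}) * ('X - x%:P) :> {poly F}.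
  by move=> /szh e; rewrite npolypK // e.
have hinj : {in rootless A k &, injective h}.
  move=> D D' HD HD' e; apply/val_inj/(mulIf (monic_neq0 (monicXsubC x))).
  by rewrite /= -(hE _ HD) -(hE _ HD') e.
rewrite -(card_in_imset hinj); apply: eq_card => D; rewrite inE.
apply/imsetP/andP => [[D' HD' ->]|[+ rD]].
  rewrite !inE hE // rootM root_XsubC eqxx orbT szh // eqxx /=.
  move: (HD'); rewrite inE => /andP[/andP[_ monD] nA].
  rewrite monicMr ?monicXsubC // monD; split=> //; apply/allP => y yA.
  rewrite rootM negb_or (allP nA) //= root_XsubC; apply: contraNneq xA => <-.
  exact: yA.
rewrite inE => /andP[/andP[/eqP szD monD] nA].
have /factor_theorem[D' DE] : root D x by move: rD; rewrite inE.
have D0 : D' != 0.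
  by apply: contraTneq monD => e; rewrite DE e mul0r monicE lead_coef0 eq_sym oner_eq0.
have szD' : size D' = k.+1.
  by move: szD; rewrite DE size_Mmonic ?monicXsubC // size_XsubC addn2 => -[].
have D'N : (size D' <= N)%N by rewrite szD' ltnW.
have HD' : npolyp N D' \in rootless A k.
  rewrite inE npolypK // szD' eqxx /=; move: monD; rewrite DE monicMr ?monicXsubC // => -> /=.
  by apply/allP => y yA; have := allP nA y yA; rewrite DE rootM negb_or => /andP[].
by exists (npolyp N D') => //; apply: val_inj; rewrite /= hE // npolypK.
Qed.

Lemma card_rootless0 A : (0 < N)%N -> #|rootless A 0| = 1%N.
Proof.
move=> N0; rewrite -(cards1 (npolyp N (1 : {poly F}))); apply: eq_card => D; rewrite !inE.
have sz1 : (size (1%R : {poly F}) <= N)%N by rewrite size_poly1.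
apply/idP/eqP => [/andP[/andP[/eqP sz monD] _]|->].
  apply: val_inj; rewrite /= npolypK //; have [c _ DE] := size_poly1P _ (introT eqP sz).
  by move: monD; rewrite DE monicE lead_coefC => /eqP->.
rewrite npolypK // size_poly1 eqxx monic1 /=; apply/allP => x _.
by rewrite root1.
Qed.

(** Each new point multiplies one series by 1 - T and the other by its inverse, so the product
    remains the series of all monic polynomials. *)
Lemma rootless_gseries (R : comNzRingType) A : uniq A -> (0 < N)%N ->
  eqtrunc N (gseries N (fun k => (neg_binomial (size A) k)%:R) *
             gseries N (fun k => (#|rootless A k|)%:R))
            (gseries N (fun k => (#|F| ^ k)%:R) : {poly R}).
Proof.
move=> + N0; elim: A => [_|x A IH /= /andP[xA uA]] k kN.
  rewrite coef_gseries_mul // big_ord_recl /= mul1r subn0 big1 ?addr0; last first.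
    by move=> i _; rewrite mul0r.
  by rewrite card_rootless_nil // coef_gseries.
rewrite -(IH uA k kN); move: k kN.
pose a := gseries N (fun k => (#|rootless A k|)%:R : R).
have e1 : eqtrunc N (gseries N (fun k => (#|rootless (x :: A) k|)%:R)) ((1 - 1 *: 'X) * a).
  apply: gseries_diff => [k kN|]; last by rewrite !card_rootless0.
  by rewrite -(card_rootless_cons xA kN) natrD mul1r addrK.
pose c := gseries N (fun k => (neg_binomial (size A).+1 k)%:R : R).
have e2 : eqtrunc N (gseries N (fun k => (neg_binomial (size A) k)%:R)) ((1 - 1 *: 'X) * c).
  apply: gseries_diff => [k kN|]; last by rewrite !neg_binomial0.
  by rewrite neg_binomialS natrD mul1r addrAC subrr add0r.
apply: eqtrunc_trans (eqtrunc_mul (fun _ _ => erefl) e1) _.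
rewrite mulrCA mulrA; apply: eqtrunc_sym; apply: eqtrunc_mul e2 _.
by [].
Qed.

End RootlessPolynomials.

(** * Square parts of forms with a given sign pattern *)

Section SquareParts.
Variables (F : finFieldType) (N : nat).
Implicit Types (D f h : {poly F}) (e : {ffun option F -> option bool}).

Definition pattern n f : {ffun option F -> option bool} :=
  [ffun P => fsign (point_value n f P)].

(* Forms of degree n, so n <= size f means that infinity is not a double zero. N bounds all
   degrees in play and makes the types finite. *)
Definition squarefree_forms n e : {set {poly_N F}} :=
  [set f : {poly_N F} | [&& `[< squarefree (f : {poly F}) >],
    (n <= size (f : {poly F}) <= n.+1)%N & pattern n f == e]]%SET.

(* Forms without double zeros at rational points. *)
Definition reduced_forms n e : {set {poly_N F}} :=
  [set f : {poly_N F} | [&& [forall x, ~~ (('X - x%:P) ^+ 2 %| (f : {poly F}))],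
    (n <= size (f : {poly F}) <= n.+1)%N & pattern n f == e]]%SET.

(** The values of D^2 at rational points are nonzero squares, also at infinity, where the value is 1
    because [D] is monic. *)
Lemma pattern_sqrM D h k m : D \is monic -> size D = k.+1 -> (forall x, ~~ root D x) ->
  (size h <= m.+1)%N -> pattern (k + k + m) (D ^+ 2 * h) = pattern m h.
Proof.
move=> monD szD nD szh; apply/ffunP => -[x|]; rewrite !ffunE /=.
  by rewrite hornerM horner_exp fsign_sqrM // -/(root D x).
have sz2 : (size (D ^+ 2)%R <= (k + k).+1)%N.
  by rewrite expr2 (leq_trans (size_polyMleq _ _)) // szD addSn addnS.
rewrite coef_top_mul // expr2 coef_top_mul ?szD //.
by have := monicP monD; rewrite lead_coefE szD /= => ->; rewrite !mul1r.
Qed.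

Lemma maximal_square_divisor f : f != 0 ->
  exists D h, [/\ D \is monic, f = D ^+ 2 * h & squarefree h].
Proof.
have [n] := ubnP (size f); elim: n f => // n IH f szf f0.
have [sf|nsf] := pselect (squarefree f).
  by exists 1, f; split; rewrite ?monic1 // expr1n mul1r.
have [d [df d1]] : exists d, d ^+ 2 %| f /\ (1 < size d)%N.
  apply: contrapT => no; apply: nsf => d df; rewrite leqNgt; apply/negP => d1.
  by apply: no; exists d.
have d0 : d != 0 by rewrite -size_poly_gt0 (ltn_trans _ d1).
case/dvdpP: df => f' fE.
have f'0 : f' != 0 by apply: contraNneq f0; rewrite fE => ->; rewrite mul0r.
have [|//|D [h [mD f'E sh]]] := IH f'.
  move: szf; rewrite fE expr2 !size_mul ?mulf_neq0 //.
  have : size f' != 0%N by rewrite size_poly_eq0.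
  by move: (size f') (size d) d1; clear; lia.
have l0 : lead_coef d != 0 by rewrite lead_coef_eq0.
(* The leading coefficient of [d] moves into the squarefree part, which keeps the square root
   monic. *)
exists ((lead_coef d)^-1 *: d * D), (lead_coef d ^+ 2 *: h); split.
- by rewrite monicMr // monicE lead_coefZ mulVf.
- rewrite fE f'E exprMn exprZn -!scalerAl -!scalerAr scalerA -exprMn mulVf //.
  by rewrite expr1n scale1r; ring.
- by move=> x; rewrite dvdpZr ?expf_neq0 // => /sh.
Qed.

Lemma square_part_unique D D' h h' : D \is monic -> D' \is monic ->
  squarefree h -> squarefree h' -> D ^+ 2 * h = D' ^+ 2 * h' -> D = D' /\ h = h'.
Proof.
move=> mD mD' sh sh' e.
have dd : D %| D' by apply: (dvdp_sqr_squarefree sh'); rewrite -e dvdp_mulr.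
have dd' : D' %| D by apply: (dvdp_sqr_squarefree sh); rewrite e dvdp_mulr.
have DD : D = D' by apply/eqP; rewrite -eqp_monic // /eqp dd dd'.
split=> //; apply: (mulfI (expf_neq0 2 (monic_neq0 mD))).
by rewrite e DD.
Qed.

Lemma mem_enumF (P : pred F) : all P (enum F) = [forall x, P x].
Proof.
apply/allP/forallP => [h x|h x _]; last exact: h.
by apply: h; rewrite mem_enum.
Qed.

(** The unique decomposition D^2 h, sorted by k = deg D. It lowers the degree by 2k, so a recursion
    through even degrees suffices. *)
Lemma card_reduced_forms i e : (2 * i < N)%N ->
  #|reduced_forms (2 * i) e| =
  (\sum_(k < i.+1) #|rootless N (enum F) k| * #|squarefree_forms (2 * (i - k)) e|)%N.
Proof.
move=> iN.
pose A := [set p : {poly_N F} * {poly_N F} | [exists k : 'I_i.+1,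
  (p.1 \in rootless N (enum F) k) && (p.2 \in squarefree_forms (2 * (i - k)) e)]]%SET.
have inA (p : {poly_N F} * {poly_N F}) : p \in A -> exists2 k, (k < i.+1)%N & 
   [/\ size (p.1 : {poly F}) = k.+1, (p.1 : {poly F}) \is monic,
    (forall x, ~~ root p.1 x) & p.2 \in squarefree_forms (2 * (i - k)) e].
  rewrite inE => /existsP[k /andP[]].
  rewrite inE mem_enumF => /andP[/andP[/eqP sz m] /forallP nr] h.
  by exists k.
pose mul (p : {poly_N F} * {poly_N F}) : {poly_N F} := npolyp N ((p.1 : {poly F}) ^+ 2 * p.2).
have szM (p : {poly_N F} * {poly_N F}) k : (k < i.+1)%N ->
    size (p.1 : {poly F}) = k.+1 -> (p.1 : {poly F}) \is monic ->
    p.2 \in squarefree_forms (2 * (i - k)) e ->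
    size ((p.1 : {poly F}) ^+ 2 * p.2) = (k + k + size (p.2 : {poly F}))%N.
  move=> ki sz m; rewrite inE => /and3P[/asboolP sh _ _].
  have m2 : (p.1 : {poly F}) ^+ 2 \is monic by rewrite monic_exp.
  rewrite mulrC size_Mmonic ?squarefree_neq0 // expr2 size_Mmonic ?monic_neq0 // sz.
  by move: (size _) => s; clear; lia.
have mulE (p : {poly_N F} * {poly_N F}) : p \in A ->
    mul p = (p.1 : {poly F}) ^+ 2 * p.2 :> {poly F}.
  move=> /inA[k ki [sz m nr h]]; rewrite npolypK // (szM p k) //.
  by move: h; rewrite inE => /and3P[_ + _]; move: (size _) ki iN; clear; lia.
have mul_inj : {in A &, injective mul}.
  move=> p p' Ap Ap' e'; have := mulE _ Ap; rewrite e' mulE // => e2.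
  have [k ki [_ m _]] := inA _ Ap; have [k' ki' [_ m' _]] := inA _ Ap'.
  rewrite !inE => /and3P[/asboolP sh' _ _] /and3P[/asboolP sh _ _].
  have [] := square_part_unique m' m sh' sh e2.
  case: p p' {Ap Ap' e' e2 m m' sh sh'} => [D h] [D' h'] /= e1 e2.
  by congr pair; apply: val_inj.
transitivity #|A|; last first.
  rewrite -sum1_card (partition_big (fun p : {poly_N F} * {poly_N F} =>
    inord (size (p.1 : {poly F})).-1 : 'I_i.+1) xpredT) //=.
  apply: eq_bigr => k _; rewrite -cardsX -sum1_card; apply: eq_bigl => -[D h] /=.
  rewrite finset.in_setX; apply/andP/andP => [[Ap /eqP kE]|[h1 h2]].
    have [k' ki' [/= sz m nr hh]] := inA _ Ap.
    have kk : k' = k by rewrite -kE inordK // sz.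
    split; last by rewrite -kk.
    by rewrite inE -kk sz eqxx m mem_enumF; apply/forallP.
  split; first by rewrite inE; apply/existsP; exists k; rewrite h1 h2.
  move: h1; rewrite inE => /andP[/andP[/eqP sz _] _].
  by apply/eqP/val_inj; rewrite /= sz /= inordK ?ltn_ord.
rewrite -(card_in_imset mul_inj); apply: eq_card => f.
apply/idP/imsetP => [|[p Ap ->]].
  rewrite inE => /and3P[/forallP nd szf /eqP pf].
  have f0 : (f : {poly F}) != 0.
    by apply: contraTneq (nd 0) => ->; rewrite dvdp0.
  have [D [h [mD fE sh]]] := maximal_square_divisor f0.
  have nr x : ~~ root D x.
    apply: contra (nd x) => rD; rewrite fE dvdp_mulr // dvdp_exp2r //.
    by rewrite dvdp_XsubCl.
  have h0 := squarefree_neq0 sh.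
  have D1 : (0 < size D)%N by rewrite size_poly_gt0 monic_neq0.
  have h1 : (0 < size h)%N by rewrite size_poly_gt0.
  pose k := (size D).-1.
  have szD : size D = k.+1 by rewrite prednK.
  have szE : size (f : {poly F}) = (k + k + size h)%N.
    rewrite fE mulrC size_Mmonic ?monic_exp // expr2 size_Mmonic ?monic_neq0 // szD.
    by move: (size _) => s; clear; lia.
  have ki : (k < i.+1)%N by move: szf; rewrite szE; move: (size h) h1; clear; lia.
  have szh : (2 * (i - k) <= size h <= (2 * (i - k)).+1)%N.
    by move: szf; rewrite szE; move: (size h) ki; clear; lia.
  have DN : (size D <= N)%N by rewrite szD; move: ki iN; clear; lia.
  have hN : (size h <= N)%N by move: (size h) szh iN; clear; lia.
  exists (npolyp N D, npolyp N h).
    rewrite inE; apply/existsP; exists (Ordinal ki); rewrite /= !inE !npolypK //.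
    rewrite szD eqxx mD mem_enumF szh; apply/andP; split; first exact/forallP.
    apply/and3P; split=> //; first exact/asboolP.
    rewrite -pf fE -[X in _ == pattern X _](_ : k + k + 2 * (i - k) = _)%N; last first.
      by move: ki; clear; lia.
    by rewrite pattern_sqrM //; case/andP: szh.
  by apply: val_inj; rewrite /= /mul !npolypK // -fE size_npoly.
have [k ki [sz m nr h]] := inA _ Ap.
rewrite inE mulE //; have szE := szM _ _ ki sz m h.
move: h; rewrite inE => /and3P[/asboolP sh szh /eqP ph].
apply/and3P; split.
- apply/forallP => x; apply/negP => dx.
  have := dvdp_sqr_squarefree sh dx.
  by rewrite dvdp_XsubCl; apply/negP.
- by rewrite szE; move: (size _) szh ki; clear; lia.
- rewrite -ph -[X in pattern X](_ : k + k + 2 * (i - k) = _)%N; last by move: ki; clear; lia.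
  by rewrite pattern_sqrM //; case/andP: szh.
Qed.

End SquareParts.

(** * Interpolation on the projective line *)

Section Interpolation.
Variable F : finFieldType.
Local Notation q := #|F|.
Implicit Types (f h r : {poly F}) (v : {ffun option F -> F}).

Lemma eq_poly_values f h : (size f <= q)%N -> (size h <= q)%N ->
  (forall x, f.[x] = h.[x]) -> f = h.
Proof.
move=> szf szh e; apply/eqP; rewrite -subr_eq0; apply/eqP.
apply: (@roots_geq_poly_eq0 _ _ (enum F)); last first.
- rewrite -cardE (leq_trans (size_polyD _ _)) // geq_max size_polyN szf szh //.
- exact: enum_uniq.
- by apply/allP => x _; rewrite /root hornerD hornerN e subrr.
Qed.

(** Evaluation is injective on polynomials of degree below q, and both sides have q^q elements. *)
Lemma interpolation (v : F -> F) : exists2 f : {poly F}, (size f <= q)%N & forall x, f.[x] = v x.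
Proof.
pose ev (f : {poly_q F}) : {ffun F -> F} := [ffun x => (f : {poly F}).[x]].
have inj : injective ev.
  move=> f h e; apply: val_inj; apply: eq_poly_values; rewrite ?size_npoly // => x.
  by have := congr1 (fun w : {ffun F -> F} => w x) e; rewrite !ffunE.
have [|ev' _ evK] := inj_card_bij inj; first by rewrite card_npoly card_ffun.
exists (ev' [ffun x => v x]); first exact: size_npoly.
by move=> x; have := congr1 (fun w : {ffun F -> F} => w x) (evK [ffun x => v x]); rewrite !ffunE.
Qed.

Definition all_linear : {poly F} := \prod_(x : F) ('X - x%:P).

Lemma size_all_linear : size all_linear = q.+1.
Proof. by rewrite size_prod_XsubC /index_enum -enumT -cardE. Qed.

Lemma root_all_linear x : root all_linear x.
Proof. by rewrite /all_linear root_prod_XsubC mem_index_enum. Qed.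

Lemma dvdp_all_linear f : (forall x, root f x) -> exists r, f = r * all_linear.
Proof.
move=> rf; apply: uniq_roots_prod_XsubC; first by apply/allP => x _; apply: rf.
by rewrite uniq_rootsE index_enum_uniq.
Qed.

Variables (N k : nat) (Al : option F -> {set F}).
Hypothesis kN : (k < N)%N.

Definition valued_forms : {set {poly_N F}} :=
  [set f : {poly_N F} | (size (f : {poly F}) <= k.+1)%N &&
    [forall P, point_value k f P \in Al P]]%SET.

Let values (f : {poly F}) : {ffun option F -> F} := [ffun P => point_value k f P].

Let valuesE f P : values f P = point_value k f P. Proof. exact: ffunE. Qed.

(** For k <= q the q + 1 values determine the form: with equal values at infinity, a difference has
    degree below q and vanishes on all of F. *)
Lemma card_valued_forms_le : (k <= q)%N -> (#|valued_forms| <= \prod_P #|Al P|)%N.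
Proof.
move=> kq; have inj : {in valued_forms &, injective (fun f : {poly_N F} => values f)}.
  move=> f h; rewrite !inE => /andP[szf _] /andP[szh _] e; apply: val_inj => /=.
  have vE P : point_value k f P = point_value k h P by rewrite -!valuesE e.
  apply/eqP; rewrite -subr_eq0; apply/eqP; apply: eq_poly_values; rewrite ?size_poly0 //.
    apply: leq_trans kq; apply/leq_sizeP => j; rewrite leq_eqVlt => /orP[/eqP<-|kj].
      by have /= := vE None; rewrite coefB => ->; rewrite subrr.
    by rewrite coefB !nth_default ?subrr // (leq_trans _ kj).
  by move=> x; have /= := vE (Some x); rewrite hornerD hornerN horner0 => ->; rewrite subrr.
rewrite -(card_in_imset inj).
have -> : (\prod_P #|Al P| = #|family (fun P => mem (Al P))|)%N.
  by rewrite card_family foldrE big_map big_enum.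
apply: subset_leq_card; apply/fintype.subsetP => v /imsetP[f].
rewrite inE => /andP[_ /forallP h] ->.
by apply/familyP => P; rewrite valuesE.
Qed.

(** For k >= q every choice of values is attained, and the solutions differ by the q^(k - q)
    multiples of X^q - X of degree below k. *)
Lemma card_valued_forms : (q <= k)%N ->
  #|valued_forms| = (\prod_P #|Al P| * q ^ (k - q))%N.
Proof.
move=> qk.
have /boolp.choice[L LE] : forall v : {ffun option F -> F}, exists f : {poly F},
    (size f <= k.+1)%N /\ forall P, point_value k f P = v P.
  (* The multiple of X^k sets the value at infinity; the interpolating correction has degree below q
     <= k and does not disturb it. *)
  move=> v; have [l szl lE] := interpolation (fun x => v (Some x) - v None * x ^+ k).
  exists (v None *: 'X^k + l); split.
    rewrite (leq_trans (size_polyD _ _)) // geq_max.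
    rewrite (leq_trans (size_scale_leq _ _)) ?size_polyXn //=.
    by rewrite (leq_trans szl) // ltnW.
  move=> [x|] /=; first by rewrite hornerD hornerZ hornerXn lE addrC subrK.
  by rewrite coefD coefZ coefXn eqxx mulr1 nth_default ?addr0 // (leq_trans szl).
have szr (r : {poly_(k - q) F}) : (size ((r : {poly F}) * all_linear)%R <= k)%N.
  have [->|r0] := eqVneq (r : {poly F}) 0; first by rewrite mul0r size_poly0.
  rewrite size_mul // ?size_all_linear; last by rewrite -size_poly_gt0 size_all_linear.
  by have := size_npoly r; move: (size _) qk; clear; lia.
pose h (p : {ffun option F -> F} * {poly_(k - q) F}) : {poly_N F} :=
  npolyp N (L p.1 + (p.2 : {poly F}) * all_linear).
have szh (p : {ffun option F -> F} * {poly_(k - q) F}) :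
    (size (L p.1 + (p.2 : {poly F}) * all_linear)%R <= k.+1)%N.
  by rewrite (leq_trans (size_polyD _ _)) // geq_max (LE _).1 (leq_trans (szr _)).
have hE p : h p = L p.1 + (p.2 : {poly F}) * all_linear :> {poly F}.
  by rewrite npolypK // (leq_trans (szh p)).
have hv p P : point_value k (h p) P = p.1 P.
  rewrite hE -(LE p.1).2; case: P => [x|] /=.
    by rewrite hornerD hornerM (rootP (root_all_linear x)) mulr0 addr0.
  by rewrite coefD [X in _ + X]nth_default ?addr0 ?szr.
have hinj : injective h.
  move=> [v r] [v' r'] e; have vv : v = v' by apply/ffunP => P; rewrite -(hv (v, r)) e hv.
  congr pair => //; apply: val_inj; apply: (mulIf (x := all_linear)).
    by rewrite -size_poly_gt0 size_all_linear.
  by apply: (addrI (L v)); have := hE (v, r); rewrite e hE /= vv.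
have -> : (\prod_P #|Al P| * q ^ (k - q) =
    #|finset.setX [set v in family (fun P => mem (Al P))]%SET [set: {poly_(k - q) F}]%SET|)%N.
  by rewrite cardsX cardsT card_npoly cardsE card_family foldrE big_map big_enum.
rewrite -(card_imset _ hinj); apply: eq_card => f; rewrite inE.
apply/andP/imsetP => [[szf /forallP vf]|[[v r] + ->]]; last first.
  rewrite finset.in_setX inE => /andP[/familyP vA _]; rewrite hE szh; split=> //.
  by apply/forallP => P; rewrite -hE hv; apply: vA.
have [|r rE] := @dvdp_all_linear ((f : {poly F}) - L (values f)).
  move=> x; rewrite /root hornerD hornerN.
  by have /= -> := (LE (values f)).2 (Some x); rewrite valuesE subrr.
have szd : (size ((f : {poly F}) - L (values f))%R <= k)%N.
  apply/leq_sizeP => j; rewrite leq_eqVlt => /orP[/eqP<-|kj].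
    by rewrite coefB; have /= -> := (LE (values f)).2 None; rewrite valuesE subrr.
  by rewrite coefB !nth_default ?subrr // (leq_trans _ kj) ?(LE _).1.
have szr' : (size r <= k - q)%N.
  have [->|r0] := eqVneq r 0; first by rewrite size_poly0.
  move: szd; rewrite rE size_mul // ?size_all_linear; last first.
    by rewrite -size_poly_gt0 size_all_linear.
  by move: (size r) => s; clear; lia.
exists (values f, npolyp (k - q) r).
  by rewrite finset.in_setX !inE andbT; apply/familyP => P; rewrite valuesE; apply: vf.
by apply: val_inj; rewrite /= hE /= npolypK // -rE addrC subrK.
Qed.

End Interpolation.

(** * Reduced forms with a given pattern *)

Section ReducedForms.
Variables (F : finFieldType) (N n : nat) (e : {ffun option F -> option bool}).
Hypotheses (oddF : odd #|F|) (nN : (n < N)%N).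
Local Notation q := #|F|.

Let Z : {set F} := [set x | e (Some x) == None]%SET.
Let M : {poly F} := \prod_(x in Z) ('X - x%:P).
Let inf0 : nat := (e None == None).

Definition nzeros : nat := #|[set P | e P == None]%SET|.

Lemma nzerosE : nzeros = (#|Z| + inf0)%N.
Proof.
rewrite /nzeros -!sum1_card big_mkcond /=.
rewrite (sum_option (fun P => if P \in [set P0 | e P0 == None]%SET then 1%N else 0%N)).
rewrite addrC; congr (_ + _)%N; last by rewrite /inf0 inE; case: (_ == _).
by rewrite [RHS]big_mkcond; apply: eq_bigr => x _; rewrite !inE.
Qed.

Let monM : M \is monic. Proof. exact: monic_prod_XsubC. Qed.

Let szM : size M = #|Z|.+1.
Proof. by rewrite /M -big_enum size_prod_XsubC -cardE. Qed.

Let rootMZ x : root M x = (x \in Z).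
Proof. by rewrite /M -big_enum root_prod_XsubC mem_enum. Qed.

(* Dividing a reduced form by the linear factors M of its prescribed rational zeros leaves a
   form of degree n - nzeros that is constrained only through its values. *)
Definition allowed (P : option F) : {set F} :=
  if e P is Some b then [set y | fsign ((if P is Some x then M.[x] else 1) * y) == Some b]%SET
  else [set y | y != 0]%SET.

Lemma fsign_eq0 (y : F) : (fsign y == None) = (y == 0).
Proof. by rewrite /fsign; case: (y == 0). Qed.

Lemma allowed_infty_neq0 y : y \in allowed None -> y != 0.
Proof.
rewrite /allowed; case: (e None) => [b|]; rewrite inE //.
by rewrite mul1r => /eqP E; rewrite -fsign_eq0 E.
Qed.

Let mulM (h : {poly_N F}) : {poly_N F} := npolyp N ((h : {poly F}) * M).

Let size_valued (h : {poly_N F}) : (nzeros <= n)%N -> h \in valued_forms N (n - nzeros) allowed ->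
  size (h : {poly F}) = (n - nzeros).+1.
Proof.
move=> mn; rewrite inE => /andP[szh /forallP/(_ None) /allowed_infty_neq0 /= h0].
apply/eqP; rewrite eqn_leq szh ltnNge; apply: contraNN h0 => sz.
by rewrite nth_default.
Qed.

Let inf0_le1 : (inf0 <= 1)%N. Proof. exact: leq_b1. Qed.

Let size_mulM (h : {poly_N F}) : (nzeros <= n)%N -> h \in valued_forms N (n - nzeros) allowed ->
  size ((h : {poly F}) * M) = (n.+1 - inf0)%N.
Proof.
move=> mn hV; rewrite size_Mmonic -?size_poly_gt0 ?(size_valued mn hV) // szM.
by move: mn inf0_le1; rewrite nzerosE; move: #|Z| inf0; clear; lia.
Qed.

Let mulME (h : {poly_N F}) : (nzeros <= n)%N -> h \in valued_forms N (n - nzeros) allowed ->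
  mulM h = (h : {poly F}) * M :> {poly F}.
Proof. by move=> mn hV; rewrite npolypK // size_mulM // (leq_trans (leq_subr _ _)). Qed.

Let reduced_factor (f : {poly_N F}) : f \in reduced_forms N n e ->
  exists h, [/\ h != 0, (f : {poly F}) = h * M & size (f : {poly F}) = (n.+1 - inf0)%N].
Proof.
rewrite inE => /and3P[/forallP nd /andP[szf szf'] /eqP pf].
have eP P : e P = fsign (point_value n f P) by rewrite -pf ffunE.
have [h hE] : exists h, (f : {poly F}) = h * M.
  rewrite /M -big_enum; apply: uniq_roots_prod_XsubC.
    by apply/allP => x; rewrite mem_enum inE eP /= fsign_eq0.
  by rewrite uniq_rootsE enum_uniq.
have f0 : (f : {poly F}) != 0.
  by apply: contraTneq (nd 0) => ->; rewrite dvdp0.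
have h0 : h != 0 by apply: contraNneq f0 => h0; rewrite hE h0 mul0r.
have szfE : size (f : {poly F}) = (n.+1 - inf0)%N.
  rewrite /inf0 eP fsign_eq0 /=; case: eqP => [fn|/eqP fn].
    rewrite subn1 /=; apply/eqP; rewrite eqn_leq szf andbT.
    apply/leq_sizeP => j; rewrite leq_eqVlt => /orP[/eqP<-//|nj].
    by rewrite nth_default // (leq_trans szf').
  rewrite subn0; apply/eqP; rewrite eqn_leq szf' ltnNge; apply: contraNN fn => sz.
  by rewrite nth_default.
by exists h.
Qed.

Lemma reduced_nzeros (f : {poly_N F}) : f \in reduced_forms N n e -> (nzeros <= n)%N.
Proof.
move=> /reduced_factor[h [h0 -> ]]; rewrite size_Mmonic // szM nzerosE.
have : (0 < size h)%N by rewrite size_poly_gt0.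
by move: inf0_le1; move: (size h) #|Z| inf0; clear; lia.
Qed.

(** The bijection is multiplication by [M]. A prescribed zero is simple exactly when the quotient
    does not vanish there. A zero at infinity counts in [nzeros] but not in [M], so h M then has
    degree n - 1. *)
Lemma card_reduced_valued : (nzeros <= n)%N ->
  #|reduced_forms N n e| = #|valued_forms N (n - nzeros) allowed|.
Proof.
move=> mn; have inj : {in valued_forms N (n - nzeros) allowed &, injective mulM}.
  move=> h h' hV hV' E; apply/val_inj/(mulIf (monic_neq0 monM)).
  by rewrite /= -(mulME mn hV) -(mulME mn hV') E.
rewrite -(card_in_imset inj); apply: eq_card => f.
apply/idP/imsetP => [|[h hV ->]].
  move=> fR; have [h [h0 hE szfE]] := reduced_factor fR.
  move: fR; rewrite inE => /and3P[/forallP nd /andP[szf szf'] /eqP pf].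
  have eP P : e P = fsign (point_value n f P) by rewrite -pf ffunE.
  have szh : size h = (n - nzeros).+1.
    have : (0 < size h)%N by rewrite size_poly_gt0.
    move: szfE; rewrite hE size_Mmonic // szM nzerosE; move: mn inf0_le1; rewrite nzerosE.
    by move: (size h) #|Z| inf0; clear; lia.
  have hN : (size h <= N)%N by rewrite szh (leq_trans _ nN) // ltnS leq_subr.
  have hV : npolyp N h \in valued_forms N (n - nzeros) allowed.
    rewrite inE npolypK // szh leqnn /=; apply/forallP => P; rewrite /allowed.
    case E : (e P) => [b|]; rewrite inE.
      rewrite -E eP; apply/eqP; congr fsign; case: P E => [x|] E /=.
        by rewrite hE hornerM mulrC.
      rewrite mul1r hE; have nE : (n - nzeros + #|Z| = n)%N.
        by move: mn; rewrite nzerosE /inf0 E /=; move: #|Z|; clear; lia.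
      rewrite -[in RHS]nE coef_top_mul ?szh ?szM //.
      by have := monicP monM; rewrite lead_coefE szM /= => ->; rewrite mulr1.
    case: P E => [x|] E /=.
      have xZ : x \in Z by rewrite inE E.
      apply: contra (nd x) => hx; rewrite hE expr2; apply: dvdp_mul.
        by rewrite dvdp_XsubCl.
      by rewrite dvdp_XsubCl rootMZ.
    have := lead_coef_eq0 h; rewrite lead_coefE szh /= => ->.
    exact: h0.
  exists (npolyp N h) => //; apply: val_inj.
  by rewrite /= mulME // npolypK.
have szE := size_mulM mn hV; have szh := size_valued mn hV.
move: (hV); rewrite inE => /andP[_ /forallP vA].
have val P : if e P is Some b then fsign (point_value n (mulM h) P) == Some b
             else point_value n (mulM h) P == 0.
  rewrite mulME //; have := vA P; rewrite /allowed; case E : (e P) => [b|]; rewrite inE.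
    move=> /eqP <-; apply/eqP; congr fsign; case: P E => [x|] E /=.
      by rewrite hornerM mulrC.
    have nE : (n - nzeros + #|Z| = n)%N.
      by move: mn; rewrite nzerosE /inf0 E /=; move: #|Z|; clear; lia.
    rewrite -[in LHS]nE coef_top_mul ?szh ?szM //.
    by have := monicP monM; rewrite lead_coefE szM /= => ->; rewrite mulr1 mul1r.
  case: P E => [x|] E /= _.
    by rewrite hornerM mulf_eq0 -!/(root _ _) rootMZ inE E eqxx orbT.
  by rewrite nth_default // szE /inf0 E eqxx subn1.
rewrite inE; apply/and3P; split.
- apply/forallP => x; apply/negP => dx; have := val (Some x); case E : (e (Some x)) => [b|] /=.
    have : root (mulM h : {poly F}) x.
      by rewrite -dvdp_XsubCl; apply: dvdp_trans dx; rewrite expr2 dvdp_mulr.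
    by rewrite /root -fsign_eq0 => /eqP->.
  move=> _; have xZ : x \in Z by rewrite inE E.
  have := vA (Some x); rewrite /allowed E inE /= => /negP; apply.
  move: dx; rewrite mulME // /M (big_setD1 x) //= mulrCA expr2 dvdp_mul2l ?polyXsubC_eq0 //.
  rewrite dvdp_XsubCl rootM => /orP[//|]; rewrite -big_enum root_prod_XsubC mem_enum.
  by rewrite !inE eqxx.
- by rewrite mulME // szE; move: inf0_le1; clear; lia.
- apply/eqP/ffunP => P; rewrite ffunE; have := val P; case: (e P) => [b /eqP//|].
  by rewrite -fsign_eq0 => /eqP.
Qed.

End ReducedForms.

(** * Numbers of values with a given sign *)

Section SignCounts.
Variable F : finFieldType.
Hypothesis oddF : odd #|F|.
Local Notation q := #|F|.

Lemma card_gt2 : (2 < q)%N.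
Proof. by have := card_finNzRing_gt1 F; case: #|F| oddF => [|[|[|k]]]. Qed.

(** Counting the square roots of all y counts each element of F once, for a total of q. *)
Lemma sum_qchar : \sum_(y : F) qchar y = 0.
Proof.
apply: (addrI (q%:Z)); rewrite addr0 -[X in X + _]natz -sumr_const -big_split /=.
under eq_bigr do rewrite -card_sqrt //.
rewrite -(big_morph Posz PoszD (erefl _)); congr Posz.
transitivity (\sum_(y : F) \sum_(z : F) (z ^+ 2 == y)%R)%N.
  by apply: eq_bigr => y _; rewrite -sum1_card big_mkcond; apply: eq_bigr => z _; rewrite inE.
rewrite exchange_big -[RHS]sum1_card; apply: eq_bigr => z _.
by rewrite (bigD1 (z ^+ 2)) //= eqxx big1 // => y; rewrite eq_sym => /negPf ->.
Qed.

(** By [sum_qchar] the nonzero squares are as numerous as the nonsquares, and together they are q -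
    1. *)
Lemma card_fsign b : #|[set y : F | fsign y == Some b]%SET| = q.-1./2.
Proof.
have cardE s : (#|[set y : F | fsign y == s]%SET| = \sum_(y : F) (fsign y == s))%N.
  by rewrite -sum1_card big_mkcond; apply: eq_bigr => y _; rewrite inE.
have eqb : #|[set y : F | fsign y == Some true]%SET| = #|[set y : F | fsign y == Some false]%SET|.
  have := sum_qchar.
  rewrite (eq_bigr (fun y : F => (fsign y == Some true)%:Z - (fsign y == Some false)%:Z)).
    rewrite big_split /= -(big_morph Posz PoszD (erefl _)) -cardE.
    rewrite -(big_morph (fun x : int => - x) (@opprD _) (oppr0 _)).
    by rewrite -(big_morph Posz PoszD (erefl _)) -cardE => /eqP; rewrite subr_eq0 => /eqP[].
  by move=> y _; rewrite /qchar; case: (fsign y) => [[]|].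
have total : (#|[set y : F | fsign y == Some true]%SET| +
    #|[set y : F | fsign y == Some false]%SET| = q.-1)%N.
  rewrite !cardE -big_split /=; transitivity (\sum_(y : F) (y != 0)%R)%N.
    by apply: eq_bigr => y _; rewrite -fsign_eq0; case: (fsign y) => [[]|].
  by rewrite -(cardC1 (0 : F)) -sum1_card [RHS]big_mkcond; apply: eq_bigr => y _; rewrite inE.
by move: eqb total; case: b => [<-|->] <-; rewrite addnn doubleK.
Qed.

Definition sign_weight (s : option bool) : nat := if s is Some _ then q.-1./2 else q.-1.

Lemma card_allowed (e : {ffun option F -> option bool}) P :
  #|allowed e P| = sign_weight (e P).
Proof.
rewrite /allowed /sign_weight; case E : (e P) => [b|]; last first.
  by rewrite -(cardC1 (0 : F)); apply: eq_card => y; rewrite !inE.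
pose c : F := if P is Some x
  then (\prod_(z in [set z | e (Some z) == None]%SET) ('X - z%:P)).[x] else 1.
have c0 : c != 0.
  rewrite /c; clear c; case: P E => [x|] E; last exact: oner_neq0.
  by rewrite -/(root _ _) -big_enum root_prod_XsubC mem_enum inE E.
rewrite -/c -(card_fsign b).
rewrite -(card_imset [set y | fsign (c * y) == Some b]%SET (mulfI c0)); apply: eq_card => y.
rewrite inE; apply/imsetP/idP => [[x + ->]|yb]; first by rewrite inE.
by exists (c^-1 * y); rewrite ?inE mulrA mulfV ?mul1r.
Qed.

Definition pattern_weight (e : {ffun option F -> option bool}) : nat :=
  (\prod_P sign_weight (e P))%N.

Lemma card_reduced_forms_large N n (e : {ffun option F -> option bool}) : (n < N)%N ->
  (q + nzeros e <= n)%N -> #|reduced_forms N n e| = (pattern_weight e * q ^ (n - nzeros e - q))%N.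
Proof.
move=> nN qmn; have mn : (nzeros e <= n)%N by rewrite (leq_trans _ qmn) ?leq_addl.
rewrite card_reduced_valued // card_valued_forms ?leq_subRL // ?(leq_ltn_trans (leq_subr _ _)) //.
  by congr (_ * _)%N; apply: eq_bigr => P _; apply: card_allowed.
by rewrite addnC.
Qed.

Lemma card_reduced_forms_small N n (e : {ffun option F -> option bool}) : (n < N)%N ->
  (n < q + nzeros e)%N -> (#|reduced_forms N n e| <= pattern_weight e)%N.
Proof.
move=> nN qmn; have [mn|nm] := leqP (nzeros e) n.
  rewrite card_reduced_valued //; have kq : (n - nzeros e <= q)%N by rewrite leq_subLR addnC ltnW.
  apply: leq_trans (card_valued_forms_le N (allowed e) kq) _.

  by rewrite (eq_bigr _ (fun P _ => card_allowed e P)).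
rewrite (_ : reduced_forms N n e = finset.set0) ?cards0 //.
apply/setP => f; rewrite [RHS]inE; apply/negP => /reduced_nzeros.
by rewrite leqNgt nm.
Qed.

End SignCounts.

(** * Squarefree forms with a given pattern *)

Section SquarefreeEstimate.
Variables (R : realFieldType) (F : finFieldType) (N : nat).
Hypothesis oddF : odd #|F|.
Local Notation q := (#|F|%:R : R).
Implicit Types e : {ffun option F -> option bool}.

(* The coefficients of (1 - q T) / (1 - T)^q, the inverse of the generating function of the
   monic polynomials without roots. They equal the sums of the Moebius function over such
   polynomials of degree k. *)
Definition sieve_coef k : R :=
  if k is k'.+1 then (neg_binomial #|F| k'.+1)%:R - q * (neg_binomial #|F| k')%:R else 1.

Lemma sieve_coef_bound k : `|sieve_coef k| <= q ^+ k.
Proof.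
case: k => [|k] /=; first by rewrite normr1 expr0.
have h1 : ((neg_binomial #|F| k.+1)%:R : R) <= q * (neg_binomial #|F| k)%:R.
  by rewrite -natrM ler_nat neg_binomial_growth.
have h2 : q * (neg_binomial #|F| k)%:R <= q ^+ k.+1.
  by rewrite exprS ler_wpM2l ?ler0n // -natrX ler_nat neg_binomial_bound.
rewrite ler0_norm ?subr_le0 // opprB; apply: le_trans h2.
by rewrite lerBlDr lerDl ler0n.
Qed.

(** [card_reduced_forms] reads t = a s. The sieve series (1 - q T) c inverts [a], because c a = w
    and (1 - q T) w = 1. *)
Lemma squarefree_inversion h e : (2 * h < N)%N ->
  (#|squarefree_forms N (2 * h) e|%:R : R) =
  \sum_(k < h.+1) sieve_coef k * (#|reduced_forms N (2 * (h - k)) e|)%:R.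
Proof.
move=> hN; have hN' : (h < N)%N by move: hN; clear; lia.
have N0 : (0 < N)%N by apply: leq_ltn_trans hN'.
pose s := gseries N (fun i => (#|squarefree_forms N (2 * i) e|)%:R : R).
pose t := gseries N (fun i => (#|reduced_forms N (2 * i) e|)%:R : R).
pose a := gseries N (fun i => (#|rootless N (enum F) i|)%:R : R).
pose c := gseries N (fun i => (neg_binomial #|F| i)%:R : R).
pose w := gseries N (fun i => (#|F| ^ i)%:R : R).
(* Truncation at h + 1 keeps the degrees 2k of the forms below [N]. *)
have et : eqtrunc h.+1 t (a * s).
  move=> k kh; have kN : (k < N)%N by rewrite (leq_trans kh).
  rewrite coef_gseries // coef_gseries_mul // card_reduced_forms.
    by rewrite natr_sum; apply: eq_bigr => i _; rewrite natrM.
  by move: kh hN; clear; lia.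
have eb : eqtrunc N (gseries N sieve_coef) ((1 - q *: 'X) * c).
  by apply: gseries_diff => [k kN|] //; rewrite neg_binomial0.
have ew : eqtrunc N ((1 - q *: 'X) * w) 1.
  move=> k kN; rewrite mulrBl mul1r coefB -scalerAl coefZ coefXM coef1 coef_gseries //.
  case: k kN => [|k] kN /=; first by rewrite mulr0 subr0.
  by rewrite coef_gseries 1?ltnW // expnS natrM subrr.
have eca : eqtrunc N (c * a) w.
  by have := @rootless_gseries F N R (enum F) (enum_uniq _) N0; rewrite -cardE.
have le_trunc (p r : {poly R}) : eqtrunc N p r -> eqtrunc h.+1 p r.
  by move=> E k kh; apply: E; rewrite (leq_trans kh).
have : eqtrunc h.+1 (gseries N sieve_coef * t) (1 * s).
  refine (eqtrunc_trans (eqtrunc_mul (le_trunc _ _ eb) et) _).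
  rewrite mulrA -[_ * c * a]mulrA; apply: eqtrunc_mul => //; apply: le_trunc.
  apply: eqtrunc_trans ew; exact: eqtrunc_mul.
move=> /(_ h (ltnSn _)); rewrite mul1r coef_gseries_mul // coef_gseries //.
Qed.

(** The factor of the main term that depends on the pattern; by [pattern_ratioE] it is proportional
    to the probability in the model. *)
Definition pattern_ratio e : R := (pattern_weight e)%:R / q ^+ nzeros e.

Lemma q_gt0 : 0 < q.
Proof. by rewrite ltr0n; have := card_gt2 oddF; case: #|F|. Qed.

(** In large degree the main term is exact; in small degree it and the count both lie between 0 and
    the weight. *)
Lemma reduced_estimate n e : (n < N)%N ->
  `|(#|reduced_forms N n e|)%:R - pattern_ratio e * (q ^+ n / q ^+ #|F|)| <= (pattern_weight e)%:R.
Proof.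
move=> nN; have q0 := q_gt0; have qn0 : q != 0 by rewrite gt_eqF.
have E : pattern_ratio e * (q ^+ n / q ^+ #|F|) =
    (pattern_weight e)%:R * (q ^+ n / q ^+ (#|F| + nzeros e)).
  rewrite /pattern_ratio exprD.
  have := expf_neq0 (nzeros e) qn0; have := expf_neq0 #|F| qn0.
  move: (q ^+ nzeros e) (q ^+ #|F|) (q ^+ n) => x y z y0 x0; field.
  by rewrite x0 y0.
have [qmn|nqm] := leqP (#|F| + nzeros e) n.
  rewrite E card_reduced_forms_large // natrM natrX.
  rewrite -[in X in q ^+ X / _](subnK qmn) exprD mulfK ?expf_neq0 //.
  by rewrite -subnDA [(nzeros e + _)%N]addnC subrr normr0 ler0n.
have hi : (#|reduced_forms N n e|%:R : R) <= (pattern_weight e)%:R.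
  by rewrite ler_nat card_reduced_forms_small.
have lo : 0 <= pattern_ratio e * (q ^+ n / q ^+ #|F|) <= (pattern_weight e)%:R.
  rewrite E; apply/andP; split.
    by rewrite mulr_ge0 ?ler0n // divr_ge0 // exprn_ge0 // ler0n.
  rewrite ler_piMr ?ler0n // ler_pdivrMr ?exprn_gt0 // mul1r.
  apply: ler_weXn2l; last exact: ltnW.
  by rewrite ler1n; have := card_gt2 oddF; case: #|F|.
case/andP: lo => lo1 lo2; have := ler0n R #|reduced_forms N n e|.
rewrite ler_norml; move: (_%:R) hi (pattern_ratio e * _) lo1 lo2 => x hi y lo1 lo2 x0.
by apply/andP; split; lra.
Qed.

Lemma sum_geometric_le h : \sum_(k < h.+1) q ^+ k <= 2 * q ^+ h.
Proof.
elim: h => [|h IH]; first by rewrite big_ord_recl big_ord0 expr0; lra.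
rewrite big_ord_recr /=; apply: le_trans (_ : 2 * q ^+ h + q ^+ h.+1 <= _); first by rewrite lerD2r.
have : 2 * q ^+ h <= q ^+ h.+1.
  by rewrite exprS ler_wpM2r ?exprn_ge0 ?ler0n // ler_nat ltnW // card_gt2.
by move=> ?; lra.
Qed.

(** [K] collects the factors without [e]. Its value never matters: comparison with the total count
    eliminates it. *)
Lemma squarefree_estimate h : (2 * h < N)%N -> exists K : R, forall e,
  `|(#|squarefree_forms N (2 * h) e|)%:R - K * pattern_ratio e| <=
    2 * q ^+ h * (pattern_weight e)%:R.
Proof.
move=> hN.
exists (\sum_(k < h.+1) sieve_coef k * (q ^+ (2 * (h - k)) / q ^+ #|F|)) => e.
rewrite squarefree_inversion // mulr_suml -sumrB.
apply: le_trans (ler_norm_sum _ _ _) _.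
apply: le_trans (_ : \sum_(k < h.+1) q ^+ k * (pattern_weight e)%:R <= _); last first.
  by rewrite -mulr_suml ler_wpM2r ?ler0n // sum_geometric_le.
apply: ler_sum => k _; rewrite -mulrA -mulrBr normrM; apply: ler_pM => //.
  exact: sieve_coef_bound.
rewrite [_ / _ * pattern_ratio e]mulrC; apply: reduced_estimate.
by apply: leq_ltn_trans hN; rewrite leq_mul2l leq_subr.
Qed.

End SquarefreeEstimate.

(** * Lower bound for the number of squarefree forms *)

Section SquarefreeLowerBound.
Variables (F : finFieldType) (N n : nat).
Hypotheses (q2 : (2 < #|F|)%N) (n_gt0 : (0 < n)%N) (NE : N = n.+1).
Local Notation q := #|F|.

(** The term q^(m - k) carries the induction, each step using 3 <= q. *)
Lemma sum_geometric_half m k : (k <= m)%N ->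
  (2 * \sum_(i < k) q ^ (m - i.+1) + q ^ (m - k) <= q ^ m)%N.
Proof.
elim: k => [|k IH] km; first by rewrite big_ord0 muln0 add0n subn0.
rewrite big_ord_recr /= mulnDr; apply: leq_trans (IH (ltnW km)).
rewrite -addnA leq_add2l.
have -> : (m - k = (m - k.+1).+1)%N by rewrite subnSK.
by rewrite expnS -[X in (_ + X <= _)%N]mul1n -mulnDl leq_mul2r q2 orbT.
Qed.

(** Union bound over the polynomials of too small degree ([A]) and the multiples of squares of monic
    polynomials of degree k + 1 ([B k]): at most q^N / 9 + q^N / 2, hence at most 2 q^N / 3. *)
Lemma card_squarefree_ge :
  (q ^ N <= 3 * #|[set f : {poly_N F} | `[< squarefree (f : {poly F}) >] &&
    (n <= size (f : {poly F}))%N]%SET|)%N.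
Proof.
set G := [set f | _]%SET.
pose A := [set npolyp N (f : {poly F}) | f : {poly_n.-1 F}]%SET.
pose B k :=
  [set npolyp N (((p.1 : {poly_N F}) : {poly F}) ^+ 2 * (p.2 : {poly_(N - k.+1 - k.+1) F}))
  | p in finset.setX (rootless N [::] k.+1) [set: {poly_(N - k.+1 - k.+1) F}]%SET]%SET.
have cover : [set: {poly_N F}]%SET \subset G :|: A :|: \bigcup_(k < n./2) B k.
  apply/fintype.subsetP => f _; rewrite !inE.
  have [szn|szn] := leqP n (size (f : {poly F})); last first.
    apply/orP; left; apply/orP; right; apply/imsetP; exists (npolyp n.-1 (f : {poly F})) => //.
    have E : npolyp n.-1 (f : {poly F}) = f :> {poly F}.
      by rewrite npolypK // -ltnS prednK.
    by apply: val_inj; rewrite /= E npolypK // size_npoly.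
  rewrite andbT; have [sf|nsf] := pselect (squarefree (f : {poly F})).
    by apply/orP; left; apply/orP; left; apply/asboolP.
  apply/orP; right; apply/finset.bigcupP.
  have [f0|f0] := eqVneq (f : {poly F}) 0.
    by move: szn; rewrite f0 size_poly0 leqNgt n_gt0.
  have [D [h [mD fE sh]]] := maximal_square_divisor f0.
  have h0 := squarefree_neq0 sh.
  have h1 : (0 < size h)%N by rewrite size_poly_gt0.
  have D1 : (1 < size D)%N.
    rewrite ltnNge; apply/negP => D1; apply: nsf.
    have : D = 1.
      have := monicP mD; rewrite (size1_polyC D1) lead_coefC => ->; exact: polyC1.
    by rewrite fE => ->; rewrite expr1n mul1r.
  have szf : size (f : {poly F}) = (size h + (size D).-1 + (size D).-1)%N.
    rewrite fE mulrC size_Mmonic ?monic_exp // expr2 size_Mmonic ?monic_neq0 //.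
    by move: (size h) (size D) D1; clear; lia.
  have szfN : (size h + (size D).-1 + (size D).-1 <= n.+1)%N by rewrite -szf -NE size_npoly.
  pose k := (size D).-2; have szD : size D = k.+2 by rewrite /k; move: (size D) D1; clear; lia.
  have kn : (k < n./2)%N.
    by move: szfN; rewrite szD /=; move: (size h) h1; clear; lia.
  exists (Ordinal kn) => //; apply/imsetP.
  have DN : (size D <= N)%N by move: szfN; rewrite szD NE; move: (size h) h1; clear; lia.
  have hN : (size h <= N - k.+1 - k.+1)%N.
    by move: szfN; rewrite szD NE; move: (size h) h1; clear; lia.
  exists (npolyp N D, npolyp (N - k.+1 - k.+1) h).
    by rewrite finset.in_setX !inE /= npolypK // szD eqxx mD.
  by apply: val_inj; rewrite /= !npolypK // -fE size_npoly.
have := subset_leq_card cover; rewrite cardsT card_npoly.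
have cB k : (k < n./2)%N -> (#|B k| <= q ^ (N - k.+1))%N.
  move=> kn; apply: leq_trans (leq_imset_card _ _) _.
  rewrite cardsX card_rootless_nil ?cardsT ?card_npoly -?expnD; last first.
    by rewrite NE; move: kn; clear; lia.
  by rewrite leq_exp2l ?(ltnW q2) //; move: kn; rewrite NE; clear; lia.
have cA : (#|A| <= q ^ n.-1)%N by apply: leq_trans (leq_imset_card _ _) _; rewrite card_npoly.
have cU : (#|\bigcup_(k < n./2) B k| <= \sum_(k < n./2) q ^ (N - k.+1))%N.
  apply: (big_rec2 (fun (X : {set {poly_N F}}) s => #|X| <= s)%N) => [|k s X _ XS].
    by rewrite cards0.
  apply: leq_trans (leq_card_setU _ _) _; apply: leq_add XS; apply: cB.
  exact: ltn_ord.
have c1 := leq_trans (leq_card_setU (G :|: A) (\bigcup_(k < n./2) B k))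
  (leq_add (leq_card_setU G A) cU).
move=> /leq_trans/(_ c1) total.
have hN : (n./2 <= N)%N by rewrite NE; clear; lia.
have geo : (2 * \sum_(k < n./2) q ^ (N - k.+1) <= q ^ N)%N.
  by apply: leq_trans (sum_geometric_half hN); rewrite leq_addr.
have q9 : (9 * q ^ n.-1 <= q ^ N)%N.
  have -> : (q ^ N = q ^ 2 * q ^ n.-1)%N.
    by rewrite -expnD NE; congr (q ^ _)%N; move: n_gt0; clear; lia.
  rewrite leq_mul2r; apply/orP; right; rewrite (leq_trans _ (_ : 3 ^ 2 <= q ^ 2)%N) // leq_exp2r //.
move: total geo q9 cA; move: #|G| #|A| (q ^ N)%N (q ^ n.-1)%N (\sum_(k < _) _)%N; clear; lia.
Qed.

End SquarefreeLowerBound.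

(** * The random model *)

Section DiscreteSum.
Local Open Scope classical_set_scope.
Context (R : realType) (d : measure_display) (T : measurableType d) (P : probability T R).

Lemma fine_measure_finType (I : finType) (E : I -> set T) (G : pred I) :
  (forall i, measurable (E i)) -> trivIset setT E ->
  fine (P (\bigcup_(i in [set i | G i]) E i)) = \sum_(i | G i) fine (P (E i)).
Proof.
move=> mE tE; have GE : [set i | G i] = [set` enum G].
  by apply/seteqP; split=> i /=; rewrite mem_enum.
rewrite GE measure_fin_bigcup //; last exact: sub_trivIset tE.
rewrite -fsbig_seq ?enum_uniq // -sum_fine; last by move=> i _; apply: fin_num_measure.
by rewrite big_enum.
Qed.

(** The atoms exhaust the probability, if not the space; the lower bounds for [A] and its complement
    add up to 1, so both are equalities. *)
Lemma probability_of_atoms (I : finType) (E : I -> set T) (G : pred I) (A : set T) :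
  (forall i, measurable (E i)) -> trivIset setT E -> \sum_i fine (P (E i)) = 1 ->
  measurable A -> (forall i, G i -> E i `<=` A) -> (forall i, ~~ G i -> E i `<=` ~` A) ->
  fine (P A) = \sum_(i | G i) fine (P (E i)).
Proof.
move=> mE tE s1 mA GA GC.
have mU (H : pred I) : measurable (\bigcup_(i in [set i | H i]) E i).
  by apply: fin_bigcup_measurable => // i _.
have le (B : set T) (H : pred I) : measurable B -> (forall i, H i -> E i `<=` B) ->
    \sum_(i | H i) fine (P (E i)) <= fine (P B).
  move=> mB HB; rewrite -fine_measure_finType // fine_le ?fin_num_measure //.
  by apply: le_measure; rewrite ?inE //; apply: bigcup_sub => i /HB.
apply/eqP; rewrite eq_le le // andbT.
have := le _ (predC G) (measurableC mA) (fun i h => GC i h).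
rewrite probability_setC // fineB ?fin_num_measure //= -s1 [X in X - _](bigID G) /=.
by move=> h; lra.
Qed.

Variables (q : nat) (X : 'I_q.+1 -> {RV P >-> R}).

Definition sign_prob (s : option bool) : R :=
  if s is Some _ then (2 * (1 + q%:R^-1))^-1 else (q%:R + 1)^-1.

Hypotheses (q0 : (0 < q)%N) (iidX : iid_trace_variables X).

Lemma sum_sign_prob : \sum_s sign_prob s = 1.
Proof.
have q0' : (q%:R : R) != 0 by rewrite pnatr_eq0 -lt0n.
have q1 : (q%:R + 1 : R) != 0 by rewrite natr1 pnatr_eq0.
rewrite (bigD1 None) //= (bigD1 (Some true)) //= (bigD1 (Some false)) //=.
rewrite big_pred0; last by move=> [[]|].
by field; rewrite q0' q1.
Qed.

Lemma sign_prob_event i s : P (X i @^-1` [set (sign_val s)%:~R]) = (sign_prob s)%:E.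
Proof.
by case: (iidX.2 i) => h0 h1 h2; case: s => [[]|]; [exact: h1|exact: h2|exact: h0].
Qed.

(** The atoms fix the values of all variables; by independence their probabilities are products, and
    these sum to 1. *)
Lemma prob_sumE s : prob_sum X s =
  \sum_(e : {ffun 'I_q.+1 -> option bool} | \sum_i sign_val (e i) == s) \prod_i sign_prob (e i).
Proof.
pose E (e : {ffun 'I_q.+1 -> option bool}) : set T :=
  \bigcap_(i in [set i | i \in [set: 'I_q.+1]%SET]) X i @^-1` [set (sign_val (e i))%:~R].
have mE e : measurable (E e).
  apply: fin_bigcap_measurable => [|i _]; first exact: finite_finset.
  by rewrite -[X in measurable X]setTI; apply: measurable_funP.
have PE e : fine (P (E e)) = \prod_i sign_prob (e i).
  rewrite /E iidX.1; last by move=> i; exact: measurable_set1.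
  rewrite (eq_bigr (fun i => (sign_prob (e i))%:E)) => [|i _]; last exact: sign_prob_event.
  by rewrite prodEFin /=; apply: eq_bigl => i; rewrite inE.
have Eval e t i : E e t -> X i t = (sign_val (e i))%:~R.
  by move=> /(_ i); apply; rewrite /= inE.
have sign_inj : injective sign_val by move=> [[]|] [[]|].
rewrite /prob_sum (@probability_of_atoms _ E (fun e => \sum_i sign_val (e i) == s)) //.
- by apply: eq_bigr => e _.
- apply/trivIsetP => e e' _ _ ne; rewrite -subset0 => t [te te'].
  case/eqP: ne; apply/ffunP => i; apply: sign_inj; apply: (intr_inj (R := R)).
  by rewrite -(Eval e t) // (Eval e' t).
- rewrite (eq_bigr _ (fun e _ => PE e)) -(bigA_distr_bigA (fun _ => sign_prob)).
  by rewrite big1 // => i _; apply: sum_sign_prob.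
- have mS : measurable_fun setT (fun t => \sum_i X i t).
    by apply: measurable_sum => i; apply: measurable_funP.
  rewrite -[X in measurable X]setTI.
  exact: (mS measurableT [set s%:~R] (measurable_set1 _)).
- move=> e /eqP <- t te /=; rewrite raddf_sum /=; apply: eq_bigr => i _.
  exact: Eval.
- move=> e ne t te /= sE; case/eqP: ne; apply: (intr_inj (R := R)).
  by rewrite -sE raddf_sum /=; apply: eq_bigr => i _; rewrite (Eval e t).
Qed.

End DiscreteSum.

(** * Comparison *)

Section TraceRatio.
Variables (R : realType) (F : finFieldType).
Hypothesis oddF : odd #|F|.
Local Notation q := (#|F|%:R : R).
Implicit Types e : {ffun option F -> option bool}.

Definition pattern_prob e : R := \prod_P sign_prob R #|F| (e P).

Definition pattern_sum e : int := \sum_P sign_val (e P).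

Lemma sign_prob_ge0 s : 0 <= sign_prob R #|F| s.
Proof.
by case: s => [b|] /=; rewrite invr_ge0 ?mulr_ge0 ?addr_ge0 ?invr_ge0 ?ler0n.
Qed.

Lemma pattern_prob_ge0 e : 0 <= pattern_prob e.
Proof. by apply: prodr_ge0 => P _; apply: sign_prob_ge0. Qed.

Lemma card_gt0 : (0 < #|F|)%N.
Proof. by have := card_gt2 oddF; case: #|F|. Qed.

Lemma sum_pattern_prob : \sum_e pattern_prob e = 1.
Proof.
rewrite -(bigA_distr_bigA (fun _ => sign_prob R #|F|)) big1 // => P _.
by apply: sum_sign_prob; apply: card_gt0.
Qed.

Lemma half_card : ((#|F|.-1)./2%:R : R) = (q - 1) / 2.
Proof.
have qE : #|F| = ((#|F|.-1)./2 * 2).+1.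
  by move: oddF; case: #|F| => [|k] //=; rewrite muln2; move=> ek; rewrite even_halfK.
have : q = (#|F|.-1)./2%:R * 2 + 1 by rewrite [in LHS]qE -addn1 natrD natrM.
by move: (_./2%:R) => x ->; lra.
Qed.

(** Point by point: a zero weighs (q - 1) / q and a sign (q - 1) / 2, which are (q^2 - 1) / q times
    1 / (q + 1) and q / (2 (q + 1)). *)
Lemma pattern_ratioE e :
  pattern_ratio R e = ((q ^+ 2 - 1) / q) ^+ #|F|.+1 * pattern_prob e.
Proof.
have q0 : q != 0 by rewrite pnatr_eq0 -lt0n card_gt0.
have q1 : q + 1 != 0 by rewrite natr1 pnatr_eq0.
rewrite /pattern_ratio /pattern_weight natr_prod.
have -> : q ^+ nzeros e = \prod_P (if e P == None then q else 1).
  rewrite -big_mkcond /= prodr_const /nzeros; congr (_ ^+ _).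
  by apply: eq_card => P; rewrite inE.
rewrite -prodf_div.
have -> : ((q ^+ 2 - 1) / q) ^+ #|F|.+1 = \prod_(P : option F) ((q ^+ 2 - 1) / q).
  by rewrite prodr_const card_option.
rewrite -big_split /=; apply: eq_bigr => P _; case: (e P) => [b|] /=.
  by rewrite half_card divr1; field; rewrite q0 q1.
have -> : (#|F|.-1)%:R = q - 1 by rewrite -subn1 natrB ?card_gt0.
by field; rewrite q0 q1.
Qed.

Lemma sum_pattern_weight :
  \sum_(e : {ffun option F -> option bool}) (pattern_weight e)%:R = (2 * (q - 1)) ^+ #|F|.+1.
Proof.
under eq_bigr do rewrite natr_prod.
rewrite -(bigA_distr_bigA (fun _ s => (sign_weight F s)%:R : R)).
rewrite -[X in _ ^+ X](card_option F) -prodr_const; apply: eq_bigr => P _.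
rewrite (bigD1 None) //= (bigD1 (Some true)) //= (bigD1 (Some false)) //=.
rewrite big_pred0; last by move=> [[]|].
rewrite half_card (_ : (#|F|.-1)%:R = q - 1); last by rewrite -subn1 natrB ?card_gt0.
by field.
Qed.

(** Any bijection of the index set with the projective line serves, as the variables are identically
    distributed. *)
Lemma prob_sum_pattern (d : measure_display) (T : measurableType d) (P : probability T R)
    (X : 'I_(#|F|.+1) -> {RV P >-> R}) (s : int) : iid_trace_variables X ->
  prob_sum X s = \sum_(e | pattern_sum e == s) pattern_prob e.
Proof.
move=> iidX; rewrite (prob_sumE card_gt0 iidX).
have cE : #|{: option F}| = #|F|.+1 by rewrite card_option.
pose h (P : option F) : 'I_(#|F|.+1) := cast_ord cE (enum_rank P).
pose h' (i : 'I_(#|F|.+1)) : option F := enum_val (cast_ord (esym cE) i).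
have hK : cancel h h' by move=> P0; rewrite /h /h' cast_ordK enum_rankK.
have h'K : cancel h' h by move=> i; rewrite /h /h' enum_valK cast_ordKV.
have bh : bijective h by exists h'.
pose G (e : {ffun option F -> option bool}) : {ffun 'I_(#|F|.+1) -> option bool} :=
  [ffun i => e (h' i)].
have bG : bijective G.
  exists (fun e : {ffun 'I_(#|F|.+1) -> option bool} => [ffun P0 => e (h P0)]) => e;
    by apply/ffunP => i; rewrite !ffunE ?hK ?h'K.
rewrite (reindex G) /=; last exact: onW_bij.
apply: eq_big => [e|e _].
  rewrite /pattern_sum (reindex h) /=; last exact: onW_bij.
  by congr (_ == _); apply: eq_bigr => P0 _; rewrite ffunE hK.
rewrite /pattern_prob (reindex h) /=; last exact: onW_bij.
by apply: eq_bigr => P0 _; rewrite ffunE hK.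
Qed.

Variable g : nat.
Local Notation n := (2 * g + 2)%N.
Local Notation N := (2 * g + 3)%N.

Let NE : N = n.+1. Proof. by rewrite addnS. Qed.

Lemma mem_hyperelliptic (f : equation F g) : (f \in hyperelliptic_set F g) =
  `[< squarefree (f : {poly F}) >] && (n <= size (f : {poly F}))%N.
Proof.
apply/mem_hyperelliptic_set/andP => [h|[/asboolP sf sz]].
  by have /andP[-> _] := hyperelliptic_size h; split=> //; apply/asboolP; case: h.
split=> //; have := size_npoly f; move: (size _) sz; clear; lia.
Qed.

Lemma hyperelliptic_pattern (f : equation F g) e :
  (f \in squarefree_forms N n e) = (f \in hyperelliptic_set F g) && (pattern n f == e).
Proof.
by rewrite mem_hyperelliptic inE -NE size_npoly andbT -andbA.
Qed.

Lemma card_pattern_classes (S : pred {ffun option F -> option bool}) :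
  #|[set f in hyperelliptic_set F g | S (pattern n (f : {poly F}))]%SET| =
  (\sum_(e | S e) #|squarefree_forms N n e|)%N.
Proof.
rewrite -sum1_card.
rewrite (partition_big (fun f : equation F g => pattern n (f : {poly F})) S) /=; last first.
  by move=> f; rewrite !inE => /andP[].
apply: eq_bigr => e Se; rewrite -sum1_card; apply: eq_bigl => f.
have -> : (f \in [set f in hyperelliptic_set F g | S (pattern n (f : {poly F}))]%SET) =
  (f \in hyperelliptic_set F g) && S (pattern n (f : {poly F})) by rewrite !inE.
rewrite hyperelliptic_pattern; case: (f \in _) => //=.
by case: eqP => [->|]; rewrite ?Se ?andbF.
Qed.

Lemma trace_FrobeniusE_pattern (f : equation F g) :
  trace_Frobenius f = - pattern_sum (pattern n (f : {poly F})).
Proof.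
by rewrite trace_FrobeniusE //; congr (- _); apply: eq_bigr => P _; rewrite ffunE.
Qed.

Lemma trace_ratioE (s : int) : (1 < g)%N ->
  trace_ratio R F g s =
  (\sum_(e | pattern_sum e == s) (#|squarefree_forms N n e|)%:R) /
  (\sum_(e : {ffun option F -> option bool}) (#|squarefree_forms N n e|)%:R).
Proof.
move=> g1; rewrite /trace_ratio (weighted_card_moduli oddF g1); last first.
  by move=> f1 f2 h1 h2 i; rewrite (isomorphic_trace oddF g1 h1 h2 i).
rewrite (weighted_card_moduli oddF g1) //.
(* The pair of the identity shows that the common constant is nonzero, so it cancels in the
   ratio. *)
have U0 : ((size (moebius_pairs F g))%:R : R) != 0.
  rewrite pnatr_eq0 size_eq0; apply: contraTN (isT : true) => /eqP U0.
  have : (moeb 1 0 0 1, tofrac 1%:P / tofrac (lin 0 1) ^+ g.+1) \in moebius_pairs F g.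
    apply/moebius_pairsP; exists 1, 0, 0, 1, 1; split=> //.
      by rewrite mulr1 mulr0 subr0 oner_neq0.
    exact: oner_neq0.
  by rewrite U0.
rewrite invf_div mulrA divfK // -!natr_sum; congr (_%:R / _%:R).
  rewrite -(card_pattern_classes (fun e => pattern_sum e == s)); apply: eq_card => f.
  by rewrite !inE trace_FrobeniusE_pattern eqr_opp.
by rewrite -(card_pattern_classes predT); apply: eq_card => f; rewrite !inE.
Qed.

Lemma sum_squarefree_forms_ge :
  q ^+ N / 3 <= \sum_(e : {ffun option F -> option bool}) (#|squarefree_forms N n e|)%:R.
Proof.
have n0 : (0 < n)%N by rewrite addn2.
have := card_squarefree_ge (card_gt2 oddF) n0 NE.
rewrite -natr_sum -(card_pattern_classes predT) -(ler_nat R) natrX natrM.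
rewrite (eq_card (B := [set f in hyperelliptic_set F g | predT (pattern n (f : {poly F}))]%SET)).
  by rewrite ler_pdivrMr // mulrC.
by move=> f; have := mem_hyperelliptic f; rewrite !inE andbT => ->.
Qed.

Lemma pattern_class_bound (S : pred {ffun option F -> option bool}) (K : R) :
  (forall e, `|(#|squarefree_forms N n e|)%:R - K * pattern_ratio R e| <=
    2 * q ^+ g.+1 * (pattern_weight e)%:R) ->
  `|\sum_(e | S e) (#|squarefree_forms N n e|)%:R -
    K * ((q ^+ 2 - 1) / q) ^+ #|F|.+1 * \sum_(e | S e) pattern_prob e| <=
    2 * q ^+ g.+1 * (2 * (q - 1)) ^+ #|F|.+1.
Proof.
move=> est; rewrite mulr_sumr -sumrB; apply: le_trans (ler_norm_sum _ _ _) _.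
apply: le_trans (_ : \sum_(e | S e) 2 * q ^+ g.+1 * (pattern_weight e)%:R <= _).
  by apply: ler_sum => e _; rewrite -mulrA -pattern_ratioE.
rewrite -sum_pattern_weight mulr_sumr [leRHS](bigID S) /= lerDl.
by apply: sumr_ge0 => e _; rewrite !mulr_ge0 ?exprn_ge0 ?ler0n.
Qed.

(** The constant is 12 = 2 * 2 * 3: numerator and total both carry the error [E], the sieve
    contributes a factor 2, and the total is at least q^N / 3. *)
Lemma trace_ratio_estimate (s : int) : (1 < g)%N ->
  `|trace_ratio R F g s - \sum_(e | pattern_sum e == s) pattern_prob e| <=
    12 * 2 ^+ #|F|.+1 * (q ^+ #|F|.+1 / q ^+ g.+2).
Proof.
move=> g1; have q0 : 0 < q by rewrite ltr0n card_gt0.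
have hN : (2 * g.+1 < N)%N by clear; lia.
have [K] := squarefree_estimate R oddF hN.
rewrite (_ : 2 * g.+1 = n)%N; last by clear; lia.
move=> est; rewrite trace_ratioE //.
have hA := pattern_class_bound (fun e => pattern_sum e == s) est.
have := pattern_class_bound predT est; rewrite sum_pattern_prob mulr1.
have := sum_squarefree_forms_ge.
set k := K * _ in hA *; move: hA.
set p := \sum_(e | _) pattern_prob e.
have p1 : 0 <= p <= 1.
  apply/andP; split; first by apply: sumr_ge0 => e _; apply: pattern_prob_ge0.
  rewrite -sum_pattern_prob [leRHS](bigID (fun e => pattern_sum e == s)) /= lerDl.
  by apply: sumr_ge0 => e _; apply: pattern_prob_ge0.
move: p p1 => p /andP[p0 p1].
move: (\sum_(e | _) _%:R) (\sum_e _%:R) => a b.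
set E := 2 * q ^+ g.+1 * _ => hA hB hb.
have E0 : 0 <= E by rewrite !mulr_ge0 ?exprn_ge0 ?mulr_ge0 ?subr_ge0 ?ler1n ?card_gt0 ?ltW.
have qN : 0 < q ^+ N by rewrite exprn_gt0.
have b0 : 0 < b by apply: lt_le_trans hB; rewrite divr_gt0.
have hE : E <= 2 * q ^+ g.+1 * (2 ^+ #|F|.+1 * q ^+ #|F|.+1).
  rewrite /E; apply: ler_wpM2l; first by rewrite !mulr_ge0 // exprn_ge0 // ltW.
  have q1 : 1 <= q by rewrite ler1n card_gt0.
  by rewrite -exprMn; apply: lerXn2r; rewrite ?nnegrE; lra.
have -> : a / b - p = (a - p * b) / b by rewrite mulrBl mulfK ?gt_eqF.
rewrite normrM [X in _ * X]gtr0_norm ?invr_gt0 // ler_pdivrMr //.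
have hap : `|a - p * b| <= 2 * E.
  (* This eliminates the unknown [k]: [a] is within [E] of k p, and [b] within [E] of [k]. *)
  have -> : a - p * b = (a - k * p) - p * (b - k) by ring.
  apply: le_trans (ler_normB _ _) _; rewrite normrM (ger0_norm p0) mulr2n mulrDl !mul1r.
  by apply: lerD => //; apply: le_trans (ler_piMl _ p1) hb.
apply: le_trans hap _.
have qg : 0 < q ^+ g.+2 by rewrite exprn_gt0.
have qNE : q ^+ N = q ^+ g.+1 * q ^+ g.+2 by rewrite -exprD; congr (_ ^+ _); clear; lia.
apply: le_trans
  (_ : 12 * 2 ^+ #|F|.+1 * (q ^+ #|F|.+1 / q ^+ g.+2) * (q ^+ N / 3) <= _); last first.
  by rewrite ler_wpM2l // !mulr_ge0 ?invr_ge0 ?exprn_ge0 ?ltW.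
apply: le_trans (_ : 2 * (2 * q ^+ g.+1 * (2 ^+ #|F|.+1 * q ^+ #|F|.+1)) <= _).
  by rewrite ler_wpM2l.
rewrite qNE; move: (q ^+ g.+2) qg (q ^+ g.+1) (2 ^+ #|F|.+1) (q ^+ #|F|.+1) => x x0 y z t.
rewrite le_eqVlt; apply/orP; left; apply/eqP; field.
by rewrite gt_eqF.
Qed.

End TraceRatio.

Lemma big_ord_nth (R : Type) (idx : R) (op : R -> R -> R) (T : Type) (x0 : T) (s : seq T) m
    (f : T -> R) :
  size s = m -> \big[op/idx]_(i < m) f (nth x0 s i) = \big[op/idx]_(x <- s) f x.
Proof. by move=> <-; rewrite (big_nth x0) big_mkord. Qed.

(** * Lower bound for the probabilities in the model *)

Section LowerBound.
Context (R : realType) (d : measure_display) (T : measurableType d) (P : probability T R).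
Variables (q : nat) (X : 'I_q.+1 -> {RV P >-> R}).
Hypotheses (q0 : (0 < q)%N) (iidX : iid_trace_variables X).

Lemma sign_prob_Some_ge b : 4^-1 <= sign_prob R q (Some b).
Proof.
have q1 : (1 : R) <= q%:R by rewrite ler1n.
rewrite /sign_prob lef_pV2 ?posrE ?mulr_gt0 ?addr_gt0 ?invr_gt0 ?(lt_le_trans ltr01 q1) //.
have : (q%:R : R)^-1 <= 1 by rewrite invf_le1 // (lt_le_trans ltr01 q1).
by move=> ?; lra.
Qed.

(** One outcome suffices: |s| variables with the sign of [s], the others cancelling in pairs, and a
    single zero if parity requires it. *)
Lemma prob_sum_ge (s : int) : (`|s| <= q.+1)%N ->
  (q%:R + 1)^-1 * 4^-1 ^+ q.+1 <= prob_sum X s.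
Proof.
move=> sq; pose t := `|s|%N; pose r := ((q.+1 - t)./2)%N; pose z : nat := odd (q.+1 - t).
have [a [b [abz abs]]] : exists a b : nat, (a + b + z = q.+1)%N /\ (a%:Z - b%:Z = s).
  have [s0|s0] := leP 0 s.
    exists (t + r)%N, r; split; first by rewrite /z /r /t; move: sq; clear; lia.
    by rewrite /t; move: s0; clear; lia.
  exists r, (t + r)%N; split; first by rewrite /z /r /t; move: sq; clear; lia.
  by rewrite /t; move: s0; clear; lia.
have z1 : (z <= 1)%N by exact: leq_b1.
pose w := nseq a (Some true) ++ nseq b (Some false) ++ nseq z None.
have szw : size w = q.+1 by rewrite !size_cat !size_nseq -abz addnA.
pose e : {ffun 'I_q.+1 -> option bool} := [ffun i : 'I_q.+1 => nth None w i].
have sume : \sum_i sign_val (e i) = s.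
  under eq_bigr do rewrite ffunE.
  rewrite (big_ord_nth _ _ _ _ szw) !big_cat /= !big_nseq !iter_addr_0 /=.
  by rewrite mul0rn addr0 -abs mulNrn !natz.
have prode : (q%:R + 1)^-1 * 4^-1 ^+ q.+1 <= \prod_i sign_prob R q (e i).
  under eq_bigr do rewrite ffunE.
  rewrite (big_ord_nth _ _ _ _ szw) !big_cat /= !big_nseq !iter_mulr_1 /=.
  have p4 := sign_prob_Some_ge true; rewrite /= in p4; set p := (2 * _)^-1 in p4 *.
  have pq : 0 <= (q%:R + 1 : R)^-1 <= 1.
    by rewrite invr_ge0 natr1 ler0n invf_le1 ?ltr0n // ler1n.
  rewrite mulrA -exprD.
  have pab : 4^-1 ^+ q.+1 <= p ^+ (a + b).
    apply: le_trans (_ : 4^-1 ^+ (a + b) <= _); last by apply: lerXn2r; rewrite ?nnegrE //; lra.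
    by apply: ler_wiXn2l; [lra | lra | rewrite -abz leq_addr].
  rewrite mulrC; apply: ler_pM => //; rewrite ?exprn_ge0 //.
  by case: (z) z1 => [|[|?]] // _; rewrite expr0; case/andP: pq.
rewrite (prob_sumE q0 iidX); apply: le_trans prode _.
rewrite (bigD1 e) /=; last by rewrite sume.
rewrite lerDl; apply: sumr_ge0 => e' _; apply: prodr_ge0 => i _.
by case: (e' i) => [b'|] /=; rewrite invr_ge0 ?mulr_ge0 ?addr_ge0 ?invr_ge0 ?ler0n.
Qed.

End LowerBound.

(** For k >= 256, k^(k/2) >= 16^k while k + 1 <= 2^k, so 8^k (k + 1) <= 16^k. For smaller k the left
    side is bounded by the constant and k^(k/2) >= 1. *)
Lemma exp_le_powR (R : realType) (k : nat) : (0 < k)%N ->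
  12 * 8 ^+ k.+1 * (k%:R + 1) <= 12 * 8 ^+ 257 * 257 * k%:R `^ (k%:R / 2) :> R.
Proof.
move=> k0; have [k256|k256] := leqP k 255.
  rewrite -[leLHS]mulr1; apply: ler_pM => //.
  - apply: ler_pM; rewrite ?mulr_ge0 ?exprn_ge0 ?addr_ge0 //.
      rewrite ler_wpM2l //; apply: ler_weXn2l; last by rewrite ltnS (leq_trans k256).
      by lra.
    by rewrite natr1 ler_nat ltnS (leq_trans k256).
  - rewrite -[leLHS](powRr0 (k%:R : R)); apply: ler_powR; first by rewrite ler1n.
    by rewrite divr_ge0.
have le16 : 16 ^+ k <= k%:R `^ (k%:R / 2) :> R.
  have -> : 16 ^+ k = 256 `^ (k%:R / 2) :> R.
    have -> : (256 : R) = 16 `^ 2%:R by rewrite powR_mulrn //; ring.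
    by rewrite -powRrM mulrCA divff // mulr1 powR_mulrn.
  apply: ge0_ler_powR; rewrite ?nnegrE ?divr_ge0 //.
  by rewrite ler_nat.
apply: le_trans (_ : 12 * 8 ^+ 257 * 257 * 16 ^+ k <= _); last first.
  by rewrite ler_wpM2l // !mulr_ge0 // exprn_ge0.
have k2 : (k%:R + 1 : R) <= 2 ^+ k by rewrite natr1 -natrX ler_nat ltn_expl.
apply: le_trans (_ : 12 * 8 ^+ k.+1 * 2 ^+ k <= _).
  by rewrite ler_wpM2l // mulr_ge0 // exprn_ge0.
rewrite exprS mulrA -[leLHS]mulrA -exprMn (_ : 8 * 2 = 16 :> R); last by ring.
apply: ler_wpM2r; first by rewrite exprn_ge0.
rewrite -mulrA ler_wpM2l // (exprS _ 256) -mulrA ler_peMr // mulr_ege1 //; last by lra.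
by apply: exprn_ege1; lra.
Qed.

(** * The absolute error in every positive genus *)

Section TraceRatioBounds.
Variables (R : realType) (F : finFieldType).
Hypothesis oddF : odd #|F|.
Context (d : measure_display) (T : measurableType d) (P : probability T R).
Variable X : 'I_(#|F|.+1) -> {RV P >-> R}.
Hypothesis iidX : iid_trace_variables X.
Local Notation q := (#|F|%:R : R).

Lemma trace_ratio_ge0_le1 g s : 0 <= trace_ratio R F g s <= 1.
Proof.
have w0 (S : pred (equation F g)) : 0 <= weighted_card R S.
  by apply: sumr_ge0 => f _; rewrite invr_ge0.
have le : weighted_card R (fun f : equation F g => trace_Frobenius f == - s) <=
    weighted_card R (fun _ : equation F g => true).
  rewrite /weighted_card big_mkcondr /= [leRHS]big_mkcondr /=; apply: ler_sum => f _.
  by case: ifP => // _; rewrite invr_ge0.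
apply/andP; split; first by rewrite divr_ge0.
(* If the total weight were 0, division by zero would give the ratio 0. *)
rewrite /trace_ratio; have [->|w1] := eqVneq (weighted_card R (fun _ : equation F g => true)) 0.
  by rewrite invr0 mulr0.
by rewrite ler_pdivrMr ?mul1r // lt_def w1 w0.
Qed.

(** For g = 1 the right side is at least 1, as q^(q+1) >= q^3, and both quantities on the left lie
    in [0, 1]. *)
Lemma trace_ratio_prob_sum g (s : int) : (0 < g)%N ->
  `|trace_ratio R F g s - prob_sum X s| <=
    12 * 2 ^+ #|F|.+1 * (q ^+ #|F|.+1 / q ^+ g.+2).
Proof.
have q3 : (3 <= #|F|)%N := card_gt2 oddF.
have q1 : 1 <= q by rewrite ler1n (leq_trans _ q3).
case: g => [//|[|g]] _; last by rewrite (prob_sum_pattern oddF _ iidX) trace_ratio_estimate.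
apply: le_trans (_ : 1 <= _).
  have /andP[r0 r1] := trace_ratio_ge0_le1 1 s.
  have /andP[p0 p1] : 0 <= prob_sum X s <= 1.
    rewrite (prob_sum_pattern oddF _ iidX); apply/andP; split.
      by apply: sumr_ge0 => e _; apply: pattern_prob_ge0.
    rewrite -(sum_pattern_prob R oddF) [leRHS](bigID (fun e => pattern_sum e == s)) /= lerDl.
    by apply: sumr_ge0 => e _; apply: pattern_prob_ge0.
  by rewrite ler_norml; move: r0 r1 p0 p1; move: (trace_ratio _ _ _ _) (prob_sum _ _) => x y *; lra.
apply: mulr_ege1; last first.
  rewrite ler_pdivlMr ?mul1r ?exprn_gt0 ?(lt_le_trans ltr01 q1) //.
  by apply: ler_weXn2l => //; rewrite ltnW.
by apply: mulr_ege1; [lra | apply: exprn_ege1; lra].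
Qed.

End TraceRatioBounds.

(** * Limit distribution and relative error *)

Local Open Scope classical_set_scope.
Local Open Scope ring_scope.

Theorem theorem1p1 (R : realType) :
  (forall (F : finFieldType) (d : measure_display) (T : measurableType d)
      (P : probability T R) (X : 'I_(#|F|.+1) -> {RV P >-> R}) (s : int),
    odd #|F| -> iid_trace_variables X ->
    (fun g : nat => trace_ratio R F g s) @ \oo --> prob_sum X s)
  /\
  exists C : R,
    forall (F : finFieldType) (d : measure_display) (T : measurableType d)
      (P : probability T R) (X : 'I_(#|F|.+1) -> {RV P >-> R})
      (g : nat) (s : int),
    odd #|F| -> iid_trace_variables X -> (0 < g)%N ->
    `|s| <= (#|F|.+1)%:Z ->
    exists2 e : R,
      trace_ratio R F g s = prob_sum X s * (1 + e)
      & `|e| <= C * #|F|%:R `^ ((3 * #|F|%:R - 2 - 2 * g%:R) / 2).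
Proof.
split=> [F d T P X s oddF iidX|].
  have q3 := card_gt2 oddF; have q0 : (0 : R) < #|F|%:R by rewrite ltr0n (leq_trans _ q3).
  (* With this [M], the bound of [trace_ratio_prob_sum] is the geometric sequence M q^-g. *)
  pose M : R := 12 * 2 ^+ #|F|.+1 * #|F|%:R ^+ #|F|.+1 / #|F|%:R ^+ 2.
  have geo : (fun g : nat => M * (#|F|%:R^-1) ^+ g) @ \oo --> (0 : R).
    apply: cvg_geometric; rewrite ger0_norm ?invr_ge0 ?ltW // invf_lt1 //.
    by rewrite ltr1n (leq_trans _ q3).
  apply/cvgrPdist_le => eps eps0.
  have /cvgrPdist_le/(_ eps eps0) := geo; apply: filterS2 (nbhs_infty_ge 1) => g g1 h.
  rewrite distrC; apply: le_trans (trace_ratio_prob_sum oddF iidX s g1) _.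
  move: h; rewrite sub0r normrN; apply: le_trans; apply: le_trans (ler_norm _).
  rewrite /M -(addn2 g) exprD exprVn invfM !mulrA.
  by rewrite le_eqVlt; apply/orP; left; apply/eqP; rewrite mulrAC.
(* exp_le_powR: for q >= 256 the factor q^(q/2) dominates 16^q; smaller q are absorbed in C. *)
exists (12 * 8 ^+ 257 * 257) => F d T P X g s oddF iidX g0 sq.
have q3 := card_gt2 oddF; have F0 : (0 < #|F|)%N by rewrite (leq_trans _ q3).
have q0 : (0 : R) < #|F|%:R by rewrite ltr0n.
have sq' : (`|s| <= #|F|.+1)%N by rewrite -lez_nat abszE.
have pge := prob_sum_ge F0 iidX sq'.
have l0 : 0 < (#|F|%:R + 1)^-1 * 4^-1 ^+ #|F|.+1 :> R.
  by rewrite mulr_gt0 ?exprn_gt0 ?invr_gt0 // ?addr_gt0.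
have p0 := lt_le_trans l0 pge.
have est := trace_ratio_prob_sum oddF iidX s g0.
exists (trace_ratio R F g s / prob_sum X s - 1).
  by rewrite addrC subrK mulrC divfK // gt_eqF.
have -> : trace_ratio R F g s / prob_sum X s - 1 =
    (trace_ratio R F g s - prob_sum X s) / prob_sum X s.
  by rewrite mulrBl divff // gt_eqF.
rewrite normrM [X in _ * X]gtr0_norm ?invr_gt0 //.
(* The part (q + 1) - (g + 2) of the exponent is that of the absolute error; q^(q/2) remains to
   absorb the division by the probability. *)
have -> : (3 * #|F|%:R - 2 - 2 * g%:R) / 2 = #|F|%:R / 2 + (#|F|.+1%:R - g.+2%:R) :> R.
  by rewrite -[#|F|.+1]addn1 -[g.+2]addn2 !natrD; lra.
rewrite powRD; last by rewrite [X in _ ==> ~~ X]gt_eqF // implybT.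
have -> : #|F|%:R `^ (#|F|.+1%:R - g.+2%:R) = #|F|%:R ^+ #|F|.+1 / #|F|%:R ^+ g.+2 :> R.
  rewrite powRB; last by rewrite [X in _ ==> ~~ X]gt_eqF // implybT.
  by rewrite !powR_mulrn // ltW.
set Q := _ / _ ^+ g.+2 in est *.
have Q0 : 0 <= Q by rewrite divr_ge0 // exprn_ge0 // ltW.
rewrite mulrA; apply: le_trans (ler_wpM2r Q0 (exp_le_powR R F0)).
(* Dividing by the lower bound of [prob_sum_ge] brings in (q + 1) 4^(q+1), which turns 2^(q+1) into
   8^(q+1). *)
apply: le_trans (_ : 12 * 2 ^+ #|F|.+1 * Q / ((#|F|%:R + 1)^-1 * 4^-1 ^+ #|F|.+1) <= _).
  by apply: ler_pM => //; rewrite ?invr_ge0 ?(ltW p0) // lef_pV2 ?posrE.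
rewrite invfM invrK exprVn invrK le_eqVlt; apply/orP; left; apply/eqP.
have -> : (8 : R) = 2 * 4 by ring.
rewrite exprMn; ring.
Qed.
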